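(* Let $f\in\mathcal{S}(\mathbb{R}^2;S^2)$ be a symmetric $2$-tensor field in $\mathbb{R}^2$. The following statements are equivalent. (a) $f$ has mean zero, i.e. $\int_{\mathbb{R}^2} f_{ij}(x)\,dx=0$ for all $1\le i,j\le 2$. (b) There exist a uniquely determined smooth symmetric $2$-tensor field $g\in C^\infty(\mathbb{R}^2;S^2)$ and a uniquely determined smooth scalar field $v\in C^\infty(\mathbb{R}^2)$ such that all of the following hold: $$f=g+\mathrm{d}^2v,\qquad \delta^2 g=0,$$ $$g(x)\to 0\ \text{ and }\ v(x)\to 0\quad\text{as } |x|\to\infty,$$ $$|g(x)|\lesssim (1+|x|)^{-2},\qquad |\mathrm{d}^\ell v(x)|\lesssim (1+|x|)^{-\ell}\quad\text{for } \ell=0,1.$$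
   Context: $S^2=S^2(\mathbb{R}^2)$ is the space of symmetric $2$-tensors on $\mathbb{R}^2$. $C^\infty(\mathbb{R}^2;S^2)$ (resp. $\mathcal{S}(\mathbb{R}^2;S^2)$) is the space of symmetric $2$-tensor fields $f=(f_{ij})$ whose components are smooth (resp. belong to the Schwartz space $\mathcal{S}(\mathbb{R}^2)$). $\mathrm{d}$ is the symmetrized derivative; for a scalar function $v$, $\mathrm{d}^0v=v$, $(\mathrm{d}v)_i=\partial_{x_i}v$, and $\mathrm{d}^2v$ is the Hessian, $(\mathrm{d}^2v)_{ij}=\partial_{x_i}\partial_{x_j}v$. $\delta$ is the divergence, so $\delta^2g=\sum_{i,j=1}^2\partial_{x_i}\partial_{x_j}g_{ij}$. The notation $A(x)\lesssim B(x)$ means that there is a constant $C$ independent of $x\in\mathbb{R}^2$ with $A(x)\le C\,B(x)$ for all $x$. *)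

(* Defs.v *)
From HB Require Import structures.
From mathcomp Require Export all_boot all_order all_algebra.
From mathcomp Require Export all_classical all_reals all_analysis.

Set Implicit Arguments.
Unset Strict Implicit.
Unset Printing Implicit Defensive.

Import Order.TTheory GRing.Theory Num.Theory.
Import numFieldNormedType.Exports.
Local Open Scope classical_set_scope.
Local Open Scope ring_scope.

Section PlaneTensorFields.
Variable R : realType.

(* Coordinates are numbered 0 and 1. *)
Definition evec (i : 'I_2) : R * R := if i == 0 then (1, 0) else (0, 1).
Definition coordinate (i : 'I_2) (x : R * R) : R := if i == 0 then x.1 else x.2.

Definition partial (i : 'I_2) (u : R * R -> R) : R * R -> R := 'D_(evec i) u.

(* partials [:: i1; ...; ik] u = d_{i1} (... (d_{ik} u)) *)
Definition partials (s : seq 'I_2) (u : R * R -> R) : R * R -> R :=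
  foldr partial u s.

(* The derivability clause is needed because 'D_v is a total operator, whose
   value where the limit does not exist is meaningless. *)
Definition smooth (u : R * R -> R) : Prop :=
  forall s : seq 'I_2, continuous (partials s u) /\
    forall (i : 'I_2) (x : R * R), derivable (partials s u) x (evec i).

Definition schwartz (u : R * R -> R) : Prop :=
  smooth u /\
  forall (a b : nat) (s : seq 'I_2), exists C : R, forall x : R * R,
    `|coordinate 0 x ^+ a * coordinate 1 x ^+ b * partials s u x| <= C.

(* The library norms on R * R and on matrices are sup norms; |x|, |g(x)| and
   |dv(x)| below are Euclidean. *)
Definition abs2 (x : R * R) : R := Num.sqrt (\sum_i coordinate i x ^+ 2).
Definition enorm m n (A : 'M[R]_(m, n)) : R :=
  Num.sqrt (\sum_i \sum_j A i j ^+ 2).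

Definition at_infinity : set_system (R * R) :=
  [set A | exists M : R, forall x : R * R, M < abs2 x -> A x].

Global Instance at_infinity_properfilter : ProperFilter at_infinity.
Proof.
split=> [[M /= MF]|].
  apply: (MF (`|M| + 1, 0)); rewrite /abs2 big_ord_recl big_ord1 /coordinate /=.
  rewrite expr0n /= addr0 sqrtr_sqr ger0_norm ?addr_ge0//.
  by rewrite (le_lt_trans (ler_norm M))// ltrDl.
split=> [|P Q [M MP] [N NQ]|P Q PQ [M MP]].
- by exists 0.
- exists (Num.max M N) => x; rewrite gt_max => /andP[Mx Nx].
  by split; [exact: MP|exact: NQ].
- by exists M => x /MP /PQ.
Qed.

Definition lesssim (A B : R * R -> R) : Prop :=
  exists C : R, forall x : R * R, A x <= C * B x.

Definition entry (g : R * R -> 'M[R]_2) (i j : 'I_2) : R * R -> R :=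
  fun x => g x i j.

Definition sym_field (g : R * R -> 'M[R]_2) : Prop :=
  forall x, g x \is symmetricmx.

Definition smooth_sym (g : R * R -> 'M[R]_2) : Prop :=
  sym_field g /\ forall i j, smooth (entry g i j).

Definition schwartz_sym (g : R * R -> 'M[R]_2) : Prop :=
  sym_field g /\ forall i j, schwartz (entry g i j).

Definition grad (v : R * R -> R) (x : R * R) : 'rV[R]_2 :=
  \row_i partial i v x.

Definition hess (v : R * R -> R) (x : R * R) : 'M[R]_2 :=
  \matrix_(i, j) partial i (partial j v) x.

Definition divdiv (g : R * R -> 'M[R]_2) (x : R * R) : R :=
  \sum_i \sum_j partial i (partial j (entry g i j)) x.

Definition mean_zero (f : R * R -> 'M[R]_2) : Prop :=
  forall i j, (\int[(lebesgue_measure \x lebesgue_measure)%E]_x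
                 (entry f i j x)%:E = 0)%E.

Definition decaying_decomposition (f g : R * R -> 'M[R]_2) (v : R * R -> R) : Prop :=
  [/\ smooth_sym g /\ smooth v,
      (forall x, f x = g x + hess v x) /\ (forall x, divdiv g x = 0),
      g @ at_infinity --> (0 : 'M[R]_2) /\ v @ at_infinity --> (0 : R),
      lesssim (fun x => enorm (g x)) (fun x => (1 + abs2 x) ^- 2) &
      lesssim (fun x => `|v x|) (fun x => (1 + abs2 x) ^- 0) /\
      lesssim (fun x => enorm (grad v x)) (fun x => (1 + abs2 x) ^- 1)].

End PlaneTensorFields.

(* Main.v *)
Require Import Defs.
From HB Require Import structures.
From mathcomp Require Import ring lra measurable_realfun.
Import Order.TTheory GRing.Theory Num.Theory.
Import numFieldNormedType.Exports.
Set Implicit Arguments.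
Unset Strict Implicit.
Unset Printing Implicit Defensive.
Local Open Scope classical_set_scope.
Local Open Scope ring_scope.

(** Taking [divdiv] in [f = g + hess v] turns the constraint [divdiv g = 0] into
    the biharmonic equation [lap (lap v) = divdiv f], and [g] is determined by
    [v]. The theorem is thus about the solutions of this equation that decay.

    Uniqueness. The difference [w] of two potentials is biharmonic, and [lap w]
    is the trace of the difference of the two fields [g], so that [lap w] and [w]
    both tend to zero at infinity. The maximum principle shows that [lap w]
    vanishes, and then that [w] does ([biharmonic_vanishing]).

    Existence. The kernel of [d_i d_j Laplace^-2] grows logarithmically; that of
    [d_i d_j d_k Laplace^-2] is homogeneous of degree -1. This is where the means
    come in: a Schwartz function of mean zero is a divergence [sum_k d_k F_k] of
    Schwartz functions ([mean_zero_divergence]), so that [v] can be taken to be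
    the sum of the [d_i d_j d_k Laplace^-2 F_ijk]. It then decays like [1 / |x|]
    and each derivative gains a power of [|x|], which is more than what is
    required. No singular kernel is ever differentiated:
    - the only integral operator is [newton k = d_k Laplace^-1]. In polar
      coordinates centred at the point of evaluation its weight is bounded, so it
      is a superposition of translates and commutes with derivatives;
    - integrating a radial derivative along rays, an angular one along circles and
      the derivative of [r F] along rays gives three identities ([newton_div],
      [newton_curl], [newton_euler]) that determine the gradient of [newton k F]
      algebraically. Hence the bound [newton_decay] on [newton k F] itself
      propagates to all derivatives ([newton_pds_decay]);
    - [potential i j k] expresses [d_i d_j d_k Laplace^-2] by the commutator of
      [newton] with the multiplication by [x_i].

    Necessity of the vanishing means. On the square [[-N, N]^2] test the equation
    [f = g + hess v] against [(d_i d_j phi)], where [phi] is a product of two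
    polynomials rescaled to the square, flat on its boundary. Two integrations by
    parts remove [g], and bring four derivatives of [phi], of size [N^-4], against
    [v] ([box_pairing]). After multiplication by [N^2], the side of [f] tends to a
    combination of the means of [f], with coefficients given by the second
    derivatives of [phi] at the origin, while the side of [v] is controlled by the
    average of [|v|] over the square, which tends to zero. Three choices of [phi]
    isolate the three means. *)

(** * Partial derivatives in the plane *)

(** Locked, as conversion would otherwise unfold iterated derivatives down to
    limits of difference quotients. *)
HB.lock Definition pd (R : realType) (i : 'I_2) (u : R * R -> R) := partial i u.

Section Calculus.
Variable R : realType.
Implicit Types (u v : R * R -> R) (x y : R * R) (i j : 'I_2).

Lemma ord2P (P : 'I_2 -> Prop) : P 0 -> P 1 -> forall i, P i.
Proof.
move=> P0 P1 [[|[|//]] ilt].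
- by have -> : Ordinal ilt = 0 by apply/val_inj.
- by have -> : Ordinal ilt = 1 by apply/val_inj.
Qed.

Lemma norm_evec i : `|evec R i| = 1.
Proof.
rewrite /evec; case: ifP => _; rewrite prod_normE/= normr1 normr0; apply/eqP.
  by rewrite eq_maxl ler01.
by rewrite eq_maxr ler01.
Qed.

Lemma sum2E (F : 'I_2 -> R) : \sum_i F i = F 0 + F 1.
Proof. by rewrite big_ord_recl big_ord1; congr (_ + F _); apply/val_inj. Qed.

Lemma difference_quotient_line u (x e : R * R) (s h : R) :
  h^-1 *: (((fun s => u (x + s *: e)) \o shift s) (h *: 1) - u (x + s *: e)) =
  h^-1 *: ((u \o shift (x + s *: e)) (h *: e) - u (x + s *: e)).
Proof. by congr (_ *: (u _ - _)); rewrite /= [h%:A]mulr1 scalerDl addrCA. Qed.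

Lemma is_derive_line u (x e : R * R) (s : R) :
  derivable u (x + s *: e) e ->
  is_derive s 1 (fun s => u (x + s *: e)) ('D_e u (x + s *: e)).
Proof.
move=> ud; split; rewrite /derivable /derive.
  by under eq_fun do rewrite difference_quotient_line.
by under eq_fun do rewrite difference_quotient_line.
Qed.

Lemma MVT_line u (x e : R * R) (t : R) : (forall y, derivable u y e) ->
  exists2 s : R, `|s| <= `|t| & u (x + t *: e) - u x = t * 'D_e u (x + s *: e).
Proof.
move=> ud; have D s := is_derive_line (ud (x + s *: e)).
have C (a b : R) : {within `[a, b], continuous (fun s => u (x + s *: e))}.
  by apply: derivable_within_continuous => s _; have [] := D s.
have [t0|t0|->] := ltgtP t 0; last first.
- by exists 0; rewrite ?normr0// scale0r addr0 subrr mul0r.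
- have [s] := MVT t0 (fun s _ => D s) (C _ _).
  rewrite in_itv/= scale0r addr0 subr0 mulrC => /andP[s0 st] ->; exists s => //.
  by rewrite !gtr0_norm// ltW.
- have [s] := MVT t0 (fun s _ => D s) (C _ _).
  rewrite in_itv/= scale0r addr0 sub0r => /andP[ts s0] E; exists s.
    by rewrite !ltr0_norm// lerN2 ltW.
  by rewrite -opprB E mulrN opprK mulrC.
Qed.

Lemma differential_of_remainder (V W : normedModType R) (f : V -> W) (x : V)
    (df : {linear V -> W}) : continuous df ->
  (forall e : R, 0 < e -> \forall h \near (0 : V),
     `|f (h + x) - (f x + df h)| <= e * `|h|) ->
  differentiable f x /\ 'd f x = df :> (V -> W).
Proof.
move=> dfc rem.
have E : f \o shift x = cst (f x) + df +o_ 0 id.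
  by apply/eqaddoP => _/posnumP[e]; exact: rem.
have D := diff_unique dfc E; split => //.
by apply/diff_locallyP; rewrite D.
Qed.

Lemma pdE i u : pd i u = partial i u. Proof. by rewrite unlock. Qed.

Lemma pd_derive i u x : pd i u x = 'D_(evec R i) u x.
Proof. by rewrite pdE. Qed.

Lemma derive_translate u (x e t : R * R) :
  'D_e (fun y => u (y + t)) x = 'D_e u (x + t).
Proof.
by rewrite /derive /=; under eq_fun do rewrite -addrA.
Qed.

Lemma derivable_translate u (x e t : R * R) :
  derivable u (x + t) e -> derivable (fun y => u (y + t)) x e.
Proof.
move=> /derivable1P ud; apply/derivable1P.
by under eq_fun do rewrite -addrA.
Qed.

Record C1 u : Prop := IsC1 {
  C1_derivable : forall i y, derivable u y (evec R i);
  C1_continuous : forall i, continuous (pd i u) }.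

Section Differential.
Variables (u : R * R -> R).
Hypothesis C1u : C1 u.

Definition lin_form (a b : R) (h : R * R) : R := h.1 * a + h.2 * b.

Lemma lin_form_is_linear a b : linear (lin_form a b).
Proof. by move=> k x y; rewrite /lin_form/= !mulrDl scalerDr -!mulrA addrACA. Qed.

Lemma continuous_lin_form a b : continuous (lin_form a b).
Proof.
move=> x; apply: cvgD; apply: cvgMl; [exact: cvg_fst|exact: cvg_snd].
Qed.

Lemma pair_evecE (x h : R * R) : x + h = x + h.1 *: evec R 0 + h.2 *: evec R 1.
Proof.
rewrite /evec/=; case: x h => x1 x2 [h1 h2] /=.
by congr pair => /=; rewrite ?scaler0 ?addr0 [_%:A]mulr1 .
Qed.

(** The increment along a path made of two segments parallel to the axes is given
    by the mean value theorem on each of them, and the partial derivatives at the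
    intermediate points are close to those at [x]. *)
Lemma C1_differential x : differentiable u x /\
  ('d u x : R * R -> R) = lin_form (pd 0 u x) (pd 1 u x).
Proof.
set a := pd 0 u x; set b := pd 1 u x.
pose l1 := GRing.isLinear.Build _ _ _ _ _ (lin_form_is_linear a b).
pose l2 : {linear _ -> _} := HB.pack (lin_form a b) l1.
apply: (@differential_of_remainder _ _ u x l2); first exact: continuous_lin_form.
rewrite {}/l2 /= {l1}.
move=> e e0.
have e2 : 0 < e / 2 by rewrite divr_gt0.
have /cvgrPdist_lt/(_ _ e2)/nbhs_ballP[r0 /= r00 H0] := @C1_continuous _ C1u 0 x.
have /cvgrPdist_lt/(_ _ e2)/nbhs_ballP[r1 /= r10 H1] := @C1_continuous _ C1u 1 x.
apply/nbhs_ballP; exists (Num.min r0 r1) => /= [|h]; first by rewrite lt_min r00.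
rewrite -ball_normE /ball_/= sub0r normrN lt_min => /andP[hr0 hr1].
have h1 : `|h.1| <= `|h| by rewrite prod_normE le_max lexx.
have h2 : `|h.2| <= `|h| by rewrite prod_normE le_max lexx orbT.
rewrite (addrC h) pair_evecE.
have [s sh1 E0] := MVT_line x h.1 (@C1_derivable _ C1u 0).
have [t th2 E1] := MVT_line (x + h.1 *: evec R 0) h.2 (@C1_derivable _ C1u 1).
have {}H0 : `|pd 0 u (x + s *: evec R 0) - a| <= e / 2.
  rewrite distrC ltW//; apply: H0; rewrite -ball_normE /ball_/=.
  rewrite opprD addNKr normrN normrZ (le_lt_trans _ hr0)//.
  by rewrite norm_evec mulr1 (le_trans sh1).
have {}H1 : `|pd 1 u (x + h.1 *: evec R 0 + t *: evec R 1) - b| <= e / 2.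
  rewrite distrC ltW//; apply: H1; rewrite -ball_normE /ball_/=.
  rewrite -addrA opprD addNKr normrN (le_lt_trans _ hr1)//.
  rewrite /evec prod_normE/= !scaler0 addr0 add0r [h.1%:A]mulr1 [t%:A]mulr1.
  by rewrite ge_max le_max lexx/= le_max th2 orbT.
have -> : u (x + h.1 *: evec R 0 + h.2 *: evec R 1) - (u x + lin_form a b h) =
    h.1 * (pd 0 u (x + s *: evec R 0) - a) +
    h.2 * (pd 1 u (x + h.1 *: evec R 0 + t *: evec R 1) - b).
  by rewrite /lin_form !mulrBr !pd_derive -E0 -E1; ring.
rewrite (le_trans (ler_normD _ _))// !normrM [e in leRHS]splitr mulrDl.
by apply: lerD; rewrite mulrC ler_pM.
Qed.

Lemma is_derive_curve (c1 c2 : R -> R) (t d1 d2 : R) :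
  is_derive t 1 c1 d1 -> is_derive t 1 c2 d2 ->
  is_derive t 1 (fun t => u (c1 t, c2 t))
    (d1 * pd 0 u (c1 t, c2 t) + d2 * pd 1 u (c1 t, c2 t)).
Proof.
move=> [/derivable1_diffP cd1 cE1] [/derivable1_diffP cd2 cE2].
have [du0 duE] := C1_differential (c1 t, c2 t).
have cd := differentiable_pair cd1 cd2.
have ucd := differentiable_comp cd du0.
split; first exact: (iffRL (derivable1_diffP _ _) ucd).
rewrite -[LHS]/('D_1 (u \o (fun t => (c1 t, c2 t))) t) (deriveE (1 : R) ucd).
rewrite (diff_comp cd du0) /= duE (diff_pair cd1 cd2) /lin_form /=.
by rewrite -(deriveE (1 : R) cd1) -(deriveE (1 : R) cd2) cE1 cE2.
Qed.
End Differential.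

(** Second differences computed in the two possible orders both tend to the
    corresponding mixed derivative. *)
Lemma pdC u :
  C1 u -> (forall i, C1 (pd i u)) ->
  forall i j, pd i (pd j u) = pd j (pd i u).
Proof.
move=> C1u C2u.
suff H : pd 0 (pd 1 u) = pd 1 (pd 0 u).
  move=> i j; elim/ord2P: i; elim/ord2P: j; rewrite ?H; reflexivity.
have key i j x t : exists s1 s2 : R, [/\ `|s1| <= `|t|, `|s2| <= `|t| &
    u (x + t *: evec R i + t *: evec R j) - u (x + t *: evec R i) -
    (u (x + t *: evec R j) - u x) =
    t * (t * pd j (pd i u) (x + s1 *: evec R i + s2 *: evec R j))].
  have dw y : derivable (fun y => u (y + t *: evec R j) - u y) y (evec R i).
    by apply: derivableB; [exact/derivable_translate/(C1_derivable C1u)|exact: (C1_derivable C1u)].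
  have Dw y : 'D_(evec R i) (fun y => u (y + t *: evec R j) - u y) y =
      pd i u (y + t *: evec R j) - pd i u y.
    rewrite deriveB; [by rewrite derive_translate !pd_derive| |exact: (C1_derivable C1u)].
    exact/derivable_translate/(C1_derivable C1u).
  have [s1 s1t E1] := MVT_line x t dw.
  have [s2 s2t E2] := MVT_line (x + s1 *: evec R i) t (@C1_derivable _ (C2u i) j).
  exists s1, s2; split => //.
  by rewrite E1 Dw E2 pd_derive.
apply/funext => x; apply/eqP; rewrite -subr_eq0 -normr_le0.
apply/ler_addgt0Pr => e e0; rewrite add0r.
have e2 : 0 < e / 2 by rewrite divr_gt0.
have /cvgrPdist_lt/(_ _ e2)/nbhs_ballP[r0 /= r00 H0] := @C1_continuous _ (C2u 0) 1 x.
have /cvgrPdist_lt/(_ _ e2)/nbhs_ballP[r1 /= r10 H1] := @C1_continuous _ (C2u 1) 0 x.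
pose t := Num.min r0 r1 / 2.
have t0 : 0 < t by rewrite divr_gt0// lt_min r00.
have tr : t < Num.min r0 r1 by rewrite /t ltr_pdivrMr// mulr2n mulrDr mulr1 ltrDl lt_min r00.
have /andP[tr0 tr1] : (t < r0) && (t < r1) by rewrite -lt_min.
have [s1 [s2 [s1t s2t E1]]] := key 0 1 x t.
have [s3 [s4 [s3t s4t E2]]] := key 1 0 x t.
have small i j (a b : R) r : t < r -> `|a| <= `|t| -> `|b| <= `|t| -> i != j ->
    ball x r (x + a *: evec R i + b *: evec R j).
  move=> tr' at' bt ij; rewrite -ball_normE /ball_/= -addrA opprD addNKr normrN.
  rewrite (le_lt_trans _ tr')// -[leRHS]gtr0_norm//.
  move: ij; elim/ord2P: i; elim/ord2P: j => // _;
    by rewrite /evec prod_normE/= !scaler0 ?addr0 ?add0r ![_%:A]mulr1 ge_max ?at' ?bt.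
have := H0 _ (small 0 1 _ _ _ tr0 s1t s2t isT).
have := H1 _ (small 1 0 _ _ _ tr1 s3t s4t isT).
have : u (x + t *: evec R 0 + t *: evec R 1) - u (x + t *: evec R 0) -
    (u (x + t *: evec R 1) - u x) =
  u (x + t *: evec R 1 + t *: evec R 0) - u (x + t *: evec R 1) -
    (u (x + t *: evec R 0) - u x) by rewrite (addrAC x); lra.
rewrite E1 E2 => /(mulfI (lt0r_neq0 t0)) /(mulfI (lt0r_neq0 t0)) <-.
move=> A B.
rewrite [e]splitr (le_trans _ (lerD (ltW A) (ltW B)))//.
by rewrite (distrC (pd 1 (pd 0 u) x)); exact: ler_distD.
Qed.
End Calculus.

(** * Function classes closed under differentiation *)

Section Classes.
Variable R : realType.
Implicit Types (u v w : R * R -> R) (x y : R * R) (i j : 'I_2).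

Definition pds (s : seq 'I_2) u : R * R -> R := foldr (@pd R) u s.

Lemma pdsE s u : pds s u = partials s u.
Proof. by elim: s => //= i s <-; rewrite pdE. Qed.

Lemma pds_rcons s i u : pds (rcons s i) u = pds s (pd i u).
Proof. by rewrite /pds foldr_rcons. Qed.

Record sm u : Prop := IsSm {
  sm_cont : forall s, continuous (pds s u);
  sm_der : forall s i x, derivable (pds s u) x (evec R i) }.

Lemma smP u : smooth u <-> sm u.
Proof.
split=> [su|[cu du] s].
  by split=> s => [|i x]; have [cu du] := su s; rewrite pdsE; [exact: cu|exact: du].
by rewrite -pdsE; split; [exact: cu|exact: du].
Qed.

(** A coinduction principle: instead of computing iterated derivatives, describe a
    shape that all of them share. *)
Lemma sm_ind_pd (P : (R * R -> R) -> Prop) :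
  (forall u, P u -> continuous u) ->
  (forall u, P u -> forall i x, derivable u x (evec R i)) ->
  (forall u i, P u -> P (pd i u)) ->
  forall u, P u -> sm u.
Proof.
move=> Pc Pd Pp u Pu.
suff H s : P (pds s u) by split=> s; [exact: Pc|exact: Pd].
by elim: s => //= i s; exact: Pp.
Qed.

Lemma sm_continuous u : sm u -> continuous u.
Proof. by move=> [+ _] => /(_ [::]). Qed.

Lemma sm_derivable u : sm u -> forall i x, derivable u x (evec R i).
Proof. by move=> [_ +] => /(_ [::]). Qed.

Lemma sm_pd u i : sm u -> sm (pd i u).
Proof. by move=> [cu du]; split=> s; rewrite -pds_rcons; [exact: cu|exact: du]. Qed.

Lemma sm_C1 u : sm u -> C1 u.
Proof.
by move=> su; split=> i; [exact: sm_derivable|exact/sm_continuous/sm_pd].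
Qed.

Lemma sm_pdC u i j : sm u -> pd i (pd j u) = pd j (pd i u).
Proof. by move=> su; apply: pdC => [|k]; apply: sm_C1 => //; exact: sm_pd. Qed.

Lemma sm_pdsC u s i : sm u -> pds s (pd i u) = pd i (pds s u).
Proof.
move=> su; elim: s => //= j s ->; rewrite sm_pdC//.
by elim: s => //= k s; exact: sm_pd.
Qed.

Definition derivable_everywhere u := forall i x, derivable u x (evec R i).

Lemma pdD u v i : derivable_everywhere u -> derivable_everywhere v ->
  pd i (fun x => u x + v x) = fun x => pd i u x + pd i v x.
Proof.
move=> du dv; apply/funext => x; rewrite !pd_derive.
exact: (deriveD (du i x) (dv i x)).
Qed.

Lemma pdZ u i c : derivable_everywhere u ->
  pd i (fun x => c * u x) = fun x => c * pd i u x.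
Proof.
by move=> du; apply/funext => x; rewrite !pd_derive; exact: (deriveZ c (du i x)).
Qed.

Lemma pdM u v i : derivable_everywhere u -> derivable_everywhere v ->
  pd i (fun x => u x * v x) = fun x => u x * pd i v x + pd i u x * v x.
Proof.
move=> du dv; apply/funext => x; rewrite !pd_derive.
by rewrite (mulrC _ (v x)); exact: (deriveM (du i x) (dv i x)).
Qed.

Lemma is_derive_coordinate i j x :
  is_derive x (evec R i) (coordinate j) ((i == j)%:R : R).
Proof.
have H (h : R) : h != 0 ->
  h^-1 *: ((coordinate j \o shift x) (h *: evec R i) - coordinate j x) = (i == j)%:R.
  move=> h0 /=; elim/ord2P: i; elim/ord2P: j; rewrite /coordinate /evec /=.
  - by rewrite addrK [h%:A]mulr1 [LHS]mulVf.
  - by rewrite addrK scaler0 [LHS]mulr0.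
  - by rewrite addrK scaler0 [LHS]mulr0.
  - by rewrite addrK [h%:A]mulr1 [LHS]mulVf.
have L : h^-1 *: ((coordinate j \o shift x) (h *: evec R i) - coordinate j x)
    @[h --> 0^'] --> ((i == j)%:R : R).
  apply: cvg_near_cst; near=> h; apply: H.
  by near: h; exact: nbhs_dnbhs_neq.
split; first by apply/cvg_ex; exists (i == j)%:R.
by apply: cvg_lim.
Unshelve. all: by end_near. Qed.

Lemma derivable_coordinate j : derivable_everywhere (coordinate j).
Proof. by move=> i x; have [] := is_derive_coordinate i j x. Qed.

Lemma pd_coordinate i j : pd i (coordinate j) = fun _ => (i == j)%:R :> R.
Proof.
by apply/funext => x; rewrite pd_derive; have [] := is_derive_coordinate i j x.
Qed.

Lemma continuous_coordinate j : continuous (@coordinate R j).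
Proof.
move=> x; elim/ord2P: j; rewrite /coordinate/=; [exact: cvg_fst|exact: cvg_snd].
Qed.

Lemma derivable_everywhereD u v : derivable_everywhere u ->
  derivable_everywhere v -> derivable_everywhere (fun x => u x + v x).
Proof. by move=> du dv i x; exact: derivableD (du i x) (dv i x). Qed.

Lemma derivable_everywhereM u v : derivable_everywhere u ->
  derivable_everywhere v -> derivable_everywhere (fun x => u x * v x).
Proof. by move=> du dv i x; exact: derivableM (du i x) (dv i x). Qed.

Lemma derivable_everywhereZ c u : derivable_everywhere u ->
  derivable_everywhere (fun x => c * u x).
Proof. by move=> du i x; exact: (@derivableZ _ _ _ u c x _ (du i x)). Qed.

Lemma continuousDf u v : continuous u -> continuous v ->
  continuous (fun x => u x + v x).
Proof. by move=> cu cv x; exact: cvgD (cu x) (cv x). Qed.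

Lemma continuousMf u v : continuous u -> continuous v ->
  continuous (fun x => u x * v x).
Proof. by move=> cu cv x; exact: cvgM (cu x) (cv x). Qed.

Lemma continuousZf c u : continuous u -> continuous (fun x => c * u x).
Proof. by move=> cu; apply: (@continuousMf (fun _ => c)) => // x; exact: cvg_cst. Qed.

Lemma pd_coordM i j u : derivable_everywhere u ->
  pd i (fun x => coordinate j x * u x) =
  fun x => coordinate j x * pd i u x + (i == j)%:R * u x.
Proof.
move=> du; rewrite pdM; [|exact: derivable_coordinate|exact: du].
by rewrite pd_coordinate.
Qed.

(** Being smooth, being Schwartz and being a symbol are all of the form: all
    iterated derivatives of [u] satisfy a bound [B m], where [m] counts the
    order of differentiation. *)
Record tame (B : nat -> (R * R -> R) -> Prop) (m : nat) u : Prop := IsTame {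
  tame_sm : sm u;
  tame_bound : forall s, B (m + size s)%N (pds s u) }.

Lemma tame_ind_pd B (P : nat -> (R * R -> R) -> Prop) :
  (forall m u, P m u -> continuous u) ->
  (forall m u, P m u -> derivable_everywhere u) ->
  (forall m u, P m u -> B m u) ->
  (forall m u i, P m u -> P m.+1 (pd i u)) ->
  forall m u, P m u -> tame B m u.
Proof.
move=> Pc Pd PB Pp m u Pu; split.
  apply: (@sm_ind_pd (fun w => exists k, P k w)) => [w [k]|w [k]|w i [k]|].
  - exact: Pc.
  - exact: Pd.
  - by exists k.+1; exact: Pp.
  - by exists m.
move=> s; apply: PB; elim: s => [|i s IH]; first by rewrite addn0.
by rewrite /= addnS; exact: Pp.
Qed.

Lemma tame_pd B m u i : tame B m u -> tame B m.+1 (pd i u).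
Proof.
move=> [su Bu]; split; first exact: sm_pd.
by move=> s; rewrite addSnnS -(size_rcons s i) -pds_rcons.
Qed.

Lemma tame0 B m u : tame B m u -> B m u.
Proof. by move=> [_ /(_ [::])]; rewrite addn0. Qed.

Section TameClosure.
Variable B : nat -> (R * R -> R) -> Prop.
Hypothesis BD : forall m u v, B m u -> B m v -> B m (fun x => u x + v x).
Hypothesis BZ : forall m c u, B m u -> B m (fun x => c * u x).

Lemma tameD m u v : tame B m u -> tame B m v -> tame B m (fun x => u x + v x).
Proof.
move=> tu tv.
pose P m w := exists u v, [/\ tame B m u, tame B m v & w = fun x => u x + v x].
apply: (@tame_ind_pd B P) => [k w|k w|k w|k w i|]; last by exists u, v.
- move=> [a [b [[sa _] [sb _] ->]]].
  by apply: continuousDf; exact: sm_continuous.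
- move=> [a [b [[sa _] [sb _] ->]]].
  by apply: derivable_everywhereD; exact: sm_derivable.
- by move=> [a [b [/tame0 ta /tame0 tb ->]]]; exact: BD.
- move=> [a [b [ta tb ->]]]; exists (pd i a), (pd i b).
  split; [exact: tame_pd|exact: tame_pd|].
  by apply: pdD; apply: sm_derivable; [case: ta|case: tb].
Qed.

Lemma tameZ m c u : tame B m u -> tame B m (fun x => c * u x).
Proof.
move=> tu.
pose P m w := exists2 u, tame B m u & w = fun x => c * u x.
apply: (@tame_ind_pd B P) => [k w|k w|k w|k w i|]; last by exists u.
- by move=> [a [sa _] ->]; apply: continuousZf; exact: sm_continuous.
- by move=> [a [sa _] ->]; apply: derivable_everywhereZ; exact: sm_derivable.
- by move=> [a /tame0 ta ->]; exact: BZ.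
- move=> [a ta ->]; exists (pd i a); first exact: tame_pd.
  by apply: pdZ; apply: sm_derivable; case: ta.
Qed.

Lemma tameB m u v : tame B m u -> tame B m v -> tame B m (fun x => u x - v x).
Proof.
move=> tu /(tameZ (-1)) tv; under eq_fun do rewrite -mulN1r.
exact: tameD.
Qed.

Hypothesis Bweak : forall m u, B m.+1 u -> B m u.

Lemma tame_weak m u : tame B m.+1 u -> tame B m u.
Proof. by move=> [su Bu]; split=> // s; apply: Bweak; rewrite -addSn. Qed.

Hypothesis Bcoord : forall m j u, B m.+1 u -> B m (fun x => coordinate j x * u x).

(** The shape preserved by derivation is [coordinate j x * a x + b x]. *)
Lemma tame_coordM m j u : tame B m.+1 u -> tame B m (fun x => coordinate j x * u x).
Proof.
move=> tu.
pose P m w := exists u v, [/\ tame B m.+1 u, tame B m v &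
  w = fun x => coordinate j x * u x + v x].
have der a : sm a -> derivable_everywhere (fun x => coordinate j x * a x).
  move=> sa; apply: derivable_everywhereM; first exact: derivable_coordinate.
  exact: sm_derivable.
apply: (@tame_ind_pd B P) => [k w|k w|k w|k w i|].
- move=> [a [b [[sa _] [sb _] ->]]].
  apply: continuousDf; last exact: sm_continuous.
  apply: continuousMf; first exact: continuous_coordinate.
  exact: sm_continuous.
- move=> [a [b [[sa _] [sb _] ->]]].
  by apply: derivable_everywhereD; [exact: der|exact: sm_derivable].
- by move=> [a [b [/tame0 ta /tame0 tb ->]]]; apply: BD => //; exact: Bcoord.
- move=> [a [b [ta tb ->]]]; exists (pd i a), (fun x => (i == j)%:R * a x + pd i b x).
  have sa : sm a by case: ta.
  have sb : sm b by case: tb.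
  split; [exact: tame_pd| |].
    by apply: tameD; [exact: tameZ|exact: tame_pd].
  rewrite pdD; [|exact: der|exact: sm_derivable].
  rewrite pd_coordM; last exact: sm_derivable.
  by apply/funext => x; rewrite addrA.
- exists u, (fun x => 0 * u x); split => //; first exact/tameZ/tame_weak.
  by apply/funext => x; rewrite mul0r addr0.
Qed.
End TameClosure.
End Classes.

(** * Schwartz functions and symbols *)

Section Bounds.
Variable R : realType.
Implicit Types (u v w : R * R -> R) (x y : R * R) (i j : 'I_2).

(** The square of the Japanese bracket, polynomial unlike [1 + abs2 x]. *)
Definition bracket2 x : R := 1 + x.1 ^+ 2 + x.2 ^+ 2.

Lemma bracket2_ge1 x : 1 <= bracket2 x.
Proof. by rewrite /bracket2 -addrA lerDl addr_ge0 ?sqr_ge0. Qed.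

Lemma bracket2_gt0 x : 0 < bracket2 x.
Proof. exact: lt_le_trans (bracket2_ge1 x). Qed.

Lemma bracket2_ge0 x : 0 <= bracket2 x.
Proof. exact: ltW (bracket2_gt0 x). Qed.

Lemma abs2E x : abs2 x = Num.sqrt (x.1 ^+ 2 + x.2 ^+ 2).
Proof. by rewrite /abs2 sum2E. Qed.

Lemma abs2_ge0 x : 0 <= abs2 x. Proof. by rewrite sqrtr_ge0. Qed.

Lemma sqr_abs2 x : abs2 x ^+ 2 = x.1 ^+ 2 + x.2 ^+ 2.
Proof. by rewrite abs2E sqr_sqrtr// addr_ge0 ?sqr_ge0. Qed.

Lemma coordinate_le_abs2 i x : `|coordinate i x| <= abs2 x.
Proof.
rewrite abs2E -sqrtr_sqr; apply: ler_wsqrtr.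
by elim/ord2P: i; rewrite /coordinate/= ?lerDl ?lerDr sqr_ge0.
Qed.

Lemma oneDabs2_gt0 x : 0 < 1 + abs2 x.
Proof. by rewrite ltr_pwDl// abs2_ge0. Qed.

Lemma oneDabs2_ge1 x : 1 <= 1 + abs2 x.
Proof. by rewrite lerDl abs2_ge0. Qed.

Lemma sqr_oneDabs2_le x : (1 + abs2 x) ^+ 2 <= 2 * bracket2 x.
Proof.
rewrite /bracket2 -addrA -sqr_abs2.
have := sqr_ge0 (abs2 x - 1); nra.
Qed.

Definition rapid u := forall N, exists C : R, forall x, bracket2 x ^+ N * `|u x| <= C.

Definition decay m u := exists C : R, forall x, (1 + abs2 x) ^+ m * `|u x| <= C.

(** [bracket2] is a sum of three monomials, so its factors can be moved one at a
    time onto [u]. *)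
Lemma rapid_monomials u :
  (forall a b, exists C : R, forall x,
     `|coordinate 0 x ^+ a * coordinate 1 x ^+ b * u x| <= C) -> rapid u.
Proof.
move=> + N; elim: N u => [|N IH] u Hu.
  have [C HC] := Hu 0 0; exists C => x.
  by have := HC x; rewrite !expr0 !mul1r.
have [C HC] : exists C : R, forall x, bracket2 x ^+ N * `|bracket2 x * u x| <= C.
  apply: IH => a b.
  have [C0 H0] := Hu a b; have [C1 H1] := Hu a.+2 b; have [C2 H2] := Hu a b.+2.
  exists (C0 + C1 + C2) => x.
  have -> : coordinate 0 x ^+ a * coordinate 1 x ^+ b * (bracket2 x * u x) =
     coordinate 0 x ^+ a * coordinate 1 x ^+ b * u x +
     coordinate 0 x ^+ a.+2 * coordinate 1 x ^+ b * u x +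
     coordinate 0 x ^+ a * coordinate 1 x ^+ b.+2 * u x.
    by rewrite -[bracket2 x]/(1 + coordinate 0 x ^+ 2 + coordinate 1 x ^+ 2) !exprS; ring.
  by rewrite (le_trans (ler_normD _ _))// lerD// (le_trans (ler_normD _ _))// lerD.
exists C => x; have := HC x.
by rewrite normrM (ger0_norm (ltW (bracket2_gt0 x))) mulrA -exprSr.
Qed.

Lemma monomials_rapid u a b : rapid u -> exists C : R, forall x,
  `|coordinate 0 x ^+ a * coordinate 1 x ^+ b * u x| <= C.
Proof.
move=> /(_ (a + b)%N)[C HC]; exists C => x; rewrite (le_trans _ (HC x))//.
rewrite normrM ler_wpM2r// normrM !normrX exprD.
have H i : `|coordinate i x| <= bracket2 x.
  rewrite /bracket2 -addrA -sqr_abs2 (le_trans (coordinate_le_abs2 i x))//.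
  by have := sqr_ge0 (abs2 x - 1); have := abs2_ge0 x; nra.
by apply: ler_pM; rewrite ?exprn_ge0//; apply: lerXn2r; rewrite ?nnegrE ?bracket2_ge0.
Qed.

Definition sch u := tame (fun=> rapid) 0 u.

Lemma schP u : schwartz u <-> sch u.
Proof.
split=> [[/smP su H]|[su H]].
  by split=> // s; apply: rapid_monomials => a b; rewrite pdsE; exact: H.
split=> [|a b s]; first exact/smP.
by rewrite -pdsE; exact: monomials_rapid.
Qed.

Lemma rapidD u v : rapid u -> rapid v -> rapid (fun x => u x + v x).
Proof.
move=> ru rv N; have [C HC] := ru N; have [D HD] := rv N; exists (C + D) => x.
rewrite (le_trans _ (lerD (HC x) (HD x)))// -mulrDr ler_wpM2l ?ler_normD//.
by rewrite exprn_ge0// ltW// bracket2_gt0.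
Qed.

Lemma rapidZ c u : rapid u -> rapid (fun x => c * u x).
Proof.
move=> ru N; have [C HC] := ru N; exists (`|c| * C) => x.
by rewrite normrM mulrCA ler_wpM2l.
Qed.

Lemma rapid_coordM j u : rapid u -> rapid (fun x => coordinate j x * u x).
Proof.
move=> ru N; have [C HC] := ru N.+1; exists C => x; rewrite (le_trans _ (HC x))//.
rewrite normrM exprSr -mulrA ler_wpM2l ?exprn_ge0 ?(ltW (bracket2_gt0 x))//.
rewrite ler_wpM2r// (le_trans (coordinate_le_abs2 j x))//.
rewrite /bracket2 -addrA -sqr_abs2.
by have := sqr_ge0 (abs2 x - 1); have := abs2_ge0 x; nra.
Qed.

Lemma decayD m u v : decay m u -> decay m v -> decay m (fun x => u x + v x).
Proof.
move=> [C HC] [D HD]; exists (C + D) => x.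
rewrite (le_trans _ (lerD (HC x) (HD x)))// -mulrDr ler_wpM2l ?ler_normD//.
by rewrite exprn_ge0// ltW// oneDabs2_gt0.
Qed.

Lemma decayZ m c u : decay m u -> decay m (fun x => c * u x).
Proof.
by move=> [C HC]; exists (`|c| * C) => x; rewrite normrM mulrCA ler_wpM2l.
Qed.

Lemma decay_weak m u : decay m.+1 u -> decay m u.
Proof.
move=> [C HC]; exists C => x; rewrite (le_trans _ (HC x))// ler_wpM2r//.
by rewrite ler_weXn2l ?oneDabs2_ge1.
Qed.

Lemma decay_coordM m j u : decay m.+1 u -> decay m (fun x => coordinate j x * u x).
Proof.
move=> [C HC]; exists C => x; rewrite (le_trans _ (HC x))// normrM exprSr -mulrA.
rewrite ler_wpM2l ?exprn_ge0 ?(ltW (oneDabs2_gt0 x))// ler_wpM2r//.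
by rewrite (le_trans (coordinate_le_abs2 j x))// lerDr.
Qed.

Lemma rapid_decay m u : rapid u -> decay m u.
Proof.
move=> /(_ m)[C HC]; exists (2 ^+ m * C) => x.
rewrite (le_trans _ (ler_wpM2l _ (HC x)))// ?exprn_ge0// mulrA ler_wpM2r//.
rewrite -exprMn lerXn2r ?nnegrE ?mulr_ge0 ?(ltW (oneDabs2_gt0 x)) ?(ltW (bracket2_gt0 x))//.
rewrite (le_trans _ (sqr_oneDabs2_le x))// expr2 ler_peMl ?oneDabs2_ge1//.
by rewrite (ltW (oneDabs2_gt0 x)).
Qed.

Lemma sch_sm u : sch u -> sm u. Proof. by case. Qed.
Lemma sch_rapid u : sch u -> rapid u. Proof. exact: tame0. Qed.
Lemma schD u v : sch u -> sch v -> sch (fun x => u x + v x).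
Proof. by apply: tameD => _ ? ?; exact: rapidD. Qed.
Lemma schZ c u : sch u -> sch (fun x => c * u x).
Proof. by apply: tameZ => _ ? ?; exact: rapidZ. Qed.
Lemma sch_pd i u : sch u -> sch (pd i u).
Proof. by move=> /tame_pd-/(_ i)[su H]; split. Qed.
Lemma sch_pds s u : sch u -> sch (pds s u).
Proof. by move=> su; elim: s => //= i s; exact: sch_pd. Qed.
Lemma sch_coordM j u : sch u -> sch (fun x => coordinate j x * u x).
Proof.
move=> [su Bu]; apply: (@tame_coordM _ (fun=> @rapid)) => //.
- by move=> _ ? ?; exact: rapidD.
- by move=> _ ? ?; exact: rapidZ.
- by move=> _ ? ?; exact: rapid_coordM.
Qed.

Lemma sch_ind_pd (P : (R * R -> R) -> Prop) :
  (forall u, P u -> continuous u) ->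
  (forall u, P u -> derivable_everywhere u) ->
  (forall u, P u -> rapid u) ->
  (forall u i, P u -> P (pd i u)) ->
  forall u, P u -> sch u.
Proof.
by move=> Pc Pd Pr Pp u; apply: (@tame_ind_pd _ _ (fun=> P)) => // m w i; apply: Pp.
Qed.

(** The symbols of order [- m]. *)
Definition sym m u := tame decay m u.

Lemma symD m u v : sym m u -> sym m v -> sym m (fun x => u x + v x).
Proof. by apply: tameD => k ? ?; exact: decayD. Qed.
Lemma symZ m c u : sym m u -> sym m (fun x => c * u x).
Proof. by apply: tameZ => k ? ?; exact: decayZ. Qed.
Lemma symB m u v : sym m u -> sym m v -> sym m (fun x => u x - v x).
Proof. by apply: tameB => [k ? ?|k ? ?]; [exact: decayD|exact: decayZ]. Qed.
Lemma sym_pd m i u : sym m u -> sym m.+1 (pd i u).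
Proof. exact: tame_pd. Qed.
Lemma sym_coordM m j u : sym m.+1 u -> sym m (fun x => coordinate j x * u x).
Proof.
apply: tame_coordM => [k ? ?|k ? ?|k ?|k ? ?].
- exact: decayD.
- exact: decayZ.
- exact: decay_weak.
- exact: decay_coordM.
Qed.

End Bounds.

(** * Superpositions of translates *)

Section Translates.
Variable R : realType.

(** An open set is the union of the boxes with rational corners it contains. *)
Lemma open_measurable_plane (W : set (R * R)) : open W -> measurable W.
Proof.
move=> oW.
pose box (q : rat * rat * rat * rat) : set (R * R) :=
  `]ratr q.1.1.1, ratr q.1.1.2[%classic `*` `]ratr q.1.2, ratr q.2[%classic.
pose F q := if `[< box q `<=` W >] then box q else set0.
suff -> : W = \bigcup_q F q.
  apply: countable_bigcupT_measurable => // q; rewrite /F; case: ifP => // _.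
  by apply: measurableX; exact: measurable_itv.
apply/seteqP; split=> [x Wx|x [q _]]; last first.
  by rewrite /F; case: ifPn => // /asboolP; apply.
have /nbhs_ballP[e /= e0 xeW] : nbhs x W by exact: open_nbhs_nbhs.
have rat_between (s t : R) : s < t -> exists q : rat, s < ratr q < t.
  by move=> /rat_in_itvoo[q]; rewrite in_itv/=; exists q.
have [a /andP[a1 a2]] : exists a : rat, x.1 - e < ratr a < x.1.
  by apply: rat_between; rewrite gtrBl.
have [b /andP[b1 b2]] : exists b : rat, x.1 < ratr b < x.1 + e.
  by apply: rat_between; rewrite ltrDl.
have [c /andP[c1 c2]] : exists c : rat, x.2 - e < ratr c < x.2.
  by apply: rat_between; rewrite gtrBl.
have [d /andP[d1 d2]] : exists d : rat, x.2 < ratr d < x.2 + e.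
  by apply: rat_between; rewrite ltrDl.
exists (a, b, c, d) => //; rewrite /F; case: ifPn => [_|/asboolP[]].
  by rewrite /box; split; rewrite /= in_itv/= ?a2 ?b1 ?c2 ?d1.
move=> y [/=]; rewrite !in_itv/= => /andP[y1 y2] /andP[y3 y4].
by apply: xeW; split; rewrite /ball/= ltr_norml; lra.
Qed.

Lemma continuous_measurable_plane (F : R * R -> R) :
  continuous F -> measurable_fun setT F.
Proof.
move=> cF; apply: (measurability _ (RGenOInfty.measurableE R)).
move=> /= _ [_ [a ->]] <-; rewrite setTI; apply: open_measurable_plane.
by apply: open_comp => // x _; exact: cF.
Qed.

Context {d} {Y : measurableType d} (mu : {measure set Y -> \bar R}).

Lemma integrable_scale (A : set Y) (c : R) (g : Y -> R) : measurable A ->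
  mu.-integrable A (EFin \o g) -> mu.-integrable A (EFin \o (fun y => c * g y)).
Proof.
move=> mA ig; rewrite (_ : EFin \o _ = fun y => (c%:E * (EFin \o g) y)%E).
  exact: integrableZl.
exact/funext.
Qed.

Lemma integrable_add (A : set Y) (g h : Y -> R) : measurable A ->
  mu.-integrable A (EFin \o g) -> mu.-integrable A (EFin \o h) ->
  mu.-integrable A (EFin \o (fun y => g y + h y)).
Proof.
move=> mA ig ih; rewrite (_ : EFin \o _ = (EFin \o g) \+ (EFin \o h))%E.
  exact: integrableD.
exact/funext.
Qed.

Variables (D : set Y) (mD : measurable D) (w : Y -> R) (p : Y -> R * R).
Hypothesis mp : measurable_fun setT p.
Hypothesis mw : measurable_fun setT w.
Hypothesis iw : mu.-integrable D (EFin \o (fun y => `|w y| / bracket2 (p y))).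

(** A convolution in disguise: the weight [w] and the translations [p] live on a
    measure space of parameters, where the change of variables that removes a
    singularity of the kernel has already been made. *)
Definition superpose (F : R * R -> R) (x : R * R) : R :=
  \int[mu]_(y in D) (w y * F (x + p y)).

(** Peetre's inequality. *)
Lemma bracket2_Peetre (x h : R * R) : bracket2 h <= 2 * bracket2 x * bracket2 (x + h).
Proof.
rewrite /bracket2/=.
have := sqr_ge0 (2 * x.1 + h.1); have := sqr_ge0 (2 * x.2 + h.2).
have P1 : 0 <= (x.1 ^+ 2 + x.2 ^+ 2) * ((x.1 + h.1) ^+ 2 + (x.2 + h.2) ^+ 2).
  by rewrite mulr_ge0// addr_ge0// sqr_ge0.
nra.
Qed.

Section Fix.
Variables (F : R * R -> R) (cF : continuous F) (rF : rapid F).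

Lemma measurable_superpose x : measurable_fun setT (fun y => w y * F (x + p y)).
Proof.
apply: measurable_funM => //.
apply: (@measurableT_comp _ _ _ _ _ _ (fun z => F (x + z))) => //.
apply: continuous_measurable_plane => z.
apply: (@continuous_comp _ _ _ (fun z => x + z) F); last exact: cF.
by apply: cvgD; [exact: cvg_cst|exact: cvg_id].
Qed.

(** The majorant depends on [x] through [bracket2 x] only, hence is uniform on
    bounded sets, as differentiation under the integral sign requires. *)
Lemma superpose_majorant : exists2 C : R, 0 <= C & forall x y,
  `|w y * F (x + p y)| <= C * bracket2 x * (`|w y| / bracket2 (p y)).
Proof.
have [C HC] := rF 1.
have C0 : 0 <= C by have := HC 0; apply: le_trans; rewrite mulr_ge0// ?exprn_ge0 ?bracket2_ge0.
exists (2 * C) => [|x y]; first by rewrite mulr_ge0.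
rewrite normrM mulrCA ler_wpM2l// ler_pdivlMr ?bracket2_gt0//.
apply: (le_trans (ler_wpM2l _ (bracket2_Peetre x (p y)))) => //.
have := HC (x + p y); rewrite expr1 => H.
by have := ler_wpM2l (bracket2_ge0 x) H; lra.
Qed.

Lemma integrable_superpose x : mu.-integrable D (EFin \o (fun y => w y * F (x + p y))).
Proof.
have [C C0 HC] := superpose_majorant.
apply: (@le_integrable _ _ _ mu D mD _
  (EFin \o (fun y => C * bracket2 x * (`|w y| / bracket2 (p y))))).
- by apply/measurable_EFinP; apply: measurable_funTS; exact: measurable_superpose.
- move=> y Dy /=; rewrite lee_fin (le_trans (HC x y))// ler_norm//.
- exact: integrable_scale.
Qed.

End Fix.

Lemma superposeD F G x : continuous F -> rapid F -> continuous G -> rapid G ->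
  superpose (fun y => F y + G y) x = superpose F x + superpose G x.
Proof.
move=> cF rF cG rG; rewrite /superpose -RintegralD//.
- by apply: eq_Rintegral => y _; rewrite mulrDr.
- exact: integrable_superpose.
- exact: integrable_superpose.
Qed.

Lemma superposeZ c F x : continuous F -> rapid F ->
  superpose (fun y => c * F y) x = c * superpose F x.
Proof.
move=> cF rF; rewrite /superpose -RintegralZl//.
  by apply: eq_Rintegral => y _; rewrite mulrCA.
exact: integrable_superpose.
Qed.

Lemma superpose_le F (M : Y -> R) x : continuous F -> rapid F ->
  mu.-integrable D (EFin \o M) ->
  (forall y, D y -> `|w y * F (x + p y)| <= M y) ->
  `|superpose F x| <= \int[mu]_(y in D) M y.
Proof.
move=> cF rF iM FM.
rewrite (le_trans (le_normr_Rintegral mD (integrable_superpose cF rF x)))//.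
apply: le_Rintegral => //.
rewrite (_ : EFin \o _ = abse \o (EFin \o (fun y => w y * F (x + p y)))).
  exact/integrable_abse/integrable_superpose.
exact/funext.
Qed.

Lemma superpose_bound F : continuous F -> rapid F ->
  exists2 C : R, 0 <= C & forall x, `|superpose F x| <= C * bracket2 x.
Proof.
move=> cF rF; have [C C0 HC] := superpose_majorant rF.
exists (C * \int[mu]_(y in D) (`|w y| / bracket2 (p y))) => [|x].
  rewrite mulr_ge0// Rintegral_ge0// => y _.
  by rewrite divr_ge0// bracket2_ge0.
rewrite mulrAC -RintegralZl//; apply: superpose_le => //.
exact: integrable_scale.
Qed.

Lemma bracket2_line x i (t : R) : -1 < t < 1 -> bracket2 (x + t *: evec R i) <= 3 * bracket2 x.
Proof.
move=> /andP[t1 t2]; have t3 : t ^+ 2 <= 1 by nra.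
have := sqr_ge0 (x.1 - t); have := sqr_ge0 (x.2 - t).
have := sqr_ge0 x.1; have := sqr_ge0 x.2.
elim/ord2P: i; rewrite /bracket2 /evec /= ?scaler0 ?addr0 [t%:A]mulr1; nra.
Qed.

(** Differentiation under the integral sign. The increment along the axis stays in
    [-1, 1], where [bracket2] varies by a factor of at most 3. *)
Lemma is_derive_superpose F i x : sch F ->
  is_derive x (evec R i) (superpose F) (superpose (pd i F) x).
Proof.
move=> sF; pose f (t : R) y := w y * F (x + t *: evec R i + p y).
have fD (t : R) y : is_derive t 1 (f ^~ y) (w y * pd i F (x + t *: evec R i + p y)).
  have -> : f ^~ y = w y *: (fun t : R => F (x + p y + t *: evec R i)).
    by apply/funext => s; rewrite /f addrAC.
  rewrite addrAC; apply: is_deriveZ; rewrite pd_derive; apply: is_derive_line.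
  exact/sm_derivable/sch_sm.
have [C C0 HC] := superpose_majorant (sch_rapid (sch_pd i sF)).
pose G y := C * (3 * bracket2 x) * (`|w y| / bracket2 (p y)).
have I0 : (`]-1, 1[%classic : set R) 0 by rewrite /= in_itv/= ltrN10 ltr01.
have intf (t : R) : `]-1, 1[%classic t -> mu.-integrable D (EFin \o f t).
  by move=> _; apply: integrable_superpose; [exact/sm_continuous/sch_sm|exact: sch_rapid].
have derf (t : R) y : `]-1, 1[%classic t -> D y -> derivable (f ^~ y) t 1.
  by move=> _ _; case: (fD t y).
have G0 y : 0 <= G y by rewrite !mulr_ge0// ?invr_ge0// bracket2_ge0.
have intG : mu.-integrable D (EFin \o G).
  exact: integrable_scale.
have f1E t y : partial1of2 f t y = w y * pd i F (x + t *: evec R i + p y).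
  by rewrite partial1of2E; case: (fD t y).
have Gub (t : R) y : `]-1, 1[%classic t -> D y -> `|partial1of2 f t y| <= G y.
  rewrite /= in_itv/= => t1 _; rewrite f1E (le_trans (HC _ _))//.
  rewrite ler_wpM2r ?divr_ge0 ?bracket2_ge0// ler_wpM2l//.
  exact: bracket2_line.
have D1 := derivable_under_integral mD I0 intf derf G0 intG Gub.
have D2 := differentiation_under_integral mD I0 intf derf G0 intG Gub.
have E0 t : superpose F (t *: evec R i + x) = \int[mu]_(y in D) f t y.
  by rewrite /superpose/f; under eq_Rintegral do rewrite (addrC (t *: _)).
have E : (fun t : R => superpose F (t *: evec R i + x)) =
    fun t => \int[mu]_(y in D) f t y by exact/funext.
split.
  by apply/derivable1P; rewrite E.
rewrite /derive.
have -> : (fun h : R => h^-1 *: ((superpose F \o shift x) (h *: evec R i) - superpose F x)) =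
   (fun h : R => h^-1 *: (((fun t => \int[mu]_(y in D) f t y) \o shift 0) (h *: 1) -
      \int[mu]_(y in D) f 0 y)).
  apply/funext => h; rewrite /= -!E0 addr0 scale0r add0r [h%:A]mulr1//.
rewrite -[LHS]/('D_1 (fun t => \int[mu]_(y in D) f t y) (0 : R)) -derive1E D2.
by apply: eq_Rintegral => y _; rewrite f1E scale0r addr0.
Qed.

(** A superposition of translates inherits differentiability direction by
    direction; continuity follows because the derivatives are locally bounded. *)
Lemma sm_superpose F : sch F -> sm (superpose F).
Proof.
move=> sF; pose P u := exists2 G, sch G & u = superpose G.
have Pd u : P u -> derivable_everywhere u.
  by move=> [G sG ->] i x; have [] := is_derive_superpose i x sG.
have Ppd u i : P u -> P (pd i u).
  move=> [G sG ->]; exists (pd i G); first exact: sch_pd.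
  by apply/funext => x; rewrite pd_derive; have [] := is_derive_superpose i x sG.
apply: (@sm_ind_pd _ P) => //; last by exists F.
move=> u Pu x.
have bnd i : exists2 C : R, 0 <= C & forall y, `|pd i u y| <= C * bracket2 y.
  have [G sG ->] := Ppd _ i Pu; apply: superpose_bound.
    exact/sm_continuous/sch_sm.
  exact/sch_rapid.
have [C0 C00 H0] := bnd 0; have [C1 C10 H1] := bnd 1.
pose M := C0 * (3 * bracket2 x) + C1 * (3 * (3 * bracket2 x)).
have M0 : 0 <= M by rewrite addr_ge0// mulr_ge0// !mulr_ge0// bracket2_ge0.
suff K (e : R) : 0 < e -> nbhs (x : R * R) [set y | `|u x - u y| <= e].
  by apply/cvgrPdist_le => e e0; exact: K.
move=> e0; apply/nbhs_ballP.
have r0 : 0 < Num.min 1 (e / (M + 1)) by rewrite lt_min ltr01 divr_gt0// ltr_wpDl.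
exists (Num.min 1 (e / (M + 1))) => //= y.
rewrite -ball_normE /ball_/= distrC lt_min; set h := y - x => /andP[h1 he].
have -> : y = x + h by rewrite addrC subrK.
have n1 : `|h.1| <= `|h| by rewrite prod_normE le_max lexx.
have n2 : `|h.2| <= `|h| by rewrite prod_normE le_max lexx orbT.
have [s sh E0] := MVT_line x h.1 (Pd _ Pu 0).
have [t th E1] := MVT_line (x + h.1 *: evec R 0) h.2 (Pd _ Pu 1).
rewrite pair_evecE distrC.
have -> : u (x + h.1 *: evec R 0 + h.2 *: evec R 1) - u x =
   h.1 * pd 0 u (x + s *: evec R 0) + h.2 * pd 1 u (x + h.1 *: evec R 0 + t *: evec R 1).
  by rewrite !pd_derive -E0 -E1; ring.
have B1 : `|pd 0 u (x + s *: evec R 0)| <= C0 * (3 * bracket2 x).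
  rewrite (le_trans (H0 _))// ler_wpM2l// bracket2_line// -ltr_norml.
  by rewrite (le_lt_trans sh)// (le_lt_trans n1).
have B2 : `|pd 1 u (x + h.1 *: evec R 0 + t *: evec R 1)| <= C1 * (3 * (3 * bracket2 x)).
  rewrite (le_trans (H1 _))// ler_wpM2l//.
  rewrite (le_trans (bracket2_line _ _ _)) ?ler_wpM2l ?bracket2_line// -ltr_norml.
    by rewrite (le_lt_trans th)// (le_lt_trans n2).
  by rewrite (le_lt_trans n1).
rewrite (le_trans (ler_normD _ _))// !normrM.
apply: (@le_trans _ _ (`|h| * M)).
  by rewrite /M mulrDr; apply: lerD; apply: ler_pM.
apply: (@le_trans _ _ (e / (M + 1) * (M + 1))); last by rewrite divfK// gt_eqF// ltr_wpDl.
by apply: ler_pM => //; [exact: ltW|rewrite lerDl].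
Qed.

Lemma pd_superpose F i : sch F -> pd i (superpose F) = superpose (pd i F).
Proof.
move=> sF; apply/funext => x; rewrite pd_derive.
by have [] := is_derive_superpose i x sF.
Qed.

End Translates.

(** * Integrals over a half-line *)

Section HalfLine.
Variable R : realType.
Local Notation mu := (@lebesgue_measure R).
Local Notation Rp := (`[0, +oo[%classic : set R).

Lemma continuous_scale (T : topologicalType) (c : R) (f : T -> R) :
  continuous f -> continuous (fun x => c * f x).
Proof. by move=> cf x; apply: cvgM; [exact: cvg_cst|exact: cf]. Qed.

Lemma is_derive_continuous (F : R -> R) (x df : R) : is_derive x 1 F df ->
  F y @[y --> x] --> F x.
Proof.
by move=> [dF _]; exact/differentiable_continuous/derivable1_diffP.
Qed.

Lemma segment_FTC (a b : R) (f H : R -> R) : a < b -> continuous f ->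
  (forall t : R, is_derive t 1 H (f t)) -> \int[mu]_(t in `[a, b]) f t = H b - H a.
Proof.
move=> ab cf dH; rewrite /Rintegral (@continuous_FTC2 _ f H) //.
- exact: continuous_subspaceT.
- split.
  + by move=> t _; case: (dH t).
  + by apply: cvg_at_right_filter; exact: (is_derive_continuous (dH a)).
  + by apply: cvg_at_left_filter; exact: (is_derive_continuous (dH b)).
- by move=> t _; rewrite derive1E; case: (dH t).
Qed.

Lemma is_derive_atan_shift (a s : R) :
  is_derive s 1 (fun s => atan (s - a)) ((1 + (s - a) ^+ 2)^-1).
Proof.
have -> : (fun s : R => atan (s - a)) = atan \o (fun s => s - a) by [].
have D : is_derive s 1 (fun s : R => s - a) 1.
  exact: is_derive_shift.
rewrite -[X in is_derive _ _ _ X]mulr1.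
exact: is_derive1_comp.
Qed.

Lemma continuous_bell (a : R) : continuous (fun s => (1 + (s - a) ^+ 2)^-1).
Proof.
move=> s; apply: cvgV; first by rewrite gt_eqF// ltr_pwDl// sqr_ge0.
apply: cvgD; first exact: cvg_cst.
apply: (@continuous_comp _ _ _ (fun s => s - a) (fun x => x ^+ 2)).
  by apply: cvgB; [exact: cvg_id|exact: cvg_cst].
exact: exprn_continuous.
Qed.

Lemma continuous_bell0 : continuous (fun s : R => (1 + s ^+ 2)^-1).
Proof. by move=> s; have := @continuous_bell 0 s; under eq_fun do rewrite subr0. Qed.

Lemma cvgy_atan_shift (a : R) : atan (s - a) @[s --> +oo] --> pi / 2.
Proof.
apply: (cvg_comp _ _ _ (@cvgy_atan R)).
by apply/cvgryPge => A; near=> s; rewrite lerBrDr; near: s; apply: nbhs_pinfty_ge; exact: num_real.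
Unshelve. all: by end_near. Qed.

Lemma bell_ge0 (a s : R) : 0 <= (1 + (s - a) ^+ 2)^-1.
Proof. by rewrite invr_ge0 addr_ge0// sqr_ge0. Qed.

Lemma integral_bell (a : R) :
  (\int[mu]_(s in Rp) ((1 + (s - a) ^+ 2)^-1)%:E = (pi / 2 - atan (0 - a))%:E)%E.
Proof.
rewrite (@ge0_continuous_FTC2y _ _ (fun s => atan (s - a)) _ (pi / 2)).
- by rewrite EFinB.
- by move=> s _; exact: bell_ge0.
- by apply: continuous_subspaceT; exact: continuous_bell.
- exact: cvgy_atan_shift.
- by move=> s _; case: (is_derive_atan_shift a s).
- by apply: cvg_at_right_filter; exact: (is_derive_continuous (is_derive_atan_shift a 0)).
- by move=> s _; rewrite derive1E; case: (is_derive_atan_shift a s).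
Qed.

Lemma measurable_bell (a : R) (D : set R) :
  measurable_fun D (EFin \o (fun s => (1 + (s - a) ^+ 2)^-1)).
Proof.
apply/measurable_EFinP; apply: measurable_funTS; apply: continuous_measurable_fun.
exact: continuous_bell.
Qed.

Lemma integrable_bell (a : R) :
  mu.-integrable Rp (EFin \o (fun s => (1 + (s - a) ^+ 2)^-1)).
Proof.
apply/integrableP; split; first exact: measurable_bell.
under eq_integral do rewrite /= ger0_norm ?bell_ge0//.
by rewrite integral_bell ltry.
Qed.

Lemma Rintegral_bell_le (a : R) : \int[mu]_(s in Rp) (1 + (s - a) ^+ 2)^-1 <= pi.
Proof.
rewrite /Rintegral integral_bell/=.
have := atan_gtNpi2 (0 - a); lra.
Qed.

(** The positive function [f + C / (1 + s^2)] falls under the fundamental theorem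
    for positive integrands, and so does the majorant alone. *)
Lemma dominated_FTC2y (f F : R -> R) (C : R) :
  continuous f -> (forall s : R, is_derive s 1 F (f s)) ->
  (forall s, 0 <= s -> `|f s| <= C / (1 + s ^+ 2)) ->
  F s @[s --> +oo] --> (0 : R) ->
  \int[mu]_(s in Rp) f s = - F 0.
Proof.
move=> cf dF fC F0.
pose g (s : R) := C * (1 + (s - 0) ^+ 2)^-1.
have cg : continuous g.
  by apply: continuous_scale; exact: continuous_bell.
have ig : mu.-integrable Rp (EFin \o g).
  by apply: integrable_scale => //; exact: integrable_bell.
have fg s : 0 <= s -> `|f s| <= g s by move=> s0; rewrite /g subr0; exact: fC.
have if_ : mu.-integrable Rp (EFin \o f).
  apply: (le_integrable _ _ _ ig) => //.
    apply/measurable_EFinP; apply: measurable_funTS.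
    exact: continuous_measurable_fun.
  move=> s /=; rewrite in_itv/= andbT lee_fin => s0.
  by rewrite (le_trans (fg _ s0))// ler_norm.
have dG (s : R) : is_derive s 1 (fun s => F s + C * atan (s - 0)) (f s + g s).
  apply: is_deriveD => //; apply: (@is_deriveZ _ _ _ (fun s => atan (s - 0)) C).
  exact: is_derive_atan_shift.
have E : \int[mu]_(s in Rp) (f s + g s) =
    0 + C * (pi / 2) - (F 0 + C * atan (0 - 0)).
  apply: (@Rintegral_ge0_continuous_FTC2y _ _ (fun s => F s + C * atan (s - 0))).
  - by move=> s /fg; rewrite ler_norml => /andP[]; lra.
  - by apply: continuous_subspaceT => s; apply: cvgD; [exact: cf|exact: cg].
  - apply: cvgD => //; apply: cvgM; [exact: cvg_cst|exact: cvgy_atan_shift].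
  - by move=> s _; case: (dG s).
  - by apply: cvg_at_right_filter; exact: (is_derive_continuous (dG 0)).
  - by move=> s _; rewrite derive1E; case: (dG s).
move: E; rewrite RintegralD// /g RintegralZl//; last exact: integrable_bell.
rewrite /Rintegral integral_bell /= => E; move: E; rewrite subr0 atan0; lra.
Qed.

End HalfLine.

(** * Fubini's theorem on rectangles *)

Section Rectangles.
Context {R : realType} {d1 d2} {T1 : measurableType d1} {T2 : measurableType d2}.
Variables (m1 : {sigma_finite_measure set T1 -> \bar R}).
Variables (m2 : {sigma_finite_measure set T2 -> \bar R}).
Variables (A : set T1) (B : set T2) (mA : measurable A) (mB : measurable B).
Variable f : T1 * T2 -> R.

Let mAB : measurable (A `*` B). Proof. exact: measurableX. Qed.

Lemma patch_rectangle x y : ((EFin \o f) \_ (A `*` B)) (x, y) =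
  ((fun x => ((fun y => (f (x, y))%:E) \_ B) y) \_ A) x.
Proof.
rewrite /patch; case: ifPn => [/set_mem[/= Ax By]|/negP H].
  by rewrite !mem_set.
case: ifPn => // /set_mem Ax; case: ifPn => // /set_mem By.
by exfalso; apply: H; rewrite mem_set.
Qed.

(** Tonelli's theorem for the extension of [f] by zero. *)
Lemma integrable_rectangle (g : T1 -> R) (h : T2 -> R) :
  measurable_fun setT f ->
  (forall x y, A x -> B y -> `|f (x, y)| <= g x * h y) ->
  m1.-integrable A (EFin \o g) -> m2.-integrable B (EFin \o h) ->
  (forall x, A x -> 0 <= g x) -> (forall y, B y -> 0 <= h y) ->
  (m1 \x m2)%E.-integrable (A `*` B) (EFin \o f).
Proof.
move=> mf fgh ig ih g0 h0; apply/(integrable_mkcond _ mAB).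
have mfp : measurable_fun setT ((EFin \o f) \_ (A `*` B)).
  apply/(measurable_restrictT _ mAB); apply: measurable_funTS.
  exact/measurable_EFinP.
apply/integrable12ltyP => //.
have I1 x : A x -> (\int[m2]_y `|((EFin \o f) \_ (A `*` B)) (x, y)| <=
    (g x)%:E * \int[m2]_(y in B) (h y)%:E)%E.
  move=> Ax.
  rewrite -ge0_integralZl//; last 2 first.
  - by move: ih => /integrableP[].
  - by rewrite lee_fin g0.
  rewrite [leRHS]integral_mkcond; apply: ge0_le_integral => //.
  - by apply: measurableT_comp => //; exact: measurableT_comp.
  - apply/(measurable_restrictT _ mB); apply: measurable_funeM.
    by move: ih => /integrableP[].
  - move=> y _; rewrite patch_rectangle /patch (mem_set Ax); case: ifPn => [/set_mem By|_].
      by rewrite -EFinM lee_fin fgh.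
    by rewrite abse0.
have I2 x : ~ A x -> (\int[m2]_y `|((EFin \o f) \_ (A `*` B)) (x, y)| = 0)%E.
  move=> nAx; apply: integral0_eq => y _.
  by rewrite patch_rectangle /patch (memNset nAx) abse0.
have hoo : (\int[m2]_(y in B) (h y)%:E < +oo)%E.
  move: ih => /integrableP[_]; apply: le_lt_trans.
  by under eq_integral => y /set_mem By do rewrite -(ger0_norm (h0 _ By)).
have h1 : (0 <= \int[m2]_(y in B) (h y)%:E)%E.
  by apply: integral_ge0 => y By; rewrite lee_fin h0.
apply: (@le_lt_trans _ _ (\int[m1]_(x in A) ((g x)%:E * \int[m2]_(y in B) (h y)%:E))%E).
  rewrite [leRHS]integral_mkcond; apply: ge0_le_integral => //.
  - by move=> x _; apply: integral_ge0.
  - apply: (@measurable_fun_fubini_tonelli_F _ _ _ _ _ _ (abse \o _)) => //=.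
    exact: measurableT_comp.
  - apply/(measurable_restrictT _ mA); apply: emeasurable_funM => //.
    by move: ig => /integrableP[].
  - move=> x _; rewrite [leRHS]/patch; case: ifPn => [/set_mem Ax|/negP nAx]; first exact: I1.
    by rewrite I2// => Ax; apply: nAx; rewrite mem_set.
rewrite ge0_integralZr//; last by move: ig => /integrableP[].
apply: lte_mul_pinfty => //.
- by apply: integral_ge0 => x Ax; rewrite lee_fin g0.
- rewrite ge0_fin_numE; last by apply: integral_ge0 => x Ax; rewrite lee_fin g0.
  move: ig => /integrableP[_]; apply: le_lt_trans.
  by under eq_integral => y /set_mem By do rewrite -(ger0_norm (g0 _ By)).
Qed.

Hypothesis if_ : (m1 \x m2)%E.-integrable (A `*` B) (EFin \o f).

Lemma Fubini_rectangle_lr :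
  (forall x, A x -> m2.-integrable B (EFin \o (fun y => f (x, y)))) ->
  \int[(m1 \x m2)%E]_(z in A `*` B) f z = \int[m1]_(x in A) \int[m2]_(y in B) f (x, y).
Proof.
move=> iy; rewrite /Rintegral; congr fine.
rewrite integral_mkcond -integral12_prod_meas1; last exact/(integrable_mkcond _ mAB).
rewrite [RHS]integral_mkcond; apply: eq_integral => x _; rewrite /fubini_F [in RHS]/patch.
case: ifPn => [/set_mem Ax|/negP nAx].
  rewrite fineK; last exact: integrable_fin_num (iy _ Ax).
  rewrite [RHS]integral_mkcond; apply: eq_integral => y _.
  by rewrite patch_rectangle /patch (mem_set Ax).
apply: integral0_eq => y _; rewrite patch_rectangle /patch memNset//.
by move=> Ax; apply: nAx; rewrite mem_set.
Qed.

Lemma Fubini_rectangle_rl :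
  (forall y, B y -> m1.-integrable A (EFin \o (fun x => f (x, y)))) ->
  \int[(m1 \x m2)%E]_(z in A `*` B) f z = \int[m2]_(y in B) \int[m1]_(x in A) f (x, y).
Proof.
move=> ix; rewrite /Rintegral; congr fine.
rewrite integral_mkcond -integral21_prod_meas1; last exact/(integrable_mkcond _ mAB).
rewrite [RHS]integral_mkcond; apply: eq_integral => y _; rewrite /fubini_G [in RHS]/patch.
case: ifPn => [/set_mem By|/negP nBy].
  rewrite fineK; last exact: integrable_fin_num (ix _ By).
  rewrite [RHS]integral_mkcond; apply: eq_integral => x _.
  by rewrite patch_rectangle /patch; case: ifPn => //; rewrite (mem_set By).
apply: integral0_eq => x _; rewrite patch_rectangle /patch; case: ifPn => //.
by case: ifPn => // /set_mem By; exfalso; apply: nBy; rewrite mem_set.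
Qed.

End Rectangles.

(** * Integrals along rays *)

Section Rays.
Variable R : realType.
Local Notation mu := (@lebesgue_measure R).
Local Notation Rp := (`[0, +oo[%classic : set R).
Implicit Types (F u : R * R -> R) (x e : R * R).

Definition ray e F : R * R -> R := superpose mu Rp (fun=> 1) (fun s : R => s *: e) F.

Definition dirder e F x : R := e.1 * pd 0 F x + e.2 * pd 1 F x.

Lemma rayE e F x : ray e F x = \int[mu]_(s in Rp) F (x + s *: e).
Proof. by rewrite /ray/superpose; under eq_Rintegral do rewrite mul1r. Qed.

Lemma measurable_line e : measurable_fun setT (fun s : R => s *: e).
Proof.
rewrite (_ : (fun s : R => s *: e) = fun s => (s * e.1, s * e.2))//.
by apply: measurable_fun_pair => //=; exact: mulrr_measurable.
Qed.

Variables (e : R * R) (e1 : e.1 ^+ 2 + e.2 ^+ 2 = 1).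

Lemma bracket2_unit (s : R) : bracket2 (s *: e) = 1 + (s - 0) ^+ 2.
Proof.
rewrite /bracket2 subr0 -addrA; congr (_ + _).
rewrite -[(s *: e).1]/(s * e.1) -[(s *: e).2]/(s * e.2) !exprMn -mulrDr e1.
exact: mulr1.
Qed.

Lemma integrable_ray_weight :
  mu.-integrable Rp (EFin \o (fun s : R => `|1| / bracket2 (s *: e))).
Proof.
rewrite (_ : (fun s : R => _) = fun s => (1 + (s - 0) ^+ 2)^-1).
  exact: integrable_bell.
by apply/funext => s; rewrite normr1 mul1r bracket2_unit.
Qed.

Lemma sm_ray F : sch F -> sm (ray e F).
Proof.
apply: sm_superpose => //; [exact: measurable_line|exact: integrable_ray_weight].
Qed.

Lemma pd_ray F i : sch F -> pd i (ray e F) = ray e (pd i F).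
Proof.
apply: pd_superpose => //; [exact: measurable_line|exact: integrable_ray_weight].
Qed.

Lemma rayD F u x : sch F -> sch u ->
  ray e (fun y => F y + u y) x = ray e F x + ray e u x.
Proof.
move=> sF su; apply: superposeD => //.
- exact: measurable_line.
- exact: integrable_ray_weight.
- exact/sm_continuous/sch_sm.
- exact: sch_rapid.
- exact/sm_continuous/sch_sm.
- exact: sch_rapid.
Qed.

Lemma rayZ F c x : sch F -> ray e (fun y => c * F y) x = c * ray e F x.
Proof.
move=> sF; apply: superposeZ => //.
- exact: measurable_line.
- exact: integrable_ray_weight.
- exact/sm_continuous/sch_sm.
- exact: sch_rapid.
Qed.

Lemma integrable_ray F x : sch F -> mu.-integrable Rp (EFin \o (fun s : R => F (x + s *: e))).
Proof.
move=> sF.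
rewrite (_ : (fun s : R => _) = (fun s : R => 1 * F (x + s *: e))); last first.
  by apply/funext => s; rewrite mul1r.
apply: integrable_superpose => //.
- exact: measurable_line.
- exact: integrable_ray_weight.
- exact/sm_continuous/sch_sm.
- exact: sch_rapid.
Qed.

Lemma sch_ray_bound F x : sch F ->
  exists2 C, 0 <= C & forall s : R, `|F (x + s *: e)| <= C / (1 + s ^+ 2).
Proof.
move=> /sch_rapid/(superpose_majorant (fun=> 1) (fun s : R => s *: e))[C C0 HC].
exists (C * bracket2 x) => [|s]; first by rewrite mulr_ge0// bracket2_ge0.
by have := HC x s; rewrite mul1r normr1 mul1r bracket2_unit subr0.
Qed.

Lemma sch_ray_cvg0 F x : sch F -> F (x + s *: e) @[s --> +oo] --> (0 : R).
Proof.
move=> /sch_ray_bound-/(_ x)[C C0 HC].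
apply: norm_cvg0; apply: (@squeeze_cvgr _ _ _ _ (fun=> 0) (fun s => C * s^-1)).
- near=> s; rewrite normr_ge0/= (le_trans (HC s))// ler_wpM2l//.
  have s1 : 1 <= s by near: s; apply: nbhs_pinfty_ge; exact: num_real.
  by rewrite lef_pV2 ?posrE; nra.
- exact: cvg_cst.
- rewrite -[X in _ --> X](mulr0 C); apply: cvgM; first exact: cvg_cst.
  have pos : \forall s \near +oo, (0 : R) < id s.
    by near=> s; near: s; apply: nbhs_pinfty_gt; exact: num_real.
  have [_] := @gtr0_cvgV0 R R +oo _ id pos; apply; exact: cvg_id.
Unshelve. all: by end_near. Qed.

Lemma is_derive_ray F x (s : R) : sm F ->
  is_derive s 1 (fun s : R => F (x + s *: e)) (dirder e F (x + s *: e)).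
Proof.
move=> /sm_C1 C1F.
have d i : is_derive s 1 (fun s : R => coordinate i x + s * coordinate i e) (coordinate i e).
  have -> : (fun s : R => coordinate i x + s * coordinate i e) =
     cst (coordinate i x) + coordinate i e *: id.
    by apply/funext => t /=; rewrite mulrC.
  have D := is_deriveD (is_derive_cst (coordinate i x) s (1 : R))
      (is_deriveZ (coordinate i e) (is_derive_id s (1 : R))).
    rewrite add0r in D; rewrite -[X in is_derive _ _ _ X]mulr1; exact D.
exact: (is_derive_curve C1F (d 0) (d 1)).
Qed.

Lemma sch_dirder F : sch F -> sch (dirder e F).
Proof. by move=> sF; apply: schD; apply: schZ; exact: sch_pd. Qed.

Lemma ray_FTC F x : sch F -> ray e (dirder e F) x = - F x.
Proof.
move=> sF; have [C C0 HC] := sch_ray_bound x (sch_dirder sF).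
transitivity (- F (x + 0 *: e)); last by rewrite scale0r addr0.
rewrite rayE; apply: (@dominated_FTC2y _ _ (fun s : R => F (x + s *: e)) C).
- move=> s; apply: (@continuous_comp _ _ _ (fun s : R => x + s *: e)).
    by apply: cvgD; [exact: cvg_cst|exact: scalel_continuous].
  exact/sm_continuous/sch_sm/sch_dirder.
- by move=> s; apply: is_derive_ray; exact: sch_sm.
- by move=> s _; exact: HC.
- exact: sch_ray_cvg0.
Qed.

End Rays.

(** * The gradient of the Newtonian potential in polar coordinates *)

Section Newton.
Variable R : realType.
Local Notation mu := (@lebesgue_measure R).
Local Notation Rp := (`[0, +oo[%classic : set R).
Local Notation circle := (`[0, 2 * pi]%classic : set R).
Local Notation mu2 := (mu \x mu)%E.
Implicit Types (F u : R * R -> R) (x : R * R) (k i j : 'I_2).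

Definition dir (t : R) : R * R := (cos t, sin t).

Lemma dir_unit t : (dir t).1 ^+ 2 + (dir t).2 ^+ 2 = 1.
Proof. exact: cos2Dsin2. Qed.

Lemma continuous_fst_plane : continuous (fun z : R * R => z.1).
Proof. by move=> z; exact: cvg_fst. Qed.

Lemma continuous_snd_plane : continuous (fun z : R * R => z.2).
Proof. by move=> z; exact: cvg_snd. Qed.

Lemma continuous_comp_fst (h : R -> R) : continuous h -> continuous (fun z : R * R => h z.1).
Proof.
move=> ch z; apply: (@continuous_comp _ _ _ (fun z : R * R => z.1) h); last exact: ch.
exact: continuous_fst_plane.
Qed.

Lemma continuous_comp_snd (h : R -> R) : continuous h -> continuous (fun z : R * R => h z.2).
Proof.
move=> ch z; apply: (@continuous_comp _ _ _ (fun z : R * R => z.2) h); last exact: ch.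
exact: continuous_snd_plane.
Qed.

Lemma continuous_dir k : continuous (fun z : R * R => coordinate k (dir z.1)).
Proof.
move=> z; elim/ord2P: k; rewrite /coordinate/=.
  apply: (@continuous_comp _ _ _ (fun z : R * R => z.1) cos).
    exact: continuous_fst_plane.
  exact: continuous_cos.
apply: (@continuous_comp _ _ _ (fun z : R * R => z.1) sin).
  exact: continuous_fst_plane.
exact: continuous_sin.
Qed.

Lemma coordinate_dir_le1 k t : `|coordinate k (dir t)| <= 1.
Proof.
rewrite ler_norml; elim/ord2P: k; rewrite /coordinate/=.
  by rewrite cos_geN1 cos_le1.
by rewrite sin_geN1 sin_le1.
Qed.

Lemma continuous_pairf (T : topologicalType) (f g : T -> R) :
  continuous f -> continuous g -> continuous (fun z => (f z, g z)).
Proof. by move=> cf cg z; exact: cvg_pair (cf z) (cg z). Qed.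

Lemma continuous_slice_r (G : R * R -> R) t : continuous G -> continuous (fun r => G (t, r)).
Proof.
move=> cG r; apply: (@continuous_comp _ _ _ (fun r => (t, r)) G); last exact: cG.
by apply: (@continuous_pairf R (fun=> t) id) => s; [exact: cvg_cst|exact: cvg_id].
Qed.

Lemma continuous_slice_l (G : R * R -> R) r : continuous G -> continuous (fun t => G (t, r)).
Proof.
move=> cG t; apply: (@continuous_comp _ _ _ (fun t => (t, r)) G); last exact: cG.
by apply: (@continuous_pairf R id (fun=> r)) => s; [exact: cvg_id|exact: cvg_cst].
Qed.

Lemma continuous_polar_coordinate k :
  continuous (fun z : R * R => z.2 * coordinate k (dir z.1)).
Proof.
by apply: continuousMf; [exact: continuous_snd_plane|exact: continuous_dir].
Qed.

Lemma continuous_polar : continuous (fun z : R * R => z.2 *: dir z.1).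
Proof.
exact: (continuous_pairf (@continuous_polar_coordinate 0)
  (@continuous_polar_coordinate 1)).
Qed.

Lemma integrable_circle (c : R) : mu.-integrable circle (EFin \o (fun=> c)).
Proof.
apply: continuous_compact_integrable; first exact: segment_compact.
by apply: continuous_subspaceT => z; exact: cvg_cst.
Qed.

Lemma twopi_gt0 : 0 < 2 * pi :> R.
Proof. by rewrite mulr_gt0// pi_gt0. Qed.

Lemma mu_circle : (mu circle = (2 * pi)%:E)%E.
Proof.
by rewrite lebesgue_measure_itv/= lte_fin twopi_gt0 oppr0 adde0.
Qed.

Lemma Rintegral_circle_cst (c : R) : \int[mu]_(t in circle) c = c * (2 * pi).
Proof. by rewrite /Rintegral integral_cst//= [X in (_ * X)%E]mu_circle. Qed.

Section PolarFubini.
Variables (G : R * R -> R) (C : R).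
Hypothesis cG : continuous G.
Hypothesis GC : forall t r, 0 <= r -> `|G (t, r)| <= C / (1 + r ^+ 2).

Let C0 : 0 <= C.
Proof.
by have := GC 0 (lexx 0); rewrite expr0n addr0 divr1; apply: le_trans.
Qed.

Lemma integrable_polar : mu2.-integrable (circle `*` Rp) (EFin \o G).
Proof.
apply: (@integrable_rectangle _ _ _ _ _ mu mu circle Rp _ _ G (fun=> C)
  (fun r => (1 + (r - 0) ^+ 2)^-1)) => //.
- exact: continuous_measurable_plane.
- by move=> t r _; rewrite /= in_itv/= andbT subr0 => /GC.
- exact: integrable_circle.
- exact: integrable_bell.
- by move=> r _; exact: bell_ge0.
Qed.

Lemma integrable_polar_radial t : mu.-integrable Rp (EFin \o (fun r => G (t, r))).
Proof.
apply: (@le_integrable _ _ _ mu Rp _ _ (EFin \o (fun r => C * (1 + (r - 0) ^+ 2)^-1))) => //.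
- apply/measurable_EFinP; apply: measurable_funTS; apply: continuous_measurable_fun.
  exact: continuous_slice_r.
- move=> r /=; rewrite in_itv/= andbT subr0 lee_fin => /GC H.
  by rewrite (le_trans (H t))// ler_norm.
- by apply: integrable_scale => //; exact: integrable_bell.
Qed.

Lemma integrable_polar_angular r : mu.-integrable circle (EFin \o (fun t => G (t, r))).
Proof.
apply: continuous_compact_integrable; first exact: segment_compact.
by apply: continuous_subspaceT; exact: continuous_slice_l.
Qed.

Lemma polar_Fubini_radial : \int[mu2]_(z in circle `*` Rp) G z =
  \int[mu]_(t in circle) \int[mu]_(r in Rp) G (t, r).
Proof.
apply: Fubini_rectangle_lr => //; first exact: integrable_polar.
by move=> t _; exact: integrable_polar_radial.
Qed.

Lemma polar_Fubini_angular : \int[mu2]_(z in circle `*` Rp) G z =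
  \int[mu]_(r in Rp) \int[mu]_(t in circle) G (t, r).
Proof.
apply: Fubini_rectangle_rl => //; first exact: integrable_polar.
by move=> t _; exact: integrable_polar_angular.
Qed.

End PolarFubini.

Definition newton_weight k (z : R * R) : R := - (2 * pi)^-1 * coordinate k (dir z.1).

(** [d_k Laplace^-1 F], the convolution of [F] with [x_k / (2 pi |x|^2)]. In polar
    coordinates [(t, r)] centred at [x] the Jacobian [r] cancels the singularity;
    the sign of the weight comes from evaluating [F] at [x + r dir t] rather than
    at [x - r dir t]. *)
Definition newton k F : R * R -> R :=
  superpose mu2 (circle `*` Rp) (newton_weight k) (fun z => z.2 *: dir z.1) F.

Lemma pi2_gt0 : 0 < (2 * pi)^-1 :> R.
Proof. by rewrite invr_gt0 twopi_gt0. Qed.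

Lemma continuous_newton_weight k : continuous (newton_weight k).
Proof. by apply: continuous_scale; exact: continuous_dir. Qed.

Lemma newton_weight_le k z : `|newton_weight k z| <= (2 * pi)^-1.
Proof.
rewrite normrM normrN (gtr0_norm pi2_gt0) ler_piMr ?coordinate_dir_le1//.
by rewrite ltW// pi2_gt0.
Qed.

Lemma measurable_newton_weight k : measurable_fun setT (newton_weight k).
Proof. by apply: continuous_measurable_plane; exact: continuous_newton_weight. Qed.

Lemma measurable_polar : measurable_fun setT (fun z : R * R => z.2 *: dir z.1).
Proof.
exact: (measurable_fun_pair
  (continuous_measurable_plane (@continuous_polar_coordinate 0))
  (continuous_measurable_plane (@continuous_polar_coordinate 1))).
Qed.

Lemma bracket2_polar (z : R * R) : bracket2 (z.2 *: dir z.1) = 1 + z.2 ^+ 2.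
Proof. by rewrite (bracket2_unit (dir_unit _)) subr0. Qed.

Lemma integrable_newton_weight k : mu2.-integrable (circle `*` Rp)
  (EFin \o (fun z => `|newton_weight k z| / bracket2 (z.2 *: dir z.1))).
Proof.
rewrite (_ : (fun z => _) = fun z : R * R => `|newton_weight k z| * (1 + (z.2 - 0) ^+ 2)^-1).
  apply: (@integrable_polar _ (2 * pi)^-1).
    move=> z; apply: (@cvgM _ _ _ _ (fun z => `|newton_weight k z|)).
      by apply: cvg_norm; exact: continuous_newton_weight.
    exact: (continuous_comp_snd (@continuous_bell R 0)).
  move=> t r _ /=; rewrite subr0 normrM normr_id [`|_^-1|]ger0_norm.
    by rewrite ler_wpM2r ?newton_weight_le// invr_ge0 addr_ge0// sqr_ge0.
  by rewrite invr_ge0 addr_ge0// sqr_ge0.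
by apply/funext => z; rewrite bracket2_polar subr0.
Qed.

Lemma sm_newton k F : sch F -> sm (newton k F).
Proof.
apply: sm_superpose.
- by apply: measurableX.
- exact: measurable_polar.
- exact: measurable_newton_weight.
- exact: integrable_newton_weight.
Qed.

Lemma pd_newton k F i : sch F -> pd i (newton k F) = newton k (pd i F).
Proof.
apply: pd_superpose.
- by apply: measurableX.
- exact: measurable_polar.
- exact: measurable_newton_weight.
- exact: integrable_newton_weight.
Qed.

Lemma newtonD k F u x : sch F -> sch u ->
  newton k (fun y => F y + u y) x = newton k F x + newton k u x.
Proof.
move=> sF su; apply: superposeD.
- by apply: measurableX.
- exact: measurable_polar.
- exact: measurable_newton_weight.
- exact: integrable_newton_weight.
- exact/sm_continuous/sch_sm.
- exact: sch_rapid.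
- exact/sm_continuous/sch_sm.
- exact: sch_rapid.
Qed.

Lemma newtonZ k F c x : sch F -> newton k (fun y => c * F y) x = c * newton k F x.
Proof.
move=> sF; apply: superposeZ.
- by apply: measurableX.
- exact: measurable_polar.
- exact: measurable_newton_weight.
- exact: integrable_newton_weight.
- exact/sm_continuous/sch_sm.
- exact: sch_rapid.
Qed.

Lemma integrable_newton k F x : sch F -> mu2.-integrable (circle `*` Rp)
  (EFin \o (fun z => newton_weight k z * F (x + z.2 *: dir z.1))).
Proof.
move=> sF; apply: integrable_superpose.
- by apply: measurableX.
- exact: measurable_polar.
- exact: measurable_newton_weight.
- exact: integrable_newton_weight.
- exact/sm_continuous/sch_sm.
- exact: sch_rapid.
Qed.

Lemma sch_polar_bound F x : sch F ->
  exists2 C, 0 <= C & forall t r : R, `|F (x + r *: dir t)| <= C / (1 + r ^+ 2).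
Proof.
move=> /sch_rapid/(superpose_majorant (fun=> 1) (fun z : R * R => z.2 *: dir z.1))[C C0 HC].
exists (C * bracket2 x) => [|t r]; first by rewrite mulr_ge0// bracket2_ge0.
by have := HC x (t, r); rewrite mul1r normr1 mul1r bracket2_polar.
Qed.

Lemma continuous_polar_sch F x : sch F ->
  continuous (fun z : R * R => F (x + z.2 *: dir z.1)).
Proof.
move=> sF z; apply: (@continuous_comp _ _ _ (fun z : R * R => x + z.2 *: dir z.1) F).
  by apply: cvgD; [exact: cvg_cst|exact: continuous_polar].
exact/sm_continuous/sch_sm.
Qed.

End Newton.

(** * Divergence, curl and scaling of the Newtonian gradient *)

Section NewtonFacts.
Variable R : realType.
Local Notation mu := (@lebesgue_measure R).
Local Notation Rp := (`[0, +oo[%classic : set R).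
Local Notation circle := (`[0, 2 * pi]%classic : set R).
Local Notation mu2 := (mu \x mu)%E.
Implicit Types (F u : R * R -> R) (x : R * R) (k i j : 'I_2).

Lemma circle_FTC (f H : R -> R) :
  continuous f -> (forall t : R, is_derive t 1 H (f t)) -> H (2 * pi) = H 0 ->
  \int[mu]_(t in circle) f t = 0.
Proof.
by move=> cf dH HE; rewrite (segment_FTC (twopi_gt0 R) cf dH) HE subrr.
Qed.

Lemma dir_periodic : dir (2 * pi) = dir 0 :> R * R.
Proof. by rewrite /dir mulr_natl cos2pi sin2pi cos0 sin0. Qed.

(** On each ray issuing from [x] the integrand is the radial derivative of [F],
    whose integral [- F x] does not depend on the direction. *)
Lemma newton_div F x : sch F -> newton 0 (pd 0 F) x + newton 1 (pd 1 F) x = F x.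
Proof.
move=> sF; pose G (z : R * R) := - (2 * pi)^-1 * dirder (dir z.1) F (x + z.2 *: dir z.1).
have [C0 _ H0] := sch_polar_bound x (sch_pd 0 sF).
have [C1 _ H1] := sch_polar_bound x (sch_pd 1 sF).
have cG : continuous G.
  apply: continuous_scale; apply: continuousDf; apply: continuousMf.
  - exact: (@continuous_dir R 0).
  - exact/continuous_polar_sch/sch_pd.
  - exact: (@continuous_dir R 1).
  - exact/continuous_polar_sch/sch_pd.
have GC t r : 0 <= r -> `|G (t, r)| <= (2 * pi)^-1 * (C0 + C1) / (1 + r ^+ 2).
  move=> _; rewrite normrM normrN (gtr0_norm (pi2_gt0 R)) -mulrA.
  rewrite ler_wpM2l ?(ltW (pi2_gt0 R))// (le_trans (ler_normD _ _))// mulrDl.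
  apply: lerD; rewrite normrM -[leRHS]mul1r ler_pM//.
  - exact: (@coordinate_dir_le1 R 0).
  - exact: (@coordinate_dir_le1 R 1).
rewrite /newton /superpose -RintegralD; last 3 first.
- by apply: measurableX.
- exact/integrable_newton/sch_pd.
- exact/integrable_newton/sch_pd.
transitivity (\int[mu2]_(z in circle `*` Rp) G z).
  apply: eq_Rintegral => z _; rewrite /G /newton_weight /dirder /coordinate/=; ring.
rewrite (polar_Fubini_radial cG GC).
rewrite (@eq_Rintegral _ _ _ mu circle (fun=> (2 * pi)^-1 * F x)); last first.
  move=> t _; rewrite /G/= RintegralZl//; last first.
    exact/integrable_ray/sch_dirder/sF/dir_unit.
  by rewrite -rayE (ray_FTC (dir_unit _) _ sF) mulNr mulrN opprK.
by rewrite Rintegral_circle_cst mulrAC mulVf ?mul1r// gt_eqF// twopi_gt0.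
Qed.

Lemma is_derive_value (f : R -> R) (t d d' : R) :
  is_derive t 1 f d -> d = d' -> is_derive t 1 f d'.
Proof. by move=> D <-. Qed.

Lemma is_derive_cosine_sine (a b c t : R) :
  is_derive t 1 (fun t : R => c + (a * cos t + b * sin t)) (a * - sin t + b * cos t).
Proof.
have D := is_deriveD (is_derive_cst c t (1 : R)) (is_deriveD
  (is_deriveZ a (is_derive_cos t)) (is_deriveZ b (is_derive_sin t))).
by rewrite add0r in D; exact D.
Qed.

(** [d_1 (d_0 Laplace^-1 F)] and [d_0 (d_1 Laplace^-1 F)] differ by an integral
    whose restriction to each circle is that of an angular derivative. *)
Lemma newton_curl F x : sch F -> newton 0 (pd 1 F) x = newton 1 (pd 0 F) x.
Proof.
move=> sF; apply/eqP; rewrite -subr_eq0; apply/eqP.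
pose G (z : R * R) := - (2 * pi)^-1 * (cos z.1 * pd 1 F (x + z.2 *: dir z.1) +
  - 1 * (sin z.1 * pd 0 F (x + z.2 *: dir z.1))).
have [C0 _ H0] := sch_polar_bound x (sch_pd 0 sF).
have [C1 _ H1] := sch_polar_bound x (sch_pd 1 sF).
have cG : continuous G.
  apply: continuous_scale; apply: continuousDf; last apply: continuous_scale;
    apply: continuousMf.
  - exact: (@continuous_dir R 0).
  - exact/continuous_polar_sch/sch_pd.
  - exact: (@continuous_dir R 1).
  - exact/continuous_polar_sch/sch_pd.
have GC t r : 0 <= r -> `|G (t, r)| <= (2 * pi)^-1 * (C1 + C0) / (1 + r ^+ 2).
  move=> _; rewrite normrM normrN (gtr0_norm (pi2_gt0 R)) -mulrA.
  rewrite ler_wpM2l ?(ltW (pi2_gt0 R))// (le_trans (ler_normD _ _))// mulrDl.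
  rewrite mulN1r normrN; apply: lerD; rewrite normrM -[leRHS]mul1r ler_pM//.
  - exact: (@coordinate_dir_le1 R 0).
  - exact: (@coordinate_dir_le1 R 1).
rewrite /newton /superpose -RintegralB; last 3 first.
- by apply: measurableX.
- exact/integrable_newton/sch_pd.
- exact/integrable_newton/sch_pd.
transitivity (\int[mu2]_(z in circle `*` Rp) G z).
  apply: eq_Rintegral => z _; rewrite /G /newton_weight /coordinate/=; ring.
rewrite (polar_Fubini_angular cG GC).
rewrite (@eq_Rintegral _ _ _ mu Rp (fun=> 0)); first by rewrite /Rintegral integral0.
move=> r _; have cGr := (@continuous_slice_l R G r cG).
(* For [r = 0] the integrand is not an angular derivative of [F], but a linear
   combination of [cos] and [sin]. *)
have [r0|r0] := eqVneq r 0.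
  pose H t := - (2 * pi)^-1 * (0 + (pd 0 F x * cos t + pd 1 F x * sin t)).
  apply: (@circle_FTC _ H cGr); last by rewrite /H mulr_natl cos2pi sin2pi cos0 sin0.
  move=> t; rewrite /G /= r0 scale0r addr0.
  have D := is_deriveZ (- (2 * pi)^-1) (is_derive_cosine_sine (pd 0 F x) (pd 1 F x) 0 t).
  apply: (is_derive_value D).
  by congr (_ * _); ring.
pose H t := (- (2 * pi)^-1 * r^-1) * F (x + r *: dir t).
apply: (@circle_FTC _ H cGr); last by rewrite /H dir_periodic.
move=> t.
have D := is_deriveZ (- (2 * pi)^-1 * r^-1) (is_derive_curve (sm_C1 (sch_sm sF))
  (is_derive_cosine_sine r 0 x.1 t) (is_derive_cosine_sine 0 r x.2 t)).
have DE : ((- (2 * pi)^-1 * r^-1) *: (fun t0 : R =>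
    F (x.1 + (r * cos t0 + 0 * sin t0), x.2 + (0 * cos t0 + r * sin t0)))) = H.
  apply/funext => s; rewrite /H.
  by rewrite -[LHS]/(_ * F (x.1 + (r * cos s + 0 * sin s), x.2 + (0 * cos s + r * sin s))) !mul0r addr0 add0r.
rewrite -DE; apply: (is_derive_value D).
rewrite !mul0r !addr0 !add0r /G /=.
rewrite -[(x.1 + r * cos t, x.2 + r * sin t)]/(x + r *: dir t).
rewrite -[_ *: _]/(_ * _) -[LHS]mulrA; congr (_ * _).
apply: (mulfI r0); rewrite mulrA mulfV// mul1r; ring.
Qed.

Definition euler F x : R := coordinate 0 x * pd 0 F x + coordinate 1 x * pd 1 F x.

Lemma sch_euler F : sch F -> sch (euler F).
Proof. by move=> sF; apply: schD; apply: sch_coordM; exact: sch_pd. Qed.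

(** Invariance of the Newton gradient under dilations centred at the origin,
    in infinitesimal form: the kernel is homogeneous of degree -1 in the plane. *)
Lemma newton_euler k F x : sch F ->
  coordinate 0 x * newton k (pd 0 F) x + coordinate 1 x * newton k (pd 1 F) x =
  newton k (euler F) x + newton k F x.
Proof.
move=> sF; apply/eqP; rewrite -subr_eq0; apply/eqP.
pose P y := (coordinate 0 x * pd 0 F y + coordinate 1 x * pd 1 F y) +
  -1 * (euler F y + F y).
have s0 := schZ (coordinate 0 x) (sch_pd 0 sF).
have s1 := schZ (coordinate 1 x) (sch_pd 1 sF).
have s2 := schD (sch_euler sF) sF.
have sP : sch P by apply: schD; [exact: schD|exact: schZ].
transitivity (newton k P x).
  rewrite (newtonD _ _ (schD s0 s1) (schZ (-1) s2)) (newtonD _ _ s0 s1).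
  rewrite (newtonZ _ _ _ s2) (newtonD _ _ (sch_euler sF) sF).
  by rewrite (newtonZ _ _ _ (sch_pd 0 sF)) (newtonZ _ _ _ (sch_pd 1 sF)) mulN1r.
have [C C0 HC] := sch_polar_bound x sP.
have [CF CF0 HF] := sch_polar_bound x sF.
pose G (z : R * R) := newton_weight k z * P (x + z.2 *: dir z.1).
have cG : continuous G.
  by apply: continuousMf; [exact: continuous_newton_weight|exact: continuous_polar_sch].
have GC t r : 0 <= r -> `|G (t, r)| <= (2 * pi)^-1 * C / (1 + r ^+ 2).
  by move=> _; rewrite normrM -mulrA; apply: ler_pM; rewrite ?newton_weight_le.
rewrite -[LHS]/(\int[mu2]_(z in circle `*` Rp) G z) (polar_Fubini_radial cG GC).
rewrite (@eq_Rintegral _ _ _ mu circle (fun=> 0)); first by rewrite /Rintegral integral0.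
move=> t _; rewrite /G /newton_weight /= RintegralZl//; last by apply: integrable_ray => //; exact: dir_unit.
(* Along the ray, [P] is the derivative of [H]. *)
pose H r := - (r * F (x + r *: dir t)).
suff -> : \int[mu]_(r in Rp) P (x + r *: dir t) = - H 0.
  by rewrite /H mul0r !oppr0 mulr0.
have cvH : H r @[r --> +oo] --> (0 : R).
  rewrite -[X in _ --> X]oppr0; apply: cvgN; apply: norm_cvg0.
  apply: (@squeeze_cvgr _ _ _ _ (fun=> 0) (fun r => CF * r^-1)).
  - near=> r; rewrite normr_ge0/= normrM.
    have r1 : 1 <= r by near: r; apply: nbhs_pinfty_ge; exact: num_real.
    rewrite ger0_norm ?(le_trans ler01)//.
    rewrite (le_trans (ler_wpM2l _ (HF t r))) ?(le_trans ler01)//.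
    rewrite mulrCA ler_wpM2l// ler_pdivrMr; last by rewrite ltr_pwDl// sqr_ge0.
    have rV : r^-1 * r = 1 by rewrite mulVf// gt_eqF// (lt_le_trans _ r1).
    have : 0 <= r^-1 by rewrite invr_ge0 (le_trans ler01).
    nra.
  - exact: cvg_cst.
  - rewrite -[X in _ --> X](mulr0 CF); apply: cvgM; first exact: cvg_cst.
    have pos : \forall s \near +oo, (0 : R) < id s.
      by near=> s; near: s; apply: nbhs_pinfty_gt; exact: num_real.
    have [_] := @gtr0_cvgV0 R R +oo _ id pos; apply; exact: cvg_id.
apply: (@dominated_FTC2y R (fun r : R => P (x + r *: dir t)) H C) => //.
- move=> r; exact (@continuous_slice_r R (fun z : R * R => P (x + z.2 *: dir z.1)) t (@continuous_polar_sch R P x sP) r).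
- move=> r.
  have D := is_deriveN (is_deriveM (is_derive_id r (1 : R))
    (is_derive_ray (dir t) x r (sch_sm sF))).
  apply: (is_derive_value D).
  rewrite /P /euler /dirder -[_ *: 1]/(_ * _) mulr1 -[_ *: _]/(_ * _) /=.
  rewrite -[(x + r *: dir t)]/(x.1 + r * cos t, x.2 + r * sin t).
  rewrite /coordinate /=; ring.
Unshelve. all: by end_near. Qed.

End NewtonFacts.

(** * Decay of the Newtonian gradient *)

Section NewtonDecay.
Variable R : realType.
Local Notation mu := (@lebesgue_measure R).
Local Notation Rp := (`[0, +oo[%classic : set R).
Local Notation circle := (`[0, 2 * pi]%classic : set R).
Local Notation mu2 := (mu \x mu)%E.
Implicit Types (F u : R * R -> R) (x : R * R) (k i j : 'I_2).

Definition along x t : R := x.1 * cos t + x.2 * sin t.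
Definition across x t : R := - x.1 * sin t + x.2 * cos t.

Lemma along_across x t : along x t ^+ 2 + across x t ^+ 2 = x.1 ^+ 2 + x.2 ^+ 2.
Proof.
have := cos2Dsin2 t; rewrite /along /across.
move: (cos t) (sin t) => c s cs.
transitivity ((x.1 ^+ 2 + x.2 ^+ 2) * (c ^+ 2 + s ^+ 2)); first ring.
by rewrite cs mulr1.
Qed.

Lemma bracket2_polar_split x t r :
  bracket2 (x + r *: dir t) = 1 + (r + along x t) ^+ 2 + across x t ^+ 2.
Proof.
rewrite /bracket2 -[(x + r *: dir t)]/(x.1 + r * cos t, x.2 + r * sin t) /=.
have := cos2Dsin2 t; rewrite /along /across.
move: (cos t) (sin t) => c s cs.
have : r ^+ 2 * (c ^+ 2 + s ^+ 2) = r ^+ 2 by rewrite cs mulr1.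
have : x.1 ^+ 2 * (c ^+ 2 + s ^+ 2) = x.1 ^+ 2 by rewrite cs mulr1.
have : x.2 ^+ 2 * (c ^+ 2 + s ^+ 2) = x.2 ^+ 2 by rewrite cs mulr1.
lra.
Qed.

Lemma is_derive_along x (t : R) : is_derive t 1 (along x) (across x t).
Proof.
have D := is_derive_cosine_sine x.1 x.2 0 t.
have -> : along x = fun t => 0 + (x.1 * cos t + x.2 * sin t).
  by apply/funext => s; rewrite add0r.
by apply: (is_derive_value D); rewrite /across; ring.
Qed.

Lemma is_derive_across x (t : R) : is_derive t 1 (across x) (- along x t).
Proof.
have D := is_derive_cosine_sine x.2 (- x.1) 0 t.
have -> : across x = fun t => 0 + (x.2 * cos t + - x.1 * sin t).
  by apply/funext => s; rewrite add0r addrC.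
by apply: (is_derive_value D); rewrite /along; ring.
Qed.

Lemma continuous_along x : continuous (along x).
Proof. by move=> t; exact: (is_derive_continuous (is_derive_along x t)). Qed.

Lemma continuous_across x : continuous (across x).
Proof. by move=> t; exact: (is_derive_continuous (is_derive_across x t)). Qed.

Lemma continuousM1 (f g : R -> R) : continuous f -> continuous g ->
  continuous (fun t => f t * g t).
Proof. by move=> cf cg t; exact: cvgM (cf t) (cg t). Qed.

Lemma continuousD1 (f g : R -> R) : continuous f -> continuous g ->
  continuous (fun t => f t + g t).
Proof. by move=> cf cg t; exact: cvgD (cf t) (cg t). Qed.

Lemma continuous_atan_across x : continuous (fun t => atan (across x t)).
Proof.
move=> t; apply: (@continuous_comp _ _ _ (across x) atan).
  exact: continuous_across.
exact: continuous_atan.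
Qed.

Lemma continuous_bell_across x : continuous (fun t => (1 + across x t ^+ 2)^-1).
Proof.
move=> t; under eq_fun do rewrite -[across x _]subr0.
apply: (@continuous_comp _ _ _ (across x) (fun s => (1 + (s - 0) ^+ 2)^-1)).
  exact: continuous_across.
exact: continuous_bell.
Qed.

Lemma integrable_circle_continuous (f : R -> R) : continuous f ->
  mu.-integrable circle (EFin \o f).
Proof.
move=> cf; apply: continuous_compact_integrable; first exact: segment_compact.
exact: continuous_subspaceT.
Qed.

(** [along x] and [across x] are, up to sign, derivatives of each other, so that
    the periodic function [along x * atan (across x)] is an antiderivative of the
    difference of the integrands. *)
Lemma circle_integration_by_parts x :
  \int[mu]_(t in circle) (along x t ^+ 2 * (1 + across x t ^+ 2)^-1) =
  \int[mu]_(t in circle) (across x t * atan (across x t)).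
Proof.
have c1 : continuous (fun t => along x t ^+ 2 * (1 + across x t ^+ 2)^-1).
  apply: continuousM1; last exact: continuous_bell_across.
  by under eq_fun do rewrite expr2; apply: continuousM1; exact: continuous_along.
have c2 : continuous (fun t => across x t * atan (across x t)).
  by apply: continuousM1; [exact: continuous_across|exact: continuous_atan_across].
apply/esym/eqP; rewrite -subr_eq0 -RintegralB//; last 2 first.
- exact: integrable_circle_continuous.
- exact: integrable_circle_continuous.
apply/eqP; apply: (@circle_FTC _ _ (fun t => along x t * atan (across x t))).
- apply: continuousD1 => //; move=> t; apply: cvgN; exact: c1.
- move=> t.
  have D := is_deriveM (is_derive_along x t)
    (is_derive1_comp (is_derive1_atan (across x t)) (is_derive_across x t)).
  apply: (is_derive_value D).
  rewrite -[_ *: _]/(_ * _) -[X in _ + X]/(_ * _) /=; ring.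
- by rewrite /along /across mulr_natl cos2pi sin2pi cos0 sin0.
Qed.

(** The integrand concentrates near the directions of [x] and [- x], on arcs of
    length of order [1 / |x|]. Instead of localizing there, multiply it by
    [|x|^2 = along^2 + across^2]: integration by parts bounds the first term by a
    multiple of [|x|], and the second one is at most 1 under the integral sign. *)
Lemma circle_bound : exists K : R, forall x,
  (1 + abs2 x) * \int[mu]_(t in circle) (1 + across x t ^+ 2)^-1 <= K.
Proof.
(* [2 * (2 pi)] is enough for [|x| <= 1], and [2 pi + 6 pi] for [|x| >= 1]. *)
exists (12 * pi) => x; set J := (X in _ * X).
have pi0 := pi_gt0 R.
have bell1 t : (1 + across x t ^+ 2)^-1 <= 1.
  by rewrite invf_le1 ?lerDl ?sqr_ge0// ltr_pwDl// sqr_ge0.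
have J0 : 0 <= J.
  by apply: Rintegral_ge0 => t _; rewrite invr_ge0 addr_ge0// sqr_ge0.
have cb := @continuous_bell_across x.
have J1 : J <= 2 * pi.
  rewrite -[leRHS]mul1r -Rintegral_circle_cst; apply: le_Rintegral => //.
  - exact: integrable_circle_continuous.
  - exact: integrable_circle.
have c1 : continuous (fun t => along x t ^+ 2 * (1 + across x t ^+ 2)^-1).
  apply: continuousM1; last exact: continuous_bell_across.
  by under eq_fun do rewrite expr2; apply: continuousM1; exact: continuous_along.
have c2 : continuous (fun t => across x t * atan (across x t)).
  by apply: continuousM1; [exact: continuous_across|exact: continuous_atan_across].
have c3 : continuous (fun t => across x t ^+ 2 * (1 + across x t ^+ 2)^-1).
  apply: continuousM1; last exact: continuous_bell_across.
  by under eq_fun do rewrite expr2; apply: continuousM1; exact: continuous_across.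
have J2 : abs2 x ^+ 2 * J <= 4 * pi * abs2 x + 2 * pi.
  have -> : abs2 x ^+ 2 * J =
      \int[mu]_(t in circle) (along x t ^+ 2 * (1 + across x t ^+ 2)^-1) +
      \int[mu]_(t in circle) (across x t ^+ 2 * (1 + across x t ^+ 2)^-1).
    rewrite -RintegralD//; last 2 first.
    - exact: integrable_circle_continuous.
    - exact: integrable_circle_continuous.
    rewrite /J -RintegralZl//; last exact: integrable_circle_continuous.
    by apply: eq_Rintegral => t _; rewrite -mulrDl along_across sqr_abs2.
  apply: lerD.
    rewrite circle_integration_by_parts.
    apply: (@le_trans _ _ (\int[mu]_(t in circle) (2 * abs2 x))); last first.
      by rewrite Rintegral_circle_cst; lra.
    apply: le_Rintegral => //.
    - exact: integrable_circle_continuous.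
    - exact: integrable_circle.
    - move=> t _; rewrite (le_trans (ler_norm _))// normrM mulrC.
      have a2 : `|atan (across x t)| <= 2.
        have := atan_gtNpi2 (across x t); have := atan_ltpi2 (across x t).
        have := pihalf_lt2 R; rewrite ler_norml; lra.
      have b2 : `|across x t| <= abs2 x.
        rewrite abs2E -sqrtr_sqr; apply: ler_wsqrtr.
        by rewrite -(along_across x t) lerDr sqr_ge0.
      exact: ler_pM.
  rewrite -[leRHS]mul1r -Rintegral_circle_cst; apply: le_Rintegral => //.
  - exact: integrable_circle_continuous.
  - exact: integrable_circle.
  - by move=> t _; rewrite ler_pdivrMr ?mul1r ?lerDr// ltr_pwDl// sqr_ge0.
have x0 := abs2_ge0 x.
have [x1|x1] := leP (abs2 x) 1.
  rewrite (le_trans (ler_wpM2r J0 (_ : 1 + abs2 x <= 2))) ?lerD2l//; lra.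
have x2 : 0 < abs2 x by apply: lt_trans x1.
have xJ : abs2 x * J <= 6 * pi.
  rewrite -(ler_pM2l x2) mulrA -expr2 (le_trans J2)//.
  have : pi * 1 <= pi * abs2 x by rewrite ler_wpM2l// ltW.
  lra.
by rewrite mulrDl mul1r; lra.
Qed.

(** On the ray of direction [t], the rapid decay of [F] bounds it by a bell in [r]
    centred at [- along x t] times [1 / (1 + across^2)]: the radial integral is
    bounded, and [circle_bound] takes care of the angular one. *)
Lemma newton_decay k F : sch F -> decay 1 (newton k F).
Proof.
move=> sF; have [C HC] := sch_rapid sF 2.
have C0 : 0 <= C.
  by have := HC 0; apply: le_trans; rewrite mulr_ge0// exprn_ge0// bracket2_ge0.
have [K HK] := circle_bound.
exists ((2 * pi)^-1 * C * pi * K) => x; rewrite expr1.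
pose c := (2 * pi)^-1 * C.
have c0 : 0 <= c by rewrite mulr_ge0// ltW// pi2_gt0.
pose M (z : R * R) := c * ((1 + across x z.1 ^+ 2)^-1 * (1 + (z.2 + along x z.1) ^+ 2)^-1).
have cM : continuous M.
  apply: continuous_scale; apply: continuousMf.
    exact: (continuous_comp_fst (@continuous_bell_across x)).
  move=> z; under eq_fun do rewrite -[_ + along _ _]subr0.
  apply: (@continuous_comp _ _ _ (fun z : R * R => z.2 + along x z.1)
     (fun s => (1 + (s - 0) ^+ 2)^-1)).
    apply: continuousDf; first exact: continuous_snd_plane.
    exact: (continuous_comp_fst (@continuous_along x)).
  exact: continuous_bell.
have bell1 (b : R) : (1 + b ^+ 2)^-1 <= 1.
  by rewrite invf_le1 ?lerDl ?sqr_ge0// ltr_pwDl// sqr_ge0.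
have bell0 (b : R) : 0 <= (1 + b ^+ 2)^-1 by rewrite invr_ge0 addr_ge0// sqr_ge0.
have oned0 (b : R) : 0 < 1 + b ^+ 2 by rewrite ltr_pwDl// sqr_ge0.
have M0 z : 0 <= M z by apply: mulr_ge0 => //; apply: mulr_ge0.
have MC t r : 0 <= r -> `|M (t, r)| <= c * (2 * bracket2 x) / (1 + r ^+ 2).
  move=> _; rewrite (ger0_norm (M0 _)) /M /= -[leRHS]mulrA; apply: ler_wpM2l => //.
  rewrite ler_pdivlMr//.
  rewrite mulrAC ler_pdivrMr//.
  apply: (@le_trans _ _ (1 + r ^+ 2)).
    by rewrite ler_piMl// ltW.
  have ax : along x t ^+ 2 <= x.1 ^+ 2 + x.2 ^+ 2.
    by rewrite -(along_across x t) lerDl sqr_ge0.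
  apply: (@le_trans _ _ (2 * (1 + along x t ^+ 2) * (1 + (r + along x t) ^+ 2))).
    have := sqr_ge0 (2 * along x t + r).
    have := mulr_ge0 (sqr_ge0 (along x t)) (sqr_ge0 (r + along x t)).
    nra.
  apply: ler_wpM2r; first exact: ltW.
  by apply: ler_wpM2l => //; rewrite /bracket2 -addrA lerD2l.
have FM z : `|newton_weight k z * F (x + z.2 *: dir z.1)| <= M z.
  rewrite normrM /M /c -mulrA; apply: ler_pM => //; first exact: newton_weight_le.
  rewrite -invfM ler_pdivlMr ?mulr_gt0// mulrC (le_trans _ (HC (x + z.2 *: dir z.1)))//.
  rewrite ler_wpM2r// bracket2_polar_split.
  have := mulr_ge0 (sqr_ge0 (z.2 + along x z.1)) (sqr_ge0 (across x z.1)).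
  have := sqr_ge0 (z.2 + along x z.1); have := sqr_ge0 (across x z.1).
  move: (z.2 + _) (across x z.1) => a b; nra.
have N1 : `|newton k F x| <= \int[mu2]_(z in circle `*` Rp) M z.
  apply: superpose_le => //.
  - by apply: measurableX.
  - exact: measurable_polar.
  - exact: measurable_newton_weight.
  - exact: integrable_newton_weight.
  - exact/sm_continuous/sch_sm.
  - exact: sch_rapid.
  - exact: integrable_polar cM MC.
rewrite (polar_Fubini_radial cM MC) in N1.
have ME t : \int[mu]_(r in Rp) M (t, r) =
    c * ((1 + across x t ^+ 2)^-1 * (pi / 2 - atan (along x t))).
  have ib : mu.-integrable Rp (EFin \o (fun r => (1 + (r - - along x t) ^+ 2)^-1)).
    exact: integrable_bell.
  rewrite /M/= [LHS](@eq_Rintegral _ _ _ mu Rp (fun r => c * ((1 + across x t ^+ 2)^-1 *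
    (1 + (r - - along x t) ^+ 2)^-1))); last by move=> r _; rewrite opprK.
  rewrite RintegralZl//; last exact: integrable_scale.
  by rewrite RintegralZl// /Rintegral integral_bell/= opprK add0r.
have N2 : \int[mu]_(t in circle) \int[mu]_(r in Rp) M (t, r) <=
   (c * pi) * \int[mu]_(t in circle) (1 + across x t ^+ 2)^-1.
  rewrite -RintegralZl//; last exact/integrable_circle_continuous/continuous_bell_across.
  under eq_Rintegral do rewrite ME.
  apply: le_Rintegral => //.
  - apply: integrable_circle_continuous; apply: continuous_scale.
    apply: continuousM1; first exact: continuous_bell_across.
    apply: continuousD1; first by move=> t; exact: cvg_cst.
    move=> t; apply: cvgN; apply: (@continuous_comp _ _ _ (along x) atan).
      exact: continuous_along.
    exact: continuous_atan.
  - by apply: integrable_scale => //; exact/integrable_circle_continuous/continuous_bell_across.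
  - move=> t _; rewrite -[leRHS]mulrA; apply: ler_wpM2l => //; rewrite mulrC.
    apply: ler_wpM2r => //.
    by have := atan_gtNpi2 (along x t); lra.
have a0 := oneDabs2_gt0 x.
rewrite (le_trans (ler_wpM2l (ltW a0) (le_trans N1 N2)))// mulrCA ler_wpM2l//.
by rewrite mulr_ge0// pi_ge0.
Qed.

End NewtonDecay.

(** * Decay of the derivatives of the Newtonian gradient *)

Section NewtonSymbol.
Variable R : realType.
Implicit Types (F u : R * R -> R) (x : R * R) (k i j : 'I_2).

Lemma sch_der F : sch F -> derivable_everywhere F.
Proof. by move=> /sch_sm/sm_derivable. Qed.

Lemma pd_euler F i : sch F -> pd i (euler F) = fun x => euler (pd i F) x + pd i F x.
Proof.
move=> sF; have s0 := sch_pd 0 sF; have s1 := sch_pd 1 sF.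
rewrite /euler pdD; [|exact/sch_der/sch_coordM|exact/sch_der/sch_coordM].
rewrite pd_coordM; last exact: sch_der.
rewrite pd_coordM; last exact: sch_der.
apply/funext => x; rewrite (sm_pdC i 0 (sch_sm sF)) (sm_pdC i 1 (sch_sm sF)).
by elim/ord2P: i; rewrite /=; ring.
Qed.

Lemma pds_lin s F u (c : R) : sch F -> sch u ->
  pds s (fun x => F x + c * u x) = fun x => pds s F x + c * pds s u x.
Proof.
move=> sF su; elim: s => //= i s ->.
have sF' := sch_pds s sF; have su' := sch_pds s su.
by rewrite pdD ?pdZ //; [exact: sch_der|exact: sch_der|exact/sch_der/schZ].
Qed.

Lemma pds_euler F s : sch F ->
  pds s (euler F) = fun x => euler (pds s F) x + (size s)%:R * pds s F x.
Proof.
move=> sF; elim: s => [|i s IH]; first by apply/funext => x; rewrite mul0r addr0.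
have sF' := sch_pds s sF.
rewrite /= IH pdD; [|exact/sch_der/sch_euler|exact/sch_der/schZ].
rewrite pd_euler// pdZ; last exact: sch_der.
apply/funext => x; rewrite -natr1; ring.
Qed.

Lemma pds_newton k F s : sch F -> pds s (newton k F) = newton k (pds s F).
Proof.
by move=> sF; elim: s => //= i s ->; rewrite pd_newton//; exact: sch_pds.
Qed.

(** Since [(1 + |x|)^2 <= 2 (1 + |x|^2)]. *)
Lemma decay_sqr m u : decay m u ->
  decay m (fun x => (coordinate 0 x ^+ 2 + coordinate 1 x ^+ 2) * u x) ->
  decay m.+2 u.
Proof.
move=> [C HC] [D HD]; exists (2 * (C + D)) => x.
have := HC x; have := HD x.
have -> : coordinate 0 x ^+ 2 + coordinate 1 x ^+ 2 = abs2 x ^+ 2 by rewrite sqr_abs2.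
rewrite normrM (ger0_norm (sqr_ge0 _)) !exprS.
have p0 : 0 <= (1 + abs2 x) ^+ m by rewrite exprn_ge0// ltW// oneDabs2_gt0.
set P := (1 + abs2 x) ^+ m in p0 *; set U := `|u x|.
have PU : 0 <= P * U by rewrite mulr_ge0// normr_ge0.
have := mulr_ge0 PU (sqr_ge0 (1 - abs2 x)).
nra.
Qed.

Lemma decay_ext m u v : u =1 v -> decay m u -> decay m v.
Proof. by move=> /funext ->. Qed.

Lemma decayB m u v : decay m u -> decay m v -> decay m (fun x => u x - v x).
Proof.
move=> du /(decayZ (-1)) dv; apply: decay_ext (decayD du dv) => x.
by rewrite mulN1r.
Qed.

(** Each new derivative gains one power of decay: the Euler identity controls the
    radial part of the gradient of the curl-free field [newton _ G], and the
    divergence identity then determines the rest. *)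
Lemma newton_pds_decay s k F : sch F -> decay (size s).+1 (newton k (pds s F)).
Proof.
elim: s k F => [|i s IH] k F sF; first exact: newton_decay.
rewrite /=; set G := pds s F; have sG : sch G by exact: sch_pds.
(* Chosen so that [pds s F'] is the right-hand side of the Euler identity of [G]. *)
pose F' x := euler F x + (1 - (size s)%:R) * F x.
have sF' : sch F' by apply: schD; [exact: sch_euler|exact: schZ].
have F'E : pds s F' = fun x => euler G x + G x.
  rewrite pds_lin//; last exact: sch_euler.
  rewrite pds_euler//; apply/funext => x; rewrite /G; ring.
have Dp l : decay (size s).+1 (fun x => coordinate 0 x * newton l (pd 0 G) x +
    coordinate 1 x * newton l (pd 1 G) x).
  apply: decay_ext (IH l F' sF') => x; rewrite F'E newton_euler//.
  by rewrite newtonD//; exact: sch_euler.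
have D0 l j : decay (size s) (newton l (pd j G)).
  apply: decay_weak; have := IH l (pd j F) (sch_pd j sF).
  by rewrite (sm_pdsC _ _ (sch_sm sF)).
have DG m : decay m G by apply/rapid_decay/sch_rapid.
have DGc m j : decay m (fun x => coordinate j x * G x).
  exact/decay_coordM/DG.
(* With [a = newton 0 (pd 0 G)] and [b = newton 0 (pd 1 G)], the functions bounded
   in [Dp] are [x_0 a + x_1 b] and [x_0 b + x_1 (G - a)]; solving for [a] and [b]
   multiplies them by [|x|^2]. *)
have DA : decay (size s).+2 (newton 0 (pd 0 G)).
  apply: decay_sqr => //.
  have := decayD (decayB (decay_coordM 0 (Dp 0)) (decay_coordM 1 (Dp 1)))
    (decay_coordM 1 (DGc (size s).+1 1)).
  apply: decay_ext => x.
  rewrite (newton_curl x sG) -(newton_div x sG); ring.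
have DB : decay (size s).+2 (newton 0 (pd 1 G)).
  apply: decay_sqr => //.
  have := decayB (decayD (decay_coordM 1 (Dp 0)) (decay_coordM 0 (Dp 1)))
    (decay_coordM 0 (DGc (size s).+1 1)).
  apply: decay_ext => x.
  rewrite (newton_curl x sG) -(newton_div x sG); ring.
elim/ord2P: k; elim/ord2P: i => //.
- by apply: decay_ext DB => x; exact: newton_curl.
- apply: decay_ext (decayB (DG _) DA) => x.
  by rewrite -(newton_div x sG) addrC addrA addNr add0r.
Qed.

Lemma sym_newton k F : sch F -> sym 1 (newton k F).
Proof.
move=> sF; split; first exact: sm_newton.
by move=> s; rewrite pds_newton// add1n; exact: newton_pds_decay.
Qed.

End NewtonSymbol.

(** * Third derivatives of the biharmonic potential *)

Section Potential.
Variable R : realType.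
Implicit Types (F u v : R * R -> R) (x : R * R) (k i j l : 'I_2).

(** With a void bound, so that smooth functions inherit the closure properties of
    [tame]. *)
Lemma sm_tame u m : sm u <-> tame (fun _ (_ : R * R -> R) => True) m u.
Proof. by split=> [su|[]//]; split. Qed.

Lemma smD u v : sm u -> sm v -> sm (fun x => u x + v x).
Proof.
by move=> /(sm_tame _ 0) su /(sm_tame _ 0) sv; apply/(sm_tame _ 0); apply: tameD.
Qed.

Lemma smZ c u : sm u -> sm (fun x => c * u x).
Proof. by move=> /(sm_tame _ 0) su; apply/(sm_tame _ 0); apply: tameZ. Qed.

Lemma smB u v : sm u -> sm v -> sm (fun x => u x - v x).
Proof.
by move=> /(sm_tame _ 0) su /(sm_tame _ 0) sv; apply/(sm_tame _ 0); apply: tameB.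
Qed.

Lemma sm_coordM j u : sm u -> sm (fun x => coordinate j x * u x).
Proof. by move=> /(sm_tame _ 1) su; apply/(sm_tame _ 0); apply: tame_coordM. Qed.

Lemma sm_pdD i u v : sm u -> sm v ->
  pd i (fun x => u x + v x) = fun x => pd i u x + pd i v x.
Proof. by move=> su sv; apply: pdD; exact: sm_derivable. Qed.

Lemma sm_pdZ i c u : sm u -> pd i (fun x => c * u x) = fun x => c * pd i u x.
Proof. by move=> su; apply: pdZ; exact: sm_derivable. Qed.

Lemma sm_pdB i u v : sm u -> sm v ->
  pd i (fun x => u x - v x) = fun x => pd i u x - pd i v x.
Proof.
move=> su sv; have E w : (fun x => - w x) = fun x : R * R => -1 * w x :> R.
  by apply/funext => x; rewrite mulN1r.
transitivity (pd i (fun x => u x + -1 * v x)).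
  by congr (pd i _); apply/funext => x; rewrite mulN1r.
rewrite sm_pdD ?sm_pdZ//; last exact: smZ.
by apply/funext => x; rewrite mulN1r.
Qed.

Definition lap u x : R := pd 0 (pd 0 u) x + pd 1 (pd 1 u) x.

Lemma sm_lap u : sm u -> sm (lap u).
Proof. by move=> su; apply: smD; do 2!apply: sm_pd. Qed.

Lemma lapD u v : sm u -> sm v -> lap (fun x => u x + v x) = fun x => lap u x + lap v x.
Proof.
move=> su sv; apply/funext => x; rewrite /lap !sm_pdD//; try exact: sm_pd.
by ring.
Qed.

Lemma lapZ c u : sm u -> lap (fun x => c * u x) = fun x => c * lap u x.
Proof.
move=> su; apply/funext => x; rewrite /lap !sm_pdZ//; try exact: sm_pd.
by ring.
Qed.

Lemma lapB u v : sm u -> sm v -> lap (fun x => u x - v x) = fun x => lap u x - lap v x.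
Proof.
move=> su sv; apply/funext => x; rewrite /lap !sm_pdB//; try exact: sm_pd.
by ring.
Qed.

Lemma pd_lap i u : sm u -> pd i (lap u) = lap (pd i u).
Proof.
move=> su; rewrite /lap sm_pdD; [|by do 2!apply: sm_pd|by do 2!apply: sm_pd].
by rewrite !(sm_pdC i _ (sm_pd _ su)) !(sm_pdC i _ su).
Qed.

Lemma lap_coordM i u : sm u ->
  lap (fun x => coordinate i x * u x) = fun x => coordinate i x * lap u x + 2 * pd i u x.
Proof.
move=> su; apply/funext => x; rewrite /lap.
have E l : pd l (pd l (fun x => coordinate i x * u x)) = fun x =>
    coordinate i x * pd l (pd l u) x + (l == i)%:R * pd l u x + (l == i)%:R * pd l u x.
  rewrite pd_coordM; last exact: sm_derivable.
  rewrite sm_pdD; [|exact/sm_coordM/sm_pd|exact: smZ].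
  rewrite pd_coordM; last exact/sm_derivable/sm_pd.
  by rewrite sm_pdZ.
by rewrite !E; elim/ord2P: i {E}; rewrite /=; ring.
Qed.

Lemma lap_newton k F : sch F -> lap (newton k F) = pd k F.
Proof.
move=> sF; apply/funext => x; rewrite /lap.
rewrite !pd_newton//; try exact: sch_pd.
have sF0 := sch_pd 0 sF; have sF1 := sch_pd 1 sF.
elim/ord2P: k.
  rewrite (newton_curl x sF1) (sm_pdC 0 1 (sch_sm sF)) -(newton_div x sF0).
  by [].
rewrite -(newton_curl x sF0) (sm_pdC 1 0 (sch_sm sF)) -(newton_div x sF1).
by [].
Qed.

(** [d_i d_j d_k Laplace^-2 F], written without the biharmonic kernel: the
    commutator of multiplication by [x_i] with [d_j Laplace^-1] is, up to lower
    order terms, [2 d_i d_j Laplace^-2]. *)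
Definition potential i j k F x : R :=
  2^-1 * ((coordinate i x * newton j (pd k F) x
           - newton j (pd k (fun y => coordinate i y * F y)) x)
          + ((i == k)%:R * newton j F x + (i == j)%:R * newton k F x)).

Lemma sym_potential i j k F : sch F -> sym 1 (potential i j k F).
Proof.
move=> sF; apply: symZ; apply: symD; last first.
  by apply: symD; apply: symZ; exact: sym_newton.
apply: symB.
  by apply: sym_coordM; rewrite -pd_newton//; apply: sym_pd; exact: sym_newton.
apply: sym_newton; apply: sch_pd; exact: sch_coordM.
Qed.

Lemma lap_potential i j k F : sch F ->
  lap (potential i j k F) = pd i (newton j (pd k F)).
Proof.
move=> sF; have sk := sch_pd k sF; have si := sch_coordM i sF.
have nk := sm_newton j sk.
have nik := sm_newton j (sch_pd k si).
have n1 := sm_newton j sF; have n2 := sm_newton k sF.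
rewrite /potential.
rewrite lapZ; last by apply: smD; [apply: smB => //; exact: sm_coordM|apply: smD; exact: smZ].
rewrite lapD; [|by apply: smB => //; exact: sm_coordM|by apply: smD; exact: smZ].
rewrite lapB//; last exact: sm_coordM.
rewrite lapD; [|exact: smZ|exact: smZ].
rewrite !lapZ// lap_coordM// !lap_newton//; last exact: sch_pd.
rewrite pd_coordM; last exact: sch_der.
rewrite sm_pdD; [|exact/sm_coordM/sch_sm|exact/smZ/sch_sm].
rewrite pd_coordM; last exact: sch_der.
rewrite sm_pdZ; last exact: sch_sm.
apply/funext => x; rewrite (eq_sym k i) (eq_sym j i); lra.
Qed.

Lemma bilap_potential i j k F : sch F ->
  lap (lap (potential i j k F)) = pd i (pd j (pd k F)).
Proof.
move=> sF; rewrite lap_potential// -pd_lap; last exact/sm_newton/sch_pd.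
by rewrite lap_newton//; exact: sch_pd.
Qed.

End Potential.

(** * Integrals over lines *)

Section FullLine.
Variable R : realType.
Local Notation mu := (@lebesgue_measure R).
Local Notation Rp := (`[0, +oo[%classic : set R).

Lemma ge0_integral_line (k : R -> R) : (forall s, 0 <= k s) -> continuous k ->
  (\int[mu]_s (k s)%:E =
   \int[mu]_(s in Rp) (k s)%:E + \int[mu]_(s in Rp) (k (- s))%:E)%E.
Proof.
move=> k0 ck; have mk : measurable_fun setT k by exact: continuous_measurable_fun.
have mRp : measurable (Rp : set (measurableTypeR R)) by [].
have E := @ge0_integral_setU _ _ _ mu Rp (~` Rp) mRp (measurableC mRp) (EFin \o k).
rewrite -(setUv Rp) [LHS]E; last 3 first.
- by rewrite setUv; exact/measurable_EFinP.
- by move=> x _; rewrite lee_fin.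
- exact/disj_setPCl.
congr (_ + _)%E; rewrite setCitvr.
rewrite integral_itv_bndo_bndc; last by apply/measurable_EFinP/measurable_funTS.
rewrite -{1}oppr0 ge0_integration_by_substitutionNy//.
exact: continuous_subspaceT.
Qed.

Lemma continuous_opp_comp (f : R -> R) : continuous f -> continuous (fun s => f (- s)).
Proof.
move=> cf s; apply: (@continuous_comp _ _ _ (fun s : R => - s) f); last exact: cf.
by apply: cvgN; exact: cvg_id.
Qed.

Lemma integrable_bellT :
  mu.-integrable setT (EFin \o (fun s => (1 + (s - 0) ^+ 2)^-1)).
Proof.
apply/integrableP; split; first exact: measurable_bell.
under eq_integral do rewrite /= ger0_norm ?bell_ge0//.
rewrite ge0_integral_line; [|exact: bell_ge0|exact: continuous_bell].
under [X in (_ + X)%E]eq_integral do rewrite -sqrrN opprB add0r opprK -[X in X ^+ 2]subr0.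
by rewrite integral_bell ltry.
Qed.

Section Split.
Variables (g : R -> R) (C : R).
Hypothesis cg : continuous g.
Hypothesis gC : forall s, `|g s| <= C / (1 + s ^+ 2).

Lemma integrable_dominated (D : set R) : measurable D ->
  mu.-integrable D (EFin \o g).
Proof.
move=> mD; apply: (integrableS measurableT) => //.
apply: (@le_integrable _ _ _ mu setT _ _ (EFin \o (fun s => C * (1 + (s - 0) ^+ 2)^-1))) => //.
- by apply/measurable_EFinP; exact: continuous_measurable_fun.
- move=> s _ /=; rewrite subr0 lee_fin (le_trans (gC s))// ler_norm//.
- by apply: integrable_scale => //; exact: integrable_bellT.
Qed.

End Split.

Lemma Rintegral_line (g : R -> R) (C : R) :
  continuous g -> (forall s, `|g s| <= C / (1 + s ^+ 2)) ->
  \int[mu]_s g s = \int[mu]_(s in Rp) g s + \int[mu]_(s in Rp) g (- s).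
Proof.
move=> cg gC.
pose b (s : R) := C * (1 + (s - 0) ^+ 2)^-1.
have bC s : b s = C / (1 + s ^+ 2) by rewrite /b subr0.
have C0 : 0 <= C by have := gC 0; rewrite expr0n addr0 divr1; apply: le_trans.
have cb : continuous b by apply: continuous_scale; exact: continuous_bell.
have b0 s : 0 <= b s by rewrite mulr_ge0// bell_ge0.
have nb s : `|b s| <= C / (1 + s ^+ 2) by rewrite ger0_norm// bC.
have ig := integrable_dominated cg gC; have ib := integrable_dominated cb nb.
have gNC s : `|g (- s)| <= C / (1 + s ^+ 2) by have := gC (- s); rewrite sqrrN.
have bNC s : `|b (- s)| <= C / (1 + s ^+ 2) by have := nb (- s); rewrite sqrrN.
have igN := integrable_dominated (continuous_opp_comp cg) gNC.
have ibN := integrable_dominated (continuous_opp_comp cb) bNC.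
have S (k : R -> R) : (forall s, 0 <= k s) -> continuous k -> mu.-integrable Rp (EFin \o k) ->
    mu.-integrable Rp (EFin \o (fun s => k (- s))) ->
    \int[mu]_s k s = \int[mu]_(s in Rp) k s + \int[mu]_(s in Rp) k (- s).
  move=> k0 ck ik ikN; rewrite /Rintegral ge0_integral_line// fineD//.
    exact: integrable_fin_num ik.
  exact: integrable_fin_num ikN.
have Sgb : \int[mu]_s (g s + b s) = \int[mu]_(s in Rp) (g s + b s) +
    \int[mu]_(s in Rp) (g (- s) + b (- s)).
  apply: S.
  - by move=> s; have := gC s; rewrite -bC ler_norml => /andP[]; lra.
  - by move=> s; exact: cvgD (cg s) (cb s).
  - by apply: integrable_add => //; [exact: ig|exact: ib].
  - by apply: integrable_add => //; [exact: igN|exact: ibN].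
have Sb : \int[mu]_s b s = \int[mu]_(s in Rp) b s + \int[mu]_(s in Rp) b (- s).
  by apply: S => //; [exact: ib|exact: ibN].
have E0 : \int[mu]_s (g s + b s) = \int[mu]_s g s + \int[mu]_s b s.
  by rewrite RintegralD//; [exact: ig|exact: ib].
have E1 : \int[mu]_(s in Rp) (g s + b s) = \int[mu]_(s in Rp) g s + \int[mu]_(s in Rp) b s.
  by rewrite RintegralD//; [exact: ig|exact: ib].
have E2 : \int[mu]_(s in Rp) (g (- s) + b (- s)) =
    \int[mu]_(s in Rp) g (- s) + \int[mu]_(s in Rp) b (- s).
  by rewrite RintegralD//; [exact: igN|exact: ibN].
move: Sgb; rewrite E0 E1 E2 addrACA -Sb; exact: addIr.
Qed.

End FullLine.

Section Lines.
Variable R : realType.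
Local Notation mu := (@lebesgue_measure R).
Local Notation Rp := (`[0, +oo[%classic : set R).
Implicit Types (F G f g u : R * R -> R) (x e : R * R) (i j k : 'I_2).

Lemma evec_unit i : (evec R i).1 ^+ 2 + (evec R i).2 ^+ 2 = 1.
Proof. by elim/ord2P: i; rewrite /evec/= expr0n expr1n ?addr0 ?add0r. Qed.

Lemma oppevec_unit i : (- evec R i).1 ^+ 2 + (- evec R i).2 ^+ 2 = 1.
Proof. by rewrite -[RHS](evec_unit i) /= !sqrrN. Qed.

Lemma dirder_evec i F : dirder (evec R i) F = pd i F.
Proof.
by apply/funext => x; elim/ord2P: i; rewrite /dirder /evec/= mul1r mul0r ?addr0 ?add0r.
Qed.

Lemma dirder_oppevec i F : dirder (- evec R i) F = fun x => -1 * pd i F x.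
Proof.
apply/funext => x; elim/ord2P: i; rewrite /dirder /evec/= oppr0 mul0r ?addr0 ?add0r//.
Qed.

Lemma ray_pd i F x : sch F -> ray (evec R i) (pd i F) x = - F x.
Proof.
by move=> sF; rewrite -dirder_evec ray_FTC//; exact: evec_unit.
Qed.

Lemma ray_oppevec_pd i F x : sch F -> ray (- evec R i) (pd i F) x = F x.
Proof.
move=> sF; apply: oppr_inj; rewrite -(ray_FTC (oppevec_unit i) x sF) dirder_oppevec.
by rewrite rayZ ?mulN1r//; [exact: oppevec_unit|exact: sch_pd].
Qed.

(** A ray pointing away from the origin only meets points that are at least as far
    from the origin as its source. *)
Lemma ray_bound F N : sch F -> exists C : R, forall e x,
  e.1 ^+ 2 + e.2 ^+ 2 = 1 -> 0 <= x.1 * e.1 + x.2 * e.2 ->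
  bracket2 x ^+ N * `|ray e F x| <= C.
Proof.
move=> sF; have [C HC] := sch_rapid sF N.+1.
have C0 : 0 <= C.
  by have := HC 0; apply: le_trans; rewrite mulr_ge0// exprn_ge0// bracket2_ge0.
exists (C * pi) => e x e1 xe.
have b0 := bracket2_gt0 x; have bN : 0 < bracket2 x ^+ N by rewrite exprn_gt0.
rewrite mulrC -ler_pdivlMr//.
have far s : 0 <= s -> bracket2 (x + s *: e) = bracket2 x + 2 * s * (x.1 * e.1 + x.2 * e.2) + s ^+ 2.
  move=> s0; have E : s ^+ 2 * (e.1 ^+ 2 + e.2 ^+ 2) = s ^+ 2 by rewrite e1 mulr1.
  rewrite -E /bracket2.
  rewrite -[x + s *: e]/(x.1 + s * e.1, x.2 + s * e.2) /=; ring.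
have bound s : 0 <= s -> `|1 * F (x + s *: e)| <= C / bracket2 x ^+ N * (1 + (s - 0) ^+ 2)^-1.
  move=> s0; rewrite mul1r subr0 ler_pdivlMr; last by rewrite ltr_pwDl// sqr_ge0.
  rewrite ler_pdivlMr// mulrC (le_trans _ (HC (x + s *: e)))//.
  rewrite mulrCA [leRHS]mulrC; apply: ler_wpM2l => //.
  have xes : 0 <= 2 * s * (x.1 * e.1 + x.2 * e.2) by rewrite !mulr_ge0.
  rewrite [leRHS]exprSr; apply: ler_pM.
  - by rewrite exprn_ge0// ltW.
  - by rewrite addr_ge0// sqr_ge0.
  - apply: lerXn2r; rewrite ?nnegrE ?bracket2_ge0// far//.
    by rewrite -addrA lerDl addr_ge0// sqr_ge0.
  - by rewrite far// lerD2r (le_trans (bracket2_ge1 x))// lerDl.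
rewrite mulrAC [leRHS]mulrC; apply: (@le_trans _ _ (\int[mu]_(s in Rp)
    (C / bracket2 x ^+ N * (1 + (s - 0) ^+ 2)^-1))).
  apply: superpose_le => //.
  - exact: measurable_line.
  - exact: integrable_ray_weight.
  - exact/sm_continuous/sch_sm.
  - exact: sch_rapid.
  - by apply: integrable_scale => //; exact: integrable_bell.
  - by move=> s; rewrite /= in_itv/= andbT; exact: bound.
rewrite RintegralZl//; last exact: integrable_bell.
rewrite [leRHS]mulrC; apply: ler_wpM2l; first by rewrite divr_ge0// ltW.
exact: Rintegral_bell_le.
Qed.
End Lines.

(** * Schwartz antiderivatives *)

Section Antiderivatives.
Variable R : realType.
Local Notation mu := (@lebesgue_measure R).
Local Notation Rp := (`[0, +oo[%classic : set R).
Implicit Types (F G f g u : R * R -> R) (x e : R * R) (i j k : 'I_2).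

Definition line i F x : R := ray (evec R i) F x + ray (- evec R i) F x.

(** The antiderivative in the [i]-th direction that vanishes at [+oo]. *)
Definition prim i F x : R := -1 * ray (evec R i) F x.

Lemma sm_line i F : sch F -> sm (line i F).
Proof.
by move=> sF; apply: smD; apply: sm_ray => //; [exact: evec_unit|exact: oppevec_unit].
Qed.

Lemma pd_line i k F : sch F -> pd k (line i F) = line i (pd k F).
Proof.
move=> sF; have u := evec_unit R i; have uN := oppevec_unit R i.
by rewrite /line sm_pdD; [rewrite !pd_ray|exact: sm_ray|exact: sm_ray].
Qed.

Lemma pd_line_same i F : sch F -> pd i (line i F) = fun=> 0.
Proof.
move=> sF; rewrite pd_line//; apply/funext => x.
by rewrite /line ray_pd// ray_oppevec_pd// addNr.
Qed.

Lemma line_shift i F x (s : R) : sch F -> line i F (x + s *: evec R i) = line i F x.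
Proof.
move=> sF; have := MVT_line x s (fun y => @sm_derivable _ _ (sm_line i sF) i y).
move=> [t _ E]; apply/eqP; rewrite -subr_eq0 E -pd_derive pd_line_same//.
by rewrite mulr0.
Qed.

Lemma line0_snd F x : sch F -> line 0 F x = line 0 F (0, x.2).
Proof.
move=> sF; rewrite -[RHS](line_shift 0 (0, x.2) x.1 sF); congr (line 0 F _).
by case: x => a b; congr pair; rewrite /= ?scaler0 ?addr0// add0r [_%:A]mulr1.
Qed.

Lemma line1_fst F x : sch F -> line 1 F x = line 1 F (x.1, 0).
Proof.
move=> sF; rewrite -[RHS](line_shift 1 (x.1, 0) x.2 sF); congr (line 1 F _).
by case: x => a b; congr pair; rewrite /= ?scaler0 ?addr0// add0r [_%:A]mulr1.
Qed.

Lemma lineD i F G x : sch F -> sch G ->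
  line i (fun y => F y + G y) x = line i F x + line i G x.
Proof.
move=> sF sG; rewrite /line !rayD//; try exact: evec_unit; try exact: oppevec_unit.
exact: addrACA.
Qed.

Lemma lineZ i c F x : sch F -> line i (fun y => c * F y) x = c * line i F x.
Proof.
move=> sF; rewrite /line !rayZ//; try exact: evec_unit; try exact: oppevec_unit.
by rewrite mulrDr.
Qed.

Lemma pd_prim i F : sch F -> pd i (prim i F) = F.
Proof.
move=> sF; have u := evec_unit R i.
rewrite /prim sm_pdZ; last exact: sm_ray.
by rewrite pd_ray//; apply/funext => x; rewrite ray_pd// mulN1r opprK.
Qed.

(** When all line integrals vanish, the antiderivative can be computed from either
    end of the line; choosing the end on the side of [x] shows its rapid decay. *)
Lemma sch_prim i F : sch F -> (forall x, line i F x = 0) -> sch (prim i F).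
Proof.
move=> sF F0.
apply: (@sch_ind_pd _ (fun u => exists G, [/\ sch G, forall x, line i G x = 0 & u = prim i G])).
- move=> u [G [sG _ ->]]; apply: continuousZf; apply: sm_continuous.
  by apply: sm_ray => //; exact: evec_unit.
- move=> u [G [sG _ ->]]; apply: derivable_everywhereZ; apply: sm_derivable.
  by apply: sm_ray => //; exact: evec_unit.
- move=> u [G [sG G0 ->]] N; have [C HC] := ray_bound N sG; exists C => x.
  rewrite /prim mulN1r normrN.
  have [x0|x0] := leP 0 (coordinate i x).
    apply: HC; first exact: evec_unit.
    by elim/ord2P: i x0 {sG G0 F0 sF} => /=; rewrite /coordinate/evec/= mulr1 mulr0 ?addr0 ?add0r.
  have /eqP := G0 x; rewrite addr_eq0 => /eqP ->; rewrite normrN.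
  apply: HC; first exact: oppevec_unit.
  elim/ord2P: i x0 {sG G0 F0 sF} => /=; rewrite /coordinate/evec/= oppr0 mulrN mulr1 mulr0 ?addr0 ?add0r oppr_ge0;
    exact: ltW.
- move=> u k [G [sG G0 ->]]; exists (pd k G); split.
  + exact: sch_pd.
  + move=> x; rewrite -pd_line//.
    have -> : line i G = fun x => 0 * line i G x by apply/funext => y; rewrite G0 mulr0.
    by rewrite sm_pdZ ?mul0r//; exact: sm_line.
  + rewrite /prim sm_pdZ; last by apply: sm_ray => //; exact: evec_unit.
    by rewrite pd_ray//; exact: evec_unit.
- by exists F.
Qed.

Definition slice (c : R) f x : R := f (x.1, c).

Lemma is_derive_slice c f i x : sm f ->
  is_derive x (evec R i) (slice c f) ((i == 0)%:R * slice c (pd 0 f) x).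
Proof.
move=> sf.
have E (h : R) : slice c f (h *: evec R i + x) = f (h *: ((i == 0)%:R *: evec R 0) + (x.1, c)).
  rewrite /slice; congr f; elim/ord2P: i.
    by congr pair => /=; rewrite /evec/= scale1r// scaler0 add0r.
  by congr pair => /=; rewrite /evec/= ?scale0r ?scaler0 ?add0r//= scaler0 add0r.
have D : is_derive (x.1, c) ((i == 0)%:R *: evec R 0) f ((i == 0)%:R * pd 0 f (x.1, c)).
  have [fd fE] := C1_differential (sm_C1 sf) (x.1, c).
  split; first exact: diff_derivable.
  rewrite deriveE// fE /lin_form; case: (i == 0); rewrite /evec/= ?scale1r ?scale0r/=.
    by rewrite mul0r addr0.
  by rewrite !mul0r addr0.
move: D => [D DE]; split.
  have EE : (fun h : R => slice c f (h *: evec R i + x)) =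
      fun h => f (h *: ((i == 0)%:R *: evec R 0) + (x.1, c)) by exact/funext.
  move: D => /derivable1P D; apply/derivable1P; rewrite EE; exact D.
rewrite -[slice c (pd 0 f) x]/(pd 0 f (x.1, c)) -DE /derive.
by under eq_fun do rewrite /= E.
Qed.

Lemma derivable_slice c f : sm f -> derivable_everywhere (slice c f).
Proof. by move=> sf i x; case: (is_derive_slice c i x sf). Qed.

Lemma pd_slice c f i : sm f -> pd i (slice c f) = fun x => (i == 0)%:R * slice c (pd 0 f) x.
Proof.
by move=> sf; apply/funext => x; rewrite pd_derive; case: (is_derive_slice c i x sf).
Qed.

Lemma continuous_slice c f : sm f -> continuous (slice c f).
Proof.
move=> sf; apply: (@continuous_comp_fst R (fun t => f (t, c))).
by apply: continuous_slice_l; exact: sm_continuous.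
Qed.

Section Cross.
Variable c : R.

(** The product of the horizontal profile of [f] at height [c] with the function of
    the height alone given by the horizontal integrals of [g]. *)
Definition cross f g x : R := slice c f x * line 0 g x.

(** Multiples of such products are preserved by derivation, [pd 0] acting on the
    profile and [pd 1] under the integral. *)
Lemma sch_cross f g : sch f -> sch g -> sch (cross f g).
Proof.
move=> sf sg.
apply: (@sch_ind_pd _ (fun u => exists a f g, [/\ sch f, sch g & u = fun x => a * cross f g x])).
- move=> u [a [p [q [sp sq ->]]]]; apply: continuousZf; apply: continuousMf.
    exact/continuous_slice/sch_sm.
  exact/sm_continuous/sm_line.
- move=> u [a [p [q [sp sq ->]]]]; apply: derivable_everywhereZ.
  apply: derivable_everywhereM; first exact/derivable_slice/sch_sm.
  exact/sm_derivable/sm_line.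
- move=> u [a [p [q [sp sq ->]]]]; apply: rapidZ => N.
  have [C HC] := sch_rapid sp N; have [D HD] := ray_bound N sq.
  exists (C * (D + D)) => x.
  have H1 : (1 + x.1 ^+ 2) ^+ N * `|slice c p x| <= C.
    rewrite (le_trans _ (HC (x.1, c)))// ler_wpM2r//.
    apply: lerXn2r; rewrite ?nnegrE ?bracket2_ge0// ?addr_ge0 ?sqr_ge0//.
    by rewrite /bracket2/= lerDl sqr_ge0.
  have H2 : (1 + x.2 ^+ 2) ^+ N * `|line 0 q x| <= D + D.
    rewrite line0_snd// /line (le_trans (ler_wpM2l _ (ler_normD _ _)))//.
      by rewrite exprn_ge0// addr_ge0// sqr_ge0.
    have bE : 1 + x.2 ^+ 2 = bracket2 (0, x.2) by rewrite /bracket2/= expr0n addr0.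
    rewrite mulrDr bE; apply: lerD; apply: HD.
    + exact: evec_unit.
    + by rewrite /evec/= mul0r mulr0 addr0.
    + exact: oppevec_unit.
    + by rewrite /evec/= mul0r oppr0 mulr0 addr0.
  rewrite /cross normrM.
  have B : bracket2 x ^+ N <= (1 + x.1 ^+ 2) ^+ N * (1 + x.2 ^+ 2) ^+ N.
    rewrite -exprMn; apply: lerXn2r; rewrite ?nnegrE ?bracket2_ge0//.
      by rewrite mulr_ge0// addr_ge0// sqr_ge0.
    rewrite /bracket2; have := mulr_ge0 (sqr_ge0 x.1) (sqr_ge0 x.2); lra.
  rewrite (le_trans (ler_wpM2r _ B))// ?mulr_ge0// mulrACA.
  by apply: ler_pM => //; rewrite mulr_ge0// exprn_ge0// addr_ge0// sqr_ge0.
- move=> u i [a [p [q [sp sq ->]]]].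
  rewrite pdZ; last first.
    apply: derivable_everywhereM; first exact/derivable_slice/sch_sm.
    exact/sm_derivable/sm_line.
  rewrite pdM; [|exact/derivable_slice/sch_sm|exact/sm_derivable/sm_line].
  rewrite pd_slice; last exact: sch_sm.
  elim/ord2P: i.
    exists a, (pd 0 p), q; split => //; first exact: sch_pd.
    by rewrite pd_line_same//; apply/funext => x; rewrite mulr0 add0r mul1r.
  exists a, p, (pd 1 q); split => //; first exact: sch_pd.
  by rewrite pd_line//; apply/funext => x; rewrite mul0r mul0r addr0.
- by exists 1, f, g; split => //; apply/funext => x; rewrite mul1r.
Qed.

Lemma line0_cross f g x : sch f -> sch g ->
  line 0 (cross f g) x = line 0 g x * line 0 f (x.1, c).
Proof.
move=> sf sg.
have H (a : R) : a ^+ 2 = 1 -> ray (a *: evec R 0) (cross f g) x =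
    line 0 g x * ray (a *: evec R 0) f (x.1, c).
  move=> a1; rewrite !rayE -RintegralZl//; last first.
    by apply: integrable_ray => //; rewrite /evec/= scaler0 [a%:A]mulr1 expr0n addr0.
  apply: eq_Rintegral => s _; rewrite /cross scalerA line_shift// mulrC; congr (_ * f _).
  by rewrite /evec; congr pair; rewrite /= ?scaler0 ?addr0.
have := H 1 (expr1n _ _); have := H (-1) (sqrr_sign R 1).
by rewrite /line scaleN1r scale1r mulrDr => -> ->.
Qed.

End Cross.

Lemma continuous_line0 f : sch f -> continuous (fun s : R => line 0 f (0, s)).
Proof. by move=> sf; apply: continuous_slice_r; apply: sm_continuous; exact: sm_line. Qed.

Lemma line0_bound f : sch f -> exists C : R, forall s : R,
  `|line 0 f (0, s)| <= C / (1 + s ^+ 2).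
Proof.
move=> sf; have [C HC] := ray_bound 1 sf; exists (C + C) => s.
have bE : 1 + s ^+ 2 = bracket2 (0, s) ^+ 1 by rewrite expr1 /bracket2/= expr0n addr0.
have b0 : 0 < 1 + s ^+ 2 by rewrite ltr_pwDl// sqr_ge0.
rewrite ler_pdivlMr// mulrC (le_trans (ler_wpM2l (ltW b0) (ler_normD _ _)))//.
rewrite mulrDr bE; apply: lerD; apply: HC.
+ exact: evec_unit.
+ by rewrite /evec/= mul0r mulr0 addr0.
+ exact: oppevec_unit.
+ by rewrite /evec/= mul0r oppr0 mulr0 addr0.
Qed.

Lemma line0E f s : sch f -> line 0 f (0, s) = \int[mu]_t f (t, s).
Proof.
move=> sf; have [C C0 HC] := sch_ray_bound (evec_unit R 0) (0, s) sf.
rewrite (@Rintegral_line _ (fun t => f (t, s)) C).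
- rewrite /line !rayE; congr (_ + _); apply: eq_Rintegral => t _; congr f;
    by rewrite /evec; congr pair; rewrite /= ?oppr0 ?scaler0 ?addr0 ?add0r// ?[t%:A]mulr1// scalerN [t%:A]mulr1.
- by apply: continuous_slice_l; exact/sm_continuous/sch_sm.
- move=> t; have := HC t; congr (`|f _| <= _).
  by rewrite /evec; congr pair; rewrite /= ?scaler0 ?addr0 ?add0r// [t%:A]mulr1.
Qed.

End Antiderivatives.

(** * Schwartz functions of mean zero are divergences *)

Section MeanZero.
Variable R : realType.
Local Notation mu := (@lebesgue_measure R).
Local Notation Rp := (`[0, +oo[%classic : set R).
Local Notation mu2 := (mu \x mu)%E.
Implicit Types (F G f g u : R * R -> R) (x e : R * R) (i j k : 'I_2).

Lemma sch_product_bound f : sch f -> exists C : R, forall x : R * R,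
  `|f x| <= C * (1 + (x.1 - 0) ^+ 2)^-1 * (1 + (x.2 - 0) ^+ 2)^-1.
Proof.
move=> sf; have [C HC] := sch_rapid sf 2; exists C => x; rewrite !subr0.
have p (a : R) : 0 < 1 + a ^+ 2 by rewrite ltr_pwDl// sqr_ge0.
rewrite !ler_pdivlMr// (le_trans _ (HC x))// -mulrA mulrC; apply: ler_wpM2r => //.
have := mulr_ge0 (sqr_ge0 x.1) (sqr_ge0 x.2).
have := sqr_ge0 (x.1 ^+ 2); have := sqr_ge0 (x.2 ^+ 2).
have := sqr_ge0 x.1; have := sqr_ge0 x.2.
rewrite /bracket2; move: (x.1) (x.2) => a b; nra.
Qed.

Lemma integrable_sch_plane f : sch f ->
  mu2.-integrable (setT `*` setT) (EFin \o f).
Proof.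
move=> sf; have [C HC] := sch_product_bound sf.
have C0 : 0 <= C by have := HC 0; rewrite subr0 expr0n/= addr0 invr1 !mulr1; apply: le_trans.
apply: (@integrable_rectangle _ _ _ _ _ mu mu setT setT _ _ f
  (fun s => C * (1 + (s - 0) ^+ 2)^-1) (fun s => (1 + (s - 0) ^+ 2)^-1)) => //.
- by apply: continuous_measurable_plane; exact/sm_continuous/sch_sm.
- by apply: integrable_scale => //; exact: integrable_bellT.
- exact: integrable_bellT.
- by move=> x _; rewrite mulr_ge0// bell_ge0.
- by move=> x _; exact: bell_ge0.
Qed.

Lemma integrable_slice f s : sch f -> mu.-integrable setT (EFin \o (fun t => f (t, s))).
Proof.
move=> sf; have [C C0 HC] := sch_ray_bound (evec_unit R 0) (0, s) sf.
apply: (@integrable_dominated _ (fun t => f (t, s)) C) => //.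
- by apply: continuous_slice_l; exact/sm_continuous/sch_sm.
- move=> t; have := HC t; congr (`|f _| <= _).
  by rewrite /evec; congr pair; rewrite /= ?scaler0 ?addr0 ?add0r// [t%:A]mulr1.
Qed.

Lemma mean_zero_line f : sch f -> (\int[mu2]_x (f x)%:E = 0)%E ->
  \int[mu]_s line 0 f (0, s) = 0.
Proof.
move=> sf f0.
have E : \int[mu2]_(z in setT `*` setT) f z = 0 by rewrite /Rintegral setXTT f0.
rewrite Fubini_rectangle_rl// in E; last 2 first.
- exact: integrable_sch_plane.
- by move=> y _; exact: integrable_slice.
by rewrite -[RHS]E; apply: eq_Rintegral => s _; rewrite line0E.
Qed.

Lemma line1_cross c f g x : sch f -> sch g -> \int[mu]_s line 0 g (0, s) = 0 ->
  line 1 (cross c f g) x = 0.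
Proof.
move=> sf sg g0; have sfg := sch_cross c sf sg.
have [C HC] := line0_bound sg; have cg := continuous_line0 sg.
rewrite line1_fst// /line !rayE.
have E s : cross c f g ((x.1, 0) + s *: evec R 1) = f (x.1, c) * line 0 g (0, s).
  rewrite /cross /slice line0_snd//; congr (f _ * line 0 g _).
    by congr pair; rewrite /evec/= scaler0 addr0.
  by congr pair; rewrite /evec/= add0r [s%:A]mulr1.
have EN s : cross c f g ((x.1, 0) + s *: - evec R 1) = f (x.1, c) * line 0 g (0, - s).
  by rewrite -E scalerN scaleNr.
under eq_Rintegral do rewrite E; under [X in _ + X]eq_Rintegral do rewrite EN.
rewrite !RintegralZl//.
- by rewrite -mulrDr -(Rintegral_line cg HC) g0 mulr0.
- apply: (@integrable_dominated _ (fun s => line 0 g (0, - s)) C) => //.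
    exact: (continuous_opp_comp cg).
  by move=> s; have := HC (- s); rewrite sqrrN.
- exact: (integrable_dominated cg HC).
Qed.

(** Subtract from [f] the product, with the same integrals over horizontal lines, of
    a horizontal profile and a function of the height: the difference has a Schwartz
    antiderivative along these lines. The height factor [line 0 f] has mean zero, so
    the product has one along vertical lines. A slice of [f] whose integral is not
    zero serves as profile; if there is none, [f] itself has horizontal integrals
    equal to zero. *)
Lemma mean_zero_divergence f : sch f -> (\int[mu2]_x (f x)%:E = 0)%E ->
  exists F : 'I_2 -> R * R -> R, (forall k, sch (F k)) /\
    f = fun x => pd 0 (F 0) x + pd 1 (F 1) x.
Proof.
move=> sf /(mean_zero_line sf) f0.
have [[c hc]|h0] := pselect (exists c : R, line 0 f (0, c) != 0).
  pose a := (line 0 f (0, c))^-1.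
  have sp : sch (fun x => a * cross c f f x) by exact/schZ/sch_cross.
  have sq : sch (fun x => f x + -1 * (a * cross c f f x)) by apply: schD => //; exact: schZ.
  have q0 x : line 0 (fun x => f x + -1 * (a * cross c f f x)) x = 0.
    rewrite lineD//; last exact: schZ.
    rewrite lineZ// lineZ; last exact: sch_cross.
    rewrite line0_cross// (line0_snd (x.1, c))//= (mulrCA a) /a mulVf// mulr1 mulN1r.
    exact: subrr.
  have p0 x : line 1 (fun x => a * cross c f f x) x = 0.
    by rewrite lineZ ?line1_cross ?mulr0//; exact: sch_cross.
  exists (fun k => if k == 0 then prim 0 (fun x => f x + -1 * (a * cross c f f x))
                   else prim 1 (fun x => a * cross c f f x)).
  split=> [k|]; first by case: ifP => _; exact: sch_prim.
  by rewrite !pd_prim//; apply/funext => x; rewrite mulN1r subrK.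
have {}h0 x : line 0 f x = 0.
  rewrite line0_snd//; apply/eqP; apply: contra_notT h0 => h0; exists x.2 => //.
exists (fun k => if k == 0 then prim 0 f else (fun x => 0 * f x)).
split=> [k|]; first by case: ifP => _; [exact: sch_prim|exact: schZ].
rewrite /= pd_prim// pdZ; last exact: sch_der.
by apply/funext => x; rewrite mul0r addr0.
Qed.

End MeanZero.

(** * Maximum principle *)

Section Liouville.
Variable R : realType.
Implicit Types (u w : R * R -> R) (x c : R * R) (i j : 'I_2).

Lemma local_max_second_derivative (h h' h'' : R -> R) (d : R) : 0 < d ->
  (forall t : R, is_derive t 1 h (h' t)) -> (forall t : R, is_derive t 1 h' (h'' t)) ->
  {for 0, continuous h''} -> (forall t, `|t| < d -> h t <= h 0) -> h'' 0 <= 0.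
Proof.
move=> d0 D1 D2 c2 hmax; rewrite leNgt; apply/negP => pos.
have h'0 : h' 0 = 0.
  have Nd0 : - d <= d by lra.
  have H := @derive1_at_max _ h (- d) d 0 Nd0 (fun t _ => @ex_derive _ _ _ _ _ _ _ (D1 t)).
  have [|t|_] := H; first by rewrite in_itv/= oppr_lt0 d0.
    by rewrite in_itv/= => td; apply: hmax; rewrite ltr_norml.
  by case: (D1 0) => _ -> ->.
have /cvgrPdist_lt/(_ _ pos)/nbhs_ballP[r /= r0 Hr] := c2.
have hpos t : `|t| < r -> 0 < h'' t.
  move=> tr; have := Hr t; rewrite -ball_normE /ball_/= sub0r normrN => /(_ tr).
  by rewrite ltr_norml => /andP[]; lra.
pose t := Num.min r d / 2.
have m0 : 0 < Num.min r d by rewrite lt_min r0.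
have t0 : 0 < t by rewrite divr_gt0.
have : t < Num.min r d by rewrite /t; lra.
rewrite lt_min => /andP[tr td].
have C (f f' : R -> R) (a b : R) : (forall t : R, is_derive t 1 f (f' t)) -> {within `[a, b], continuous f}.
  by move=> D; apply: derivable_within_continuous => s _; case: (D s).
have [s + E] := MVT t0 (fun s _ => D1 s) (C h h' 0 t D1).
rewrite in_itv/= => /andP[s0 st].
have [s' + E'] := MVT s0 (fun s _ => D2 s) (C h' h'' 0 s D2).
rewrite in_itv/= => /andP[s'0 s's].
have := hmax t; rewrite gtr0_norm// => /(_ td).
rewrite -subr_le0 E subr0 pmulr_lle0// leNgt => /negP; apply.
rewrite h'0 !subr0 in E'; rewrite E' mulr_gt0//.
by apply: hpos; rewrite gtr0_norm// (lt_trans s's)// (lt_trans st).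
Qed.

Lemma sm_cst (a : R) : sm (fun _ : R * R => a).
Proof.
have D b : derivable_everywhere (fun _ : R * R => b : R).
  by move=> i x; exact: derivable_cst.
apply: (@sm_ind_pd _ (fun u => exists b, u = fun=> b)) => [u [b ->]|u [b ->]|u i [b ->]|].
- by move=> x; exact: cvg_cst.
- exact: D.
- by exists 0; apply/funext => x; rewrite pd_derive derive_cst.
- by exists a.
Qed.

Lemma pd_cst (a : R) i : pd i (fun _ : R * R => a) = fun=> 0.
Proof. by apply/funext => x; rewrite pd_derive derive_cst. Qed.

Lemma lap_sqr_coordinate j :
  lap (fun x => coordinate j x * (coordinate j x * 1)) = fun=> 2 :> R.
Proof.
have s1 := sm_cst 1; have sj := sm_coordM j s1.
rewrite lap_coordM// lap_coordM// pd_coordM; last exact: sm_derivable.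
apply/funext => x; rewrite /lap !pd_cst eqxx /=; ring.
Qed.

(** Maximum principle: a positive maximum of [u] would be attained inside a large
    square, and adding a small multiple of [|x|^2] keeps it there while making the
    Laplacian positive. *)
Lemma harmonic_le0 u : sm u -> (forall x, lap u x = 0) ->
  u @ @at_infinity R --> (0 : R) -> forall x, u x <= 0.
Proof.
move=> su lu u0 x0; rewrite leNgt; apply/negP => ux0.
pose m := u x0 / 2; have m0 : 0 < m by rewrite divr_gt0.
have [M HM] : exists M : R, forall x, M < abs2 x -> `|u x| < m.
  have /cvgrPdist_lt/(_ _ m0)[M HM] := u0; exists M => x /HM /=.
  by rewrite sub0r normrN.
pose L := Num.max M (abs2 x0) + 1.
have ML : M < L by rewrite /L ltr_pwDr// le_max lexx.
have xL : abs2 x0 < L by rewrite /L ltr_pwDr// le_max lexx orbT.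
have L0 : 0 < L by exact: le_lt_trans (abs2_ge0 x0) xL.
(* So that [e * |x|^2 <= m / 2] on the square, where [|x|^2 <= 2 * L ^+ 2]. *)
pose e := m / (4 * L ^+ 2).
have L2 : 0 < 4 * L ^+ 2 by rewrite mulr_gt0// exprn_gt0.
have e0 : 0 < e by rewrite divr_gt0.
have eE : e * (4 * L ^+ 2) = m by rewrite divfK// gt_eqF.
pose q x : R := coordinate 0 x * (coordinate 0 x * 1) + coordinate 1 x * (coordinate 1 x * 1).
have sq j : sm (fun x => coordinate j x * (coordinate j x * 1)).
  by do 2!apply: sm_coordM; exact: sm_cst.
have sqq : sm q by apply: smD.
pose w x := u x + e * q x.
have sw : sm w by apply: smD => //; exact: smZ.
have lw x : lap w x = 4 * e.
  rewrite lapD//; last exact: smZ.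
  by rewrite lapZ// lapD// !lap_sqr_coordinate lu; ring.
pose K : set (R * R) := `[- L, L] `*` `[- L, L].
have cK : compact K by apply: compact_setX; exact: segment_compact.
have Kx0 : K x0.
  have H i : `|coordinate i x0| <= L.
    by rewrite (le_trans (coordinate_le_abs2 i x0))// ltW.
  by split; rewrite /= in_itv/= -ler_norml; [exact: (H 0)|exact: (H 1)].
have [c /set_mem Kc cmax] := compact_EVT_max (ex_intro _ x0 Kx0) cK
  (continuous_subspaceT (sm_continuous sw)).
have qE x : q x = abs2 x ^+ 2 by rewrite sqr_abs2 /q !mulr1.
have wc : 2 * m <= w c.
  rewrite (le_trans _ (cmax x0 (mem_set Kx0)))// /w qE.
  have -> : 2 * m = u x0 by rewrite /m; lra.
  by rewrite lerDl mulr_ge0 ?sqr_ge0// ltW.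
have qc : q c <= 2 * L ^+ 2.
  move: Kc => [/=]; rewrite !in_itv/= -!ler_norml /q !mulr1 => c1 c2.
  have n0 : 0 <= L by exact: ltW.
  have H (a : R) : `|a| <= L -> a * a <= L ^+ 2.
    by move=> aL; rewrite -expr2 -real_normK ?num_real// lerXn2r ?nnegrE.
  have := H _ c1; have := H _ c2; rewrite /coordinate/=; lra.
have uc : m < u c.
  have : e * q c <= e * (2 * L ^+ 2) by rewrite ler_wpM2l// ltW.
  move: wc; rewrite /w; lra.
have cin i : `|coordinate i c| < L.
  rewrite ltNge; apply/negP => Lc.
  have : M < abs2 c by rewrite (lt_le_trans ML)// (le_trans Lc)// coordinate_le_abs2.
  move=> /HM; rewrite ltr_norml => /andP[]; lra.
have second i : pd i (pd i w) c <= 0.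
  have D u' (t : R) : sm u' -> is_derive t 1 (fun t : R => u' (c + t *: evec R i)) (pd i u' (c + t *: evec R i)).
    by move=> su'; rewrite pd_derive; apply: is_derive_line; exact: sm_derivable.
  have := @local_max_second_derivative (fun t => w (c + t *: evec R i))
    (fun t => pd i w (c + t *: evec R i)) (fun t => pd i (pd i w) (c + t *: evec R i))
    (L - `|coordinate i c|).
  rewrite !scale0r !addr0; apply.
  - by rewrite subr_gt0.
  - by move=> t; exact: D.
  - by move=> t; apply: D; exact: sm_pd.
  - apply: (@continuous_comp _ _ _ (fun t : R => c + t *: evec R i) (pd i (pd i w))).
      by apply: cvgD; [exact: cvg_cst|exact: scalel_continuous].
    by apply: sm_continuous; do 2!apply: sm_pd.
  - move=> t tL; apply: cmax; apply/mem_set.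
    have H : `|coordinate i c + t| <= L.
      by rewrite (le_trans (ler_normD _ _))//; lra.
    move: Kc => [/=]; rewrite !in_itv/= => c1 c2.
    elim/ord2P: i H {tL D} => /=; rewrite /coordinate/= ler_norml => H; split;
      by rewrite /evec/= ?scaler0 ?addr0 ?[t%:A]mulr1.
have := lw c; rewrite /lap; have := second 0; have := second 1; lra.
Qed.

Lemma harmonic_vanishing u : sm u -> (forall x, lap u x = 0) ->
  u @ @at_infinity R --> (0 : R) -> forall x, u x = 0.
Proof.
move=> su lu u0 x; apply/eqP; rewrite eq_le harmonic_le0//=.
have sN := smZ (-1) su.
rewrite -oppr_le0 -mulN1r; apply: (harmonic_le0 sN).
- by move=> y; rewrite lapZ// lu mulr0.
- by rewrite -(mulr0 (-1)); apply: cvgM => //; exact: cvg_cst.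
Qed.

Lemma biharmonic_vanishing w : sm w -> (forall x, lap (lap w) x = 0) ->
  lap w @ @at_infinity R --> (0 : R) -> w @ @at_infinity R --> (0 : R) ->
  forall x, w x = 0.
Proof.
move=> sw l2 lw0 w0; apply: harmonic_vanishing => //.
by apply: harmonic_vanishing => //; exact: sm_lap.
Qed.

End Liouville.

(** * Integration by parts on squares *)

Section Boxes.
Variable R : realType.
Local Notation mu := (@lebesgue_measure R).
Local Notation mu2 := (mu \x mu)%E.
Implicit Types (F G f u v w : R * R -> R) (x : R * R) (i j k : 'I_2) (N : R).

Definition side N : set R := `[- N, N]%classic.

Definition box_int N F : R := \int[mu2]_(z in side N `*` side N) F z.

Lemma measurable_box N : measurable (side N `*` side N : set (measurableTypeR R * measurableTypeR R)).
Proof. by apply: measurableX; exact: measurable_itv. Qed.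

Lemma side_le N (a : R) : side N a <-> `|a| <= N.
Proof. by rewrite /side /= in_itv/= ler_norml. Qed.

Lemma compact_box N : compact (side N `*` side N).
Proof. by apply: compact_setX; exact: segment_compact. Qed.

Lemma continuous_box_bounded N G : continuous G ->
  exists2 C : R, 0 <= C & forall a b, side N a -> side N b -> `|G (a, b)| <= C.
Proof.
move=> cG; have [[a [b [Na Nb]]]|nab] := pselect (exists a b, side N a /\ side N b); last first.
  by exists 0 => // a b Na Nb; exfalso; apply: nab; exists a, b.
have cn : continuous (fun z => `|G z|) by move=> z; apply: cvg_norm; exact: cG.
have [c _ cmax] := compact_EVT_max (ex_intro _ (a, b) (conj Na Nb)) (@compact_box N)
  (continuous_subspaceT cn).
by exists `|G c| => // s t Ns Nt; apply: cmax; apply/mem_set.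
Qed.

Lemma integrable_side N (f : R -> R) : continuous f -> mu.-integrable (side N) (EFin \o f).
Proof.
move=> cf; apply: continuous_compact_integrable; first exact: segment_compact.
exact: continuous_subspaceT.
Qed.

Lemma integrable_box N G : continuous G ->
  mu2.-integrable (side N `*` side N) (EFin \o G).
Proof.
move=> cG; have [C C0 HC] := continuous_box_bounded N cG.
apply: (@integrable_rectangle _ _ _ _ _ mu mu (side N) (side N) _ _ G (fun=> C) (fun=> 1)) => //.
- exact: measurable_itv.
- exact: measurable_itv.
- exact: continuous_measurable_plane.
- by move=> a b Na Nb; rewrite mulr1; exact: HC.
- by apply: integrable_side => z; exact: cvg_cst.
- by apply: integrable_side => z; exact: cvg_cst.
Qed.

Lemma box_intD N F G : continuous F -> continuous G ->
  box_int N (fun x => F x + G x) = box_int N F + box_int N G.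
Proof.
move=> cF cG; rewrite /box_int RintegralD//; [exact: measurable_box|exact: integrable_box|].
exact: integrable_box.
Qed.

Lemma box_intZ N c F : continuous F -> box_int N (fun x => c * F x) = c * box_int N F.
Proof.
move=> cF; rewrite /box_int RintegralZl//; [exact: measurable_box|exact: integrable_box].
Qed.

Lemma side_FTC N (f H : R -> R) : 0 < N -> continuous f ->
  (forall t : R, is_derive t 1 H (f t)) -> \int[mu]_(t in side N) f t = H N - H (- N).
Proof.
by move=> N0 cf dH; apply: segment_FTC => //; lra.
Qed.

Lemma is_derive_slot1 w (a t : R) : derivable_everywhere w ->
  is_derive t 1 (fun t : R => w (a, t)) (pd 1 w (a, t)).
Proof.
move=> dw; have E s : (a, 0) + s *: evec R 1 = (a, s).
  by rewrite /evec; congr pair; rewrite /= ?scaler0 ?addr0// add0r [s%:A]mulr1.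
have D := is_derive_line (dw 1 ((a, 0) + t *: evec R 1)).
rewrite -(E t) pd_derive; move: D; congr (is_derive _ _ _ _).
by apply/funext => s; rewrite E.
Qed.

Lemma is_derive_slot0 w (b t : R) : derivable_everywhere w ->
  is_derive t 1 (fun t : R => w (t, b)) (pd 0 w (t, b)).
Proof.
move=> dw; have E s : (0, b) + s *: evec R 0 = (s, b).
  by rewrite /evec; congr pair; rewrite /= ?scaler0 ?addr0// add0r [s%:A]mulr1.
have D := is_derive_line (dw 0 ((0, b) + t *: evec R 0)).
rewrite -(E t) pd_derive; move: D; congr (is_derive _ _ _ _).
by apply/funext => s; rewrite E.
Qed.

Definition null_on_boundary N w := forall x,
  `|coordinate 0 x| = N \/ `|coordinate 1 x| = N -> w x = 0.

Lemma box_int_pd N w i : 0 < N -> derivable_everywhere w -> continuous (pd i w) ->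
  null_on_boundary N w -> box_int N (pd i w) = 0.
Proof.
move=> N0 dw cw bw; rewrite /box_int.
have nN : `|N| = N by rewrite gtr0_norm.
elim/ord2P: i cw => cw.
  rewrite Fubini_rectangle_rl//; last 4 first.
  - exact: measurable_itv.
  - exact: measurable_itv.
  - exact: integrable_box.
  - by move=> b _; apply: integrable_side; exact: continuous_slice_l.
  rewrite (@eq_Rintegral _ _ _ mu (side N) (fun=> 0)); first by rewrite /Rintegral integral0.
  move=> b _; apply: (eq_trans (@side_FTC N (fun t => pd 0 w (t, b)) (fun t => w (t, b)) N0 _ _)).
  - exact: continuous_slice_l.
  - by move=> t; exact: is_derive_slot0.
  - by rewrite /= !bw ?subrr//=; left; rewrite /coordinate/= ?normrN.
rewrite Fubini_rectangle_lr//; last 4 first.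
- exact: measurable_itv.
- exact: measurable_itv.
- exact: integrable_box.
- by move=> b _; apply: integrable_side; exact: continuous_slice_r.
rewrite (@eq_Rintegral _ _ _ mu (side N) (fun=> 0)); first by rewrite /Rintegral integral0.
move=> a _; apply: (eq_trans (@side_FTC N (fun t => pd 1 w (a, t)) (fun t => w (a, t)) N0 _ _)).
- exact: continuous_slice_r.
- by move=> t; exact: is_derive_slot1.
- by rewrite /= !bw ?subrr//=; right; rewrite /coordinate/= ?normrN.
Qed.

Lemma box_by_parts N i u w : 0 < N -> sm u -> sm w -> null_on_boundary N w ->
  box_int N (fun x => u x * pd i w x) = -1 * box_int N (fun x => pd i u x * w x).
Proof.
move=> N0 su sw bw.
have c1 : continuous (fun x => u x * pd i w x).
  by apply: continuousMf; apply: sm_continuous => //; exact: sm_pd.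
have c2 : continuous (fun x => pd i u x * w x).
  by apply: continuousMf; apply: sm_continuous => //; exact: sm_pd.
have E := pdM i (sm_derivable su) (sm_derivable sw).
have : box_int N (pd i (fun x => u x * w x)) = 0.
  apply: box_int_pd => //.
  - by apply: derivable_everywhereM; exact: sm_derivable.
  - by rewrite E; exact: continuousDf.
  - by move=> x /bw ->; rewrite mulr0.
by rewrite E box_intD// mulN1r => /eqP; rewrite addr_eq0 => /eqP.
Qed.

End Boxes.

(** * Polynomial test functions *)

Section TestFunctions.
Variable R : realType.
Local Notation mu := (@lebesgue_measure R).
Local Notation mu2 := (mu \x mu)%E.
Implicit Types (F G f u v w : R * R -> R) (x : R * R) (i j k : 'I_2) (N : R) (p q : {poly R}).

Lemma box_int_tensor N (a b : R -> R) : continuous a -> continuous b ->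
  box_int N (fun x => a x.1 * b x.2) =
  (\int[mu]_(s in side N) a s) * (\int[mu]_(t in side N) b t).
Proof.
move=> ca cb; rewrite /box_int.
apply: eq_trans (_ : \int[mu]_(s in side N) ((\int[mu]_(t in side N) b t) * a s) = _); last first.
  by rewrite mulrC; apply: RintegralZl; [exact: measurable_itv|exact: integrable_side].
apply: (eq_trans (Fubini_rectangle_lr _ _ _ _)).
- exact: measurable_itv.
- exact: measurable_itv.
- apply: integrable_box; apply: continuousMf.
  + exact: continuous_comp_fst.
  + exact: continuous_comp_snd.
- move=> s _; apply: (@integrable_side _ N (fun y => a s * b y)).
  by apply: continuous_scale.
- apply: eq_Rintegral => s _ /=; rewrite [RHS]mulrC.
  by apply: RintegralZl; [exact: measurable_itv|exact: integrable_side].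
Qed.

Lemma box_int_le N F G : continuous F -> continuous G ->
  (forall s t, side N s -> side N t -> F (s, t) <= G (s, t)) -> box_int N F <= box_int N G.
Proof.
move=> cF cG FG; apply: le_Rintegral.
- exact: measurable_box.
- exact: integrable_box.
- exact: integrable_box.
- by move=> [s t] [/= Ns Nt]; exact: FG.
Qed.

Lemma box_int_abs N F : continuous F -> `|box_int N F| <= box_int N (fun x => `|F x|).
Proof.
by move=> cF; apply: le_normr_Rintegral; [exact: measurable_box|exact: integrable_box].
Qed.

Lemma side_int1 N : 0 < N -> \int[mu]_(t in side N) (1 : R) = N *+ 2.
Proof.
move=> N0; rewrite (@side_FTC _ N (fun=> 1) id) // ?opprK//.
by move=> z; exact: cvg_cst.
Qed.

Lemma side_int_bell N : 0 < N -> 0 <= \int[mu]_(t in side N) ((1 + t ^+ 2)^-1) <= pi.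
Proof.
move=> N0; apply/andP; split.
  by apply: Rintegral_ge0 => t _; rewrite invr_ge0 addr_ge0// sqr_ge0.
rewrite (@side_FTC _ N (fun t => (1 + t ^+ 2)^-1) atan) //.
- rewrite atanN; have := atan_ltpi2 N; lra.
- exact: continuous_bell0.
Qed.

(** Outside of a disc [v] is at most [e]; inside, it is bounded and the product of
    bells is bounded below. *)
Lemma vanishing_majorant v : (exists C : R, forall x, `|v x| <= C) -> v @ @at_infinity R --> (0 : R) ->
  forall e : R, 0 < e -> exists2 K : R, 0 <= K &
    forall x, `|v x| <= e + K * ((1 + x.1 ^+ 2)^-1 * (1 + x.2 ^+ 2)^-1).
Proof.
move=> [C HC] v0 e e0.
have /cvgrPdist_lt/(_ _ e0)[M HM] := v0.
have C0 : 0 <= C by apply: le_trans (HC 0).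
exists (C * (1 + M ^+ 2) ^+ 2) => [|x].
  by rewrite mulr_ge0// sqr_ge0.
have b0 : 0 <= (1 + x.1 ^+ 2)^-1 * (1 + x.2 ^+ 2)^-1.
  by rewrite mulr_ge0// invr_ge0 addr_ge0// sqr_ge0.
have [Mx|xM] := ltP M (abs2 x).
  have /= := HM _ Mx; rewrite sub0r normrN => /ltW H.
  apply: (le_trans H); rewrite lerDl mulr_ge0//.
  by rewrite mulr_ge0// sqr_ge0.
apply: (le_trans (HC x)).
suff H : 1 <= (1 + M ^+ 2) ^+ 2 * ((1 + x.1 ^+ 2)^-1 * (1 + x.2 ^+ 2)^-1).
  rewrite -mulrA; apply: (@le_trans _ _ (C * 1)); first by rewrite mulr1.
  by apply: (le_trans (ler_wpM2l C0 H)); rewrite lerDr ltW.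
have a0 := abs2_ge0 x.
have aM : abs2 x ^+ 2 <= M ^+ 2 by rewrite ler_sqr// nnegrE// (le_trans a0).
move: aM; rewrite sqr_abs2 => aM.
have p1 : 0 < 1 + x.1 ^+ 2 by rewrite ltr_pwDl// sqr_ge0.
have p2 : 0 < 1 + x.2 ^+ 2 by rewrite ltr_pwDl// sqr_ge0.
rewrite -invfM ler_pdivlMr ?mulr_gt0// mul1r expr2.
have s1 := sqr_ge0 x.1; have s2 := sqr_ge0 x.2.
by apply: ler_pM; [exact: ltW|exact: ltW| |]; move: aM s1 s2; lra.
Qed.

(** In the bound of [vanishing_majorant] the constant [e] contributes at most [4 e]
    to the average, and the integrable term [O(N^-2)]. *)
Lemma box_mean_vanishing v : continuous v ->
  (exists C : R, forall x, `|v x| <= C) -> v @ @at_infinity R --> (0 : R) ->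
  (fun n => n.+1%:R ^- 2 * box_int n.+1%:R (fun x => `|v x|)) @ \oo --> (0 : R).
Proof.
move=> cv bv v0; apply/cvgr0Pnorm_lt => e e0.
have e8 : 0 < e / 8 by lra.
have [K K0 HK] := vanishing_majorant bv v0 e8.
have cn : continuous (fun x => `|v x|) by move=> z; apply: cvg_norm; exact: cv.
have cb := @continuous_bell0 R.
have c1 : continuous (fun _ : R => 1 : R) by move=> z; exact: cvg_cst.
have B (N : R) : 0 < N -> box_int N (fun x => `|v x|) <= e / 8 * ((N *+ 2) * (N *+ 2)) + K * (pi * pi).
  move=> N0.
  have T1 := box_int_tensor N c1 c1.
  have T2 := box_int_tensor N cb cb.
  have d1 : continuous (fun x : R * R => (1 : R) * 1) by move=> z; exact: cvg_cst.
  have d2 : continuous (fun x : R * R => (1 + x.1 ^+ 2)^-1 * (1 + x.2 ^+ 2)^-1).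
    apply: continuousMf; first exact: (continuous_comp_fst cb).
    exact: (continuous_comp_snd cb).
  apply: (@le_trans _ _ (box_int N (fun x => e / 8 * (1 * 1) +
     K * ((1 + x.1 ^+ 2)^-1 * (1 + x.2 ^+ 2)^-1)))).
    apply: box_int_le => //.
      by apply: continuousDf; exact: continuousZf.
    by move=> s t _ _; rewrite !mulr1; exact: HK.
  rewrite box_intD; last 2 first.
  - exact: continuousZf.
  - exact: continuousZf.
  rewrite (box_intZ _ _ d1) (box_intZ _ _ d2) T1 T2 !side_int1// lerD2l ler_wpM2l//.
  have /andP[b0 bpi] := side_int_bell N0.
  exact: ler_pM.
have pp0 : 0 <= K * (pi * pi) :> R by rewrite mulr_ge0// mulr_ge0// pi_ge0.
have H : (fun n => K * (pi * pi) * harmonic n) @ \oo --> (0 : R).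
  by rewrite -(mulr0 (K * (pi * pi))); apply: cvgMr; exact: cvg_harmonic.
have e2 : 0 < e / 2 by lra.
have /cvgrPdist_lt/(_ _ e2) := H; apply: filterS => n /=; rewrite sub0r normrN => Hn.
have N0 : 0 < n.+1%:R :> R by rewrite ltr0n.
have N1 : 1 <= n.+1%:R :> R by rewrite ler1n.
have b0 : 0 <= box_int n.+1%:R (fun x => `|v x|) by apply: Rintegral_ge0.
have iN0 : 0 <= n.+1%:R ^- 2 :> R by rewrite invr_ge0 exprn_ge0.
rewrite ger0_norm ?mulr_ge0//.
apply: (le_lt_trans (ler_wpM2l iN0 (B _ N0))).
have -> : n.+1%:R ^- 2 * (e / 8 * ((n.+1%:R *+ 2) * (n.+1%:R *+ 2)) + K * (pi * pi)) =
    e / 2 + n.+1%:R ^- 2 * (K * (pi * pi)) :> R.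
  by field; rewrite gt_eqF.
rewrite [X in _ < X](splitr e) ltrD2l.
apply: le_lt_trans Hn; apply: (le_trans _ (ler_norm _)).
rewrite mulrC ler_wpM2l// lef_pV2 ?posrE ?exprn_gt0//.
by rewrite -[leLHS]expr1; apply: ler_weXn2l.
Qed.

Definition stretch i N p x : R := p.[coordinate i x / N].

(** Test functions adapted to the square of half-side [N]: bounded there uniformly
    in [N], and losing a factor [N] with each derivative. *)
Definition tensor_poly N p q x : R := stretch 0 N p x * stretch 1 N q x.

Definition deriv_if (b : bool) p : {poly R} := if b then p^`() else p.

Lemma stretchMXaddC i N p c :
  stretch i N (p * 'X + c%:P) = fun x => N^-1 * (coordinate i x * stretch i N p x) + c.
Proof.
by apply/funext => x; rewrite /stretch hornerMXaddC; ring.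
Qed.

Lemma sm_stretchM i N p u : sm u -> sm (fun x => stretch i N p x * u x).
Proof.
move=> su; elim/poly_ind: p => [|p c IH].
  rewrite (_ : (fun x => _) = fun=> 0); first exact: sm_cst.
  by apply/funext => x; rewrite /stretch horner0 mul0r.
rewrite stretchMXaddC.
rewrite (_ : (fun x => _) =
    fun x => N^-1 * (coordinate i x * (stretch i N p x * u x)) + c * u x).
  by apply: smD; apply: smZ => //; exact: sm_coordM.
by apply/funext => x; rewrite mulrDl !mulrA.
Qed.

Lemma sm_stretch i N p : sm (stretch i N p).
Proof.
rewrite (_ : stretch i N p = fun x => stretch i N p x * 1).
  by apply: sm_stretchM; exact: sm_cst.
by apply/funext => x; rewrite mulr1.
Qed.

Lemma sm_tensor_poly N p q : sm (tensor_poly N p q).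
Proof. by apply: sm_stretchM; exact: sm_stretch. Qed.

Lemma pd_stretch k i N p :
  pd k (stretch i N p) = fun x => N^-1 * ((k == i)%:R * stretch i N p^`() x).
Proof.
elim/poly_ind: p => [|p c IH].
  rewrite (_ : stretch i N 0 = fun=> 0) ?pd_cst; last first.
    by apply/funext => x; rewrite /stretch horner0.
  by apply/funext => x; rewrite /stretch deriv0 horner0 !mulr0.
rewrite stretchMXaddC.
have s1 := sm_coordM i (sm_stretch i N p).
rewrite pdD; last 2 first.
- by apply: sm_derivable; exact: smZ.
- by apply: sm_derivable; exact: sm_cst.
rewrite pdZ; last exact: sm_derivable.
rewrite pd_coordM; last exact: sm_derivable (sm_stretch i N p).
rewrite pd_cst IH; apply/funext => x.
rewrite derivMXaddC /stretch hornerD hornerMX addr0.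
case: (k == i); ring.
Qed.

Lemma pd_tensor_poly k N p q : pd k (tensor_poly N p q) =
  fun x => N^-1 * tensor_poly N (deriv_if (k == 0) p) (deriv_if (k == 1) q) x.
Proof.
rewrite /tensor_poly (pdM k (sm_derivable (sm_stretch 0 N p)) (sm_derivable (sm_stretch 1 N q))).
rewrite !pd_stretch; apply/funext => x.
elim/ord2P: k => /=; rewrite /deriv_if /=; ring.
Qed.

Lemma poly_bounded p : exists2 C : R, 0 <= C & forall s : R, `|s| <= 1 -> `|p.[s]| <= C.
Proof.
elim/poly_ind: p => [|p c [C C0 HC]]; first by exists 0 => // s _; rewrite horner0 normr0.
exists (C + `|c|) => [|s s1]; first by rewrite addr_ge0.
rewrite hornerMXaddC; apply: (le_trans (ler_normD _ _)); rewrite lerD2r normrM.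
rewrite -[C]mulr1; exact: ler_pM (HC s s1) s1.
Qed.

Lemma tensor_poly_bounded p q : exists2 C : R, 0 <= C &
  forall N s t, 0 < N -> side N s -> side N t -> `|tensor_poly N p q (s, t)| <= C.
Proof.
have [C C0 HC] := poly_bounded p; have [D D0 HD] := poly_bounded q.
exists (C * D) => [|N s t N0 /side_le Ns /side_le Nt]; first exact: mulr_ge0.
have I (a : R) : `|a| <= N -> `|a / N| <= 1.
  by move=> aN; rewrite normrM normfV (gtr0_norm N0) ler_pdivrMr// mul1r.
rewrite /tensor_poly normrM; apply: ler_pM => //; rewrite /stretch /coordinate/=.
- by apply: HC; exact: I.
- by apply: HD; exact: I.
Qed.

(** [p] vanishes to the order [n] at [1] and [-1]. *)
Definition flat n p := exists r, p = (1 - 'X ^+ 2) ^+ n * r.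

Lemma flatW n p : flat n.+1 p -> flat n p.
Proof. by move=> [r ->]; exists ((1 - 'X ^+ 2) * r); rewrite exprSr mulrA. Qed.

Lemma flat_deriv_if n b p : flat n.+1 p -> flat n (deriv_if b p).
Proof.
case: b => [[r ->]|]; last exact: flatW.
exists ((1 - 'X ^+ 2) * r^`() + (1 - 'X ^+ 2)^`() *+ n.+1 * r).
rewrite /deriv_if; move: (1 - 'X ^+ 2) => W.
rewrite derivM deriv_exp /= exprSr mulrDr [RHS]addrC mulrA !mulrnAl mulrnAr.
by congr (_ *+ _ + _); rewrite mulrA [W^`() * _]mulrC.
Qed.

Lemma flat_root n p (s : R) : flat n.+1 p -> `|s| = 1 -> p.[s] = 0.
Proof.
move=> [r ->] s1.
have s2 : s ^+ 2 = 1 by rewrite -real_normK ?num_real// s1 expr1n.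
by rewrite hornerM horner_exp hornerD hornerN hornerXn hornerC s2 subrr expr0n mul0r.
Qed.

Lemma null_on_boundary_tensor_poly N n p q : 0 < N -> flat n.+1 p -> flat n.+1 q ->
  null_on_boundary N (tensor_poly N p q).
Proof.
move=> N0 fp fq x.
have I (a : R) : `|a| = N -> `|a / N| = 1.
  by move=> aN; rewrite normrM normfV aN (gtr0_norm N0) divff// gt_eqF.
move=> [/I|/I] H; rewrite /tensor_poly /stretch.
- by rewrite (flat_root fp H) mul0r.
- by rewrite (flat_root fq H) mulr0.
Qed.

End TestFunctions.

(** * The means of a decomposable tensor field *)

Section Means.
Variable R : realType.
Local Notation mu := (@lebesgue_measure R).
Local Notation mu2 := (mu \x mu)%E.
Implicit Types (f u v w : R * R -> R) (x : R * R) (i j k : 'I_2) (N : R) (p q : {poly R}).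

Lemma box_by_parts2 N i j u w : 0 < N -> sm u -> sm w ->
  null_on_boundary N w -> null_on_boundary N (pd j w) ->
  box_int N (fun x => u x * pd i (pd j w) x) = box_int N (fun x => pd j (pd i u) x * w x).
Proof.
move=> N0 su sw w0 dw0; rewrite box_by_parts//; last exact: sm_pd.
by rewrite box_by_parts//; [rewrite mulrA mulrNN !mul1r|exact: sm_pd].
Qed.

(** The factors of the [(i, j)] entry of the Hessian of a product of a polynomial
    [p] in the first variable and a polynomial [q] in the second one. *)
Definition hess_fst i j p : {poly R} := deriv_if (i == 0) (deriv_if (j == 0) p).
Definition hess_snd i j q : {poly R} := deriv_if (i == 1) (deriv_if (j == 1) q).

Lemma pd_pd_tensor_poly N i j p q : pd i (pd j (tensor_poly N p q)) =
  fun x => N ^- 2 * tensor_poly N (hess_fst i j p) (hess_snd i j q) x.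
Proof.
rewrite pd_tensor_poly pdZ; last exact: sm_derivable (sm_tensor_poly _ _ _).
rewrite pd_tensor_poly; apply/funext => x.
by rewrite mulrA -invfM.
Qed.

Lemma null_on_boundaryZ N c w : null_on_boundary N w -> null_on_boundary N (fun x => c * w x).
Proof. by move=> nw x /nw ->; rewrite mulr0. Qed.

(** Two integrations by parts let the operator [divdiv] act on [g], and the two
    derivatives of [v] act on the test function, which thus gets four of them; the
    factor [N ^- 2] remains after multiplication of both sides by [N ^+ 2]. *)
Lemma box_pairing N p q (f g : 'I_2 -> 'I_2 -> R * R -> R) v :
  0 < N -> flat 4 p -> flat 4 q ->
  (forall i j, sm (g i j)) -> sm v ->
  (forall i j, f i j = fun x => g i j x + pd i (pd j v) x) ->
  (forall x, \sum_i \sum_j pd i (pd j (g i j)) x = 0) ->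
  \sum_i \sum_j box_int N (fun x => f i j x * tensor_poly N (hess_fst i j p) (hess_snd i j q) x) =
  N ^- 2 * \sum_i \sum_j box_int N (fun x => v x *
    tensor_poly N (hess_fst j i (hess_fst i j p)) (hess_snd j i (hess_snd i j q)) x).
Proof.
move=> N0 fp fq sg sv fE gE.
pose T p q := tensor_poly N p q.
have sT p' q' : sm (T p' q') by exact: sm_tensor_poly.
have N2 : N ^+ 2 != 0 by rewrite expf_neq0// gt_eqF.
have nT n p' q' : flat n.+1 p' -> flat n.+1 q' -> null_on_boundary N (T p' q').
  exact: null_on_boundary_tensor_poly.
have ndT n k p' q' : flat n.+2 p' -> flat n.+2 q' -> null_on_boundary N (pd k (T p' q')).
  move=> fp' fq'; rewrite pd_tensor_poly; apply: null_on_boundaryZ.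
  by apply: (@nT n); exact: flat_deriv_if.
have scale i j u p' q' : sm u ->
    box_int N (fun x => u x * pd i (pd j (T p' q')) x) =
    N ^- 2 * box_int N (fun x => u x * T (hess_fst i j p') (hess_snd i j q') x).
  move=> su; rewrite pd_pd_tensor_poly -box_intZ; last first.
    by apply: continuousMf; apply: sm_continuous.
  by congr box_int; apply/funext => x; rewrite mulrCA.
have E i j : box_int N (fun x => f i j x * T (hess_fst i j p) (hess_snd i j q) x) =
    N ^+ 2 * box_int N (fun x => pd j (pd i (g i j)) x * T p q x) +
    N ^- 2 * box_int N (fun x => v x * T (hess_fst j i (hess_fst i j p)) (hess_snd j i (hess_snd i j q)) x).
  have sf : sm (f i j) by rewrite fE; apply: smD => //; do 2 apply: sm_pd.
  have -> : box_int N (fun x => f i j x * T (hess_fst i j p) (hess_snd i j q) x) =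
      N ^+ 2 * box_int N (fun x => f i j x * pd i (pd j (T p q)) x).
    by rewrite scale// mulrA divff// mul1r.
  have -> : box_int N (fun x => f i j x * pd i (pd j (T p q)) x) =
      box_int N (fun x => g i j x * pd i (pd j (T p q)) x) +
      box_int N (fun x => pd i (pd j v) x * pd i (pd j (T p q)) x).
    rewrite -box_intD; last 2 first.
    - by apply: continuousMf; apply: sm_continuous => //; do 2 apply: sm_pd.
    - by apply: continuousMf; apply: sm_continuous => //; do 2 apply: sm_pd.
    by congr box_int; apply/funext => x; rewrite fE mulrDl.
  rewrite (box_by_parts2 i N0 (sg i j) (sT p q) (nT 3 _ _ fp fq) (ndT 2 j _ _ fp fq)).
  rewrite mulrDr; congr (_ + _).
  have sw : sm (pd i (pd j (T p q))) by do 2 apply: sm_pd.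
  have fh1 b1 b2 : flat 2 (deriv_if b1 (deriv_if b2 p)) by do 2 apply: flat_deriv_if.
  have fh2 b1 b2 : flat 2 (deriv_if b1 (deriv_if b2 q)) by do 2 apply: flat_deriv_if.
  have -> : box_int N (fun x => pd i (pd j v) x * pd i (pd j (T p q)) x) =
      box_int N (fun x => v x * pd j (pd i (pd i (pd j (T p q)))) x).
    have n1 : null_on_boundary N (pd i (pd j (T p q))).
      by rewrite pd_pd_tensor_poly; apply: null_on_boundaryZ; exact: (nT 1%N _ _ (fh1 (i == 0) (j == 0)) (fh2 (i == 1) (j == 1))).
    have n2 : null_on_boundary N (pd i (pd i (pd j (T p q)))).
      rewrite pd_pd_tensor_poly pdZ; last exact: sm_derivable (sT _ _).
      by apply: null_on_boundaryZ; exact: (ndT 0%N i _ _ (fh1 (i == 0) (j == 0)) (fh2 (i == 1) (j == 1))).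
    by rewrite -(box_by_parts2 j N0 sv sw n1 n2).
  set P := hess_fst i j p; set Q := hess_snd i j q.
  have D4 : pd j (pd i (pd i (pd j (T p q)))) =
      fun x => N ^- 2 * (N ^- 2 * T (hess_fst j i P) (hess_snd j i Q) x).
    rewrite pd_pd_tensor_poly -/P -/Q.
    have -> : pd i (fun x => N ^- 2 * tensor_poly N P Q x) = fun x => N ^- 2 * pd i (T P Q) x.
      exact: (pdZ i _ (sm_derivable (sT P Q))).
    have -> : pd j (fun x => N ^- 2 * pd i (T P Q) x) = fun x => N ^- 2 * pd j (pd i (T P Q)) x.
      exact: (pdZ j _ (sm_derivable (sm_pd i (sT P Q)))).
    by rewrite pd_pd_tensor_poly.
  rewrite D4 (_ : (fun x => v x * _) =
      fun x => N ^- 2 * (N ^- 2 * (v x * T (hess_fst j i P) (hess_snd j i Q) x))); last first.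
    by apply/funext => x; rewrite mulrCA; congr (_ * _); rewrite mulrCA.
  have cvT p' q' : continuous (fun x => v x * T p' q' x).
    by apply: continuousMf; exact: sm_continuous.
  rewrite !box_intZ//; last exact: continuousZf.
  by rewrite mulrA divff// mul1r.
rewrite (eq_bigr _ (fun i _ => eq_bigr _ (fun j _ => E i j))).
rewrite (eq_bigr _ (fun i _ => big_split _ _ _ _ _)) big_split /=.
rewrite [X in X + _](_ : _ = 0) ?add0r; last first.
  have cg i j : continuous (fun x => pd j (pd i (g i j)) x * T p q x).
    by apply: continuousMf; apply: sm_continuous => //; do 2 apply: sm_pd.
  rewrite !sum2E -!mulrDr -!box_intD//; last 2 first.
  - exact: continuousDf.
  - exact: continuousDf.
  rewrite (_ : (fun x => _) = fun=> 0 * 0); last first.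
    apply/funext => x; have := gE x; rewrite !sum2E => H.
    rewrite -!mulrDl mul0r (_ : _ + _ = 0) ?mul0r//.
    by rewrite -[RHS]H (sm_pdC 0 1 (sg 0 1)) (sm_pdC 1 0 (sg 1 0)).
  by rewrite box_intZ ?mul0r ?mulr0// => z; exact: cvg_cst.
by rewrite mulr_sumr; apply: eq_bigr => i _; rewrite mulr_sumr.
Qed.

(** By dominated convergence: the rescaled test function tends pointwise to its
    value at the origin. *)
Lemma box_tensor_poly_cvg f p q : sch f ->
  (fun n => box_int n.+1%:R (fun x => f x * tensor_poly n.+1%:R p q x)) @ \oo -->
  p.[0] * q.[0] * \int[mu2]_x f x.
Proof.
move=> sf.
have cf : continuous f by exact: sm_continuous (sch_sm sf).
have [C C0 HC] := tensor_poly_bounded p q.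
pose F n x := f x * tensor_poly n.+1%:R p q x.
pose box n := side (n.+1%:R : R) `*` side (n.+1%:R : R).
pose h n := (EFin \o F n) \_ (box n).
have mbox n : measurable (box n) by exact: measurable_box.
have N0 n : 0 < n.+1%:R :> R by rewrite ltr0n.
have cF n : continuous (F n).
  by apply: continuousMf => //; exact: sm_continuous (sm_tensor_poly _ _ _).
have fi : mu2.-integrable setT (EFin \o f) by rewrite -setXTT; exact: integrable_sch_plane.
have nfi : mu2.-integrable setT (EFin \o (fun x => `|f x|)).
  by have := integrable_norm fi.
have [] := @dominated_convergence _ _ R mu2 setT measurableT h
  (fun x => (p.[0] * q.[0] * f x)%:E) (fun x => (C * `|f x|)%:E).
- move=> n; apply/(measurable_restrictT _ (mbox n)).
  apply: measurable_funTS; apply/measurable_EFinP.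
  exact: continuous_measurable_plane.
- by apply/measurable_EFinP; apply: continuous_measurable_plane; exact: continuousZf.
- apply: aeW => x _.
  have c0 (a : R) r : r.[a / n.+1%:R] @[n --> \oo] --> r.[0].
    have H0 : (fun n => a * harmonic n) @ \oo --> (0 : R).
      by rewrite -(mulr0 a); apply: cvgMr; exact: cvg_harmonic.
    exact: (cvg_comp _ _ H0 (@continuous_horner R r 0)).
  have cT : (F n x)%:E @[n --> \oo] --> (p.[0] * q.[0] * f x)%:E.
    apply: cvg_EFin; first by apply: nearW.
    rewrite [_ * f x]mulrC; apply: cvgMr; apply: cvgM; exact: c0.
  apply: cvg_trans cT; apply: near_eq_cvg.
  have /cvgryPge/(_ (Num.max `|x.1| `|x.2|)) := @cvgr_idn R.
  apply: filterS => n xn.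
  rewrite /h /patch mem_set//; split; apply/side_le; apply: (@le_trans _ _ n%:R); rewrite ?ler_nat//.
    by apply: le_trans xn; rewrite le_max lexx.
  by apply: le_trans xn; rewrite le_max lexx orbT.
- exact: integrable_scale.
- apply: aeW => x n _; rewrite /h /patch; case: ifPn => [/set_mem [xs xt]|_].
    rewrite /= lee_fin /F normrM mulrC ler_wpM2r//.
    by case: x xs xt => s t /= xs xt; exact: HC.
  by rewrite abse0 lee_fin mulr_ge0.
move=> _ _ H.
have E : (\int[mu2]_x (p.[0] * q.[0] * f x)%:E)%E = (p.[0] * q.[0] * \int[mu2]_x f x)%:E.
  rewrite -RintegralZl// /Rintegral fineK//.
  by apply: integrable_fin_num => //; exact: integrable_scale.
rewrite E in H; move/fine_cvg: H; apply: cvg_trans; apply: near_eq_cvg; apply: nearW => n /=.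
by rewrite /box_int /Rintegral [in LHS]/h -integral_mkcond.
Qed.

Lemma box_remainder_cvg0 p q v : continuous v ->
  (exists C : R, forall x, `|v x| <= C) -> v @ @at_infinity R --> (0 : R) ->
  (fun n => n.+1%:R ^- 2 * box_int n.+1%:R (fun x => v x * tensor_poly n.+1%:R p q x)) @ \oo
    --> (0 : R).
Proof.
move=> cv bv v0; have [C C0 HC] := tensor_poly_bounded p q.
have cn : continuous (fun x => `|v x|) by move=> z; apply: cvg_norm; exact: cv.
have H : (fun n => C * (n.+1%:R ^- 2 * box_int n.+1%:R (fun x => `|v x|))) @ \oo --> (0 : R).
  by rewrite -(mulr0 C); apply: cvgMr; exact: box_mean_vanishing.
apply/cvgr0Pnorm_lt => e e0; have /cvgrPdist_lt/(_ _ e0) := H.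
apply: filterS => n /=; rewrite sub0r normrN; apply: le_lt_trans.
apply: (le_trans _ (ler_norm _)).
have N0 : 0 < n.+1%:R :> R by rewrite ltr0n.
have iN0 : 0 <= n.+1%:R ^- 2 :> R by rewrite invr_ge0 exprn_ge0// ltW.
have cvT : continuous (fun x => v x * tensor_poly n.+1%:R p q x).
  by apply: continuousMf => //; exact: sm_continuous (sm_tensor_poly _ _ _).
rewrite normrM (ger0_norm iN0) mulrCA; apply: ler_wpM2l => //.
apply: (le_trans (box_int_abs _ cvT)); rewrite -box_intZ//.
apply: box_int_le.
- by move=> z; apply: cvg_norm; exact: cvT.
- exact: continuousZf.
- by move=> s t Ns Nt; rewrite normrM mulrC ler_wpM2r//; exact: HC.
Qed.

Lemma cvg_double_sum (a : 'I_2 -> 'I_2 -> nat -> R) (l : 'I_2 -> 'I_2 -> R) :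
  (forall i j, a i j @ \oo --> l i j) ->
  (fun n => \sum_i \sum_j a i j n) @ \oo --> \sum_i \sum_j l i j.
Proof.
move=> al; rewrite !sum2E (_ : (fun n => _) = fun n => (a 0 0 n + a 0 1 n) + (a 1 0 n + a 1 1 n)).
  by apply: cvgD; apply: cvgD; exact: al.
by apply/funext => n; rewrite !sum2E.
Qed.

(** The two sides of [box_pairing] in the limit [N -> +oo]. *)
Lemma mean_relation p q (f g : 'I_2 -> 'I_2 -> R * R -> R) v :
  flat 4 p -> flat 4 q ->
  (forall i j, sch (f i j)) -> (forall i j, sm (g i j)) -> sm v ->
  (forall i j, f i j = fun x => g i j x + pd i (pd j v) x) ->
  (forall x, \sum_i \sum_j pd i (pd j (g i j)) x = 0) ->
  (exists C : R, forall x, `|v x| <= C) -> v @ @at_infinity R --> (0 : R) ->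
  \sum_i \sum_j (hess_fst i j p).[0] * (hess_snd i j q).[0] * \int[mu2]_x f i j x = 0.
Proof.
move=> fp fq sf sg sv fE gE bv v0.
pose a n := \sum_i \sum_j box_int n.+1%:R (fun x => f i j x *
  tensor_poly n.+1%:R (hess_fst i j p) (hess_snd i j q) x).
have aE n : a n = \sum_i \sum_j n.+1%:R ^- 2 * box_int n.+1%:R (fun x => v x *
    tensor_poly n.+1%:R (hess_fst j i (hess_fst i j p)) (hess_snd j i (hess_snd i j q)) x).
  rewrite /a (box_pairing (ltr0Sn _ n) fp fq sg sv fE gE) mulr_sumr.
  by apply: eq_bigr => i _; rewrite mulr_sumr.
have a0 : a @ \oo --> (0 : R).
  have H := cvg_double_sum (fun i j => box_remainder_cvg0 (hess_fst j i (hess_fst i j p))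
    (hess_snd j i (hess_snd i j q)) (sm_continuous sv) bv v0).
  have E0 : \sum_(i < 2) \sum_(j < 2) (0 : R) = 0 by rewrite !sum2E !addr0.
  by rewrite E0 in H; rewrite (funext aE).
apply: (cvg_unique _ _ a0) => //.
by apply: cvg_double_sum => i j; exact: box_tensor_poly_cvg.
Qed.

Definition cutoff : {poly R} := (1 - 'X ^+ 2) ^+ 4.

Lemma flat_cutoff r : flat 4 (r * cutoff).
Proof. by exists r; rewrite mulrC. Qed.

Lemma cutoff_coef0 : cutoff`_0 = 1.
Proof.
by rewrite -horner_coef0 /cutoff horner_exp hornerD hornerN hornerXn hornerC expr0n subr0 expr1n.
Qed.

Lemma cutoff_coef1 : cutoff`_1 = 0.
Proof.
have := coef_deriv cutoff 0; rewrite mulr1n => <-.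
rewrite -horner_coef0 /cutoff deriv_exp derivB derivXn derivC sub0r.
by rewrite hornerMn hornerM hornerN hornerMn expr1 hornerX mul0rn oppr0 mul0r mul0rn.
Qed.

Lemma mean_zero_of_decomposition (f g : 'I_2 -> 'I_2 -> R * R -> R) v :
  (forall i j, sch (f i j)) -> f 0 1 = f 1 0 -> (forall i j, sm (g i j)) -> sm v ->
  (forall i j, f i j = fun x => g i j x + pd i (pd j v) x) ->
  (forall x, \sum_i \sum_j pd i (pd j (g i j)) x = 0) ->
  (exists C : R, forall x, `|v x| <= C) -> v @ @at_infinity R --> (0 : R) ->
  forall i j, \int[mu2]_x f i j x = 0.
Proof.
move=> sf fsym sg sv fE gE bv v0.
have H r s := mean_relation (flat_cutoff r) (flat_cutoff s) sf sg sv fE gE bv v0.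
(* Up to the second order at the origin, ['X * cutoff] and ['X ^+ 2 * cutoff]
   coincide with ['X] and ['X ^+ 2]. *)
have E := (horner_coef0, coef_deriv).
have c0 := cutoff_coef0; have c1 := cutoff_coef1.
have X1 : ('X * cutoff)`_1 = 1 by rewrite coefXM.
have X0 : ('X * cutoff)`_0 = 0 by rewrite coefXM.
have X2 : ('X * cutoff)`_2 = 0 by rewrite coefXM.
have XX2 : ('X ^+ 2 * cutoff)`_2 = 1 by rewrite coefXnM.
have XX1 : ('X ^+ 2 * cutoff)`_1 = 0 by rewrite coefXnM.
have XX0 : ('X ^+ 2 * cutoff)`_0 = 0 by rewrite coefXnM.
have H00 : \int[mu2]_x f 0 0 x = 0.
  have := H ('X ^+ 2) 1; rewrite !sum2E mul1r /hess_fst /hess_snd /deriv_if /= !E.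
  rewrite XX2 XX1 XX0 c0.
  by move: (Rintegral _ _ _) (Rintegral _ _ _) => a b; lra.
have H11 : \int[mu2]_x f 1 1 x = 0.
  have := H 1 ('X ^+ 2); rewrite !sum2E mul1r /hess_fst /hess_snd /deriv_if /= !E.
  rewrite XX2 XX1 XX0 c0.
  lra.
have H01 : \int[mu2]_x f 0 1 x = 0.
  have := H 'X 'X; rewrite !sum2E /hess_fst /hess_snd /deriv_if /= !E.
  rewrite X2 X1 X0 fsym.
  lra.
by move=> i j; elim/ord2P: i; elim/ord2P: j => //; rewrite -fsym.
Qed.

End Means.

(** * The biharmonic equation for tensor fields *)

Section Assembly.
Variable R : realType.
Local Notation mu := (@lebesgue_measure R).
Local Notation mu2 := (mu \x mu)%E.
Implicit Types (u v w : R * R -> R) (f g : R * R -> 'M[R]_2) (x : R * R) (i j k : 'I_2).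

Lemma symmetricmxP (A : 'M[R]_2) : A \is symmetricmx <-> forall i j, A i j = A j i.
Proof.
split=> [/is_hermitianmxP E i j|E].
  by rewrite {1}E expr0 scale1r !mxE.
by apply/is_hermitianmxP; apply/matrixP => i j; rewrite expr0 scale1r !mxE.
Qed.

Lemma grad_pd v x : grad v x = \row_i pd i v x.
Proof. by apply/matrixP => i j; rewrite !mxE !pdE. Qed.

Lemma divdiv_pd g x : divdiv g x = \sum_i \sum_j pd i (pd j (entry g i j)) x.
Proof. by apply: eq_bigr => i _; apply: eq_bigr => j _; rewrite !pdE. Qed.

Lemma divdiv_hess v x : sm v -> \sum_i \sum_j pd i (pd j (pd i (pd j v))) x = lap (lap v) x.
Proof.
move=> sv; rewrite !sum2E /lap.
have s0 := sm_pd 0 (sm_pd 0 sv); have s1 := sm_pd 1 (sm_pd 1 sv).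
rewrite !sm_pdD//; try exact: sm_pd.
by rewrite (sm_pdC 1 0 (sm_pd 1 sv)) (sm_pdC 0 1 (sm_pd 0 sv)).
Qed.

Lemma ler_sum_sqr (I : finType) (F G : I -> R) : 
  (forall l : I, 0 <= G l) -> (forall l : I, F l <= G l ^+ 2) ->
  \sum_l F l <= (\sum_l G l) ^+ 2.
Proof.
move=> G0 FG.
suff [] : \sum_l F l <= (\sum_l G l) ^+ 2 /\ 0 <= \sum_l G l by [].
elim/big_ind2: _ => [|a b c d [ab b0] [cd d0]|i _]; [by rewrite expr0n| |by []].
split; last exact: addr_ge0.
apply: (le_trans (lerD ab cd)); rewrite sqrrD.
have := mulr_ge0 b0 d0; lra.
Qed.

Lemma enorm_le_sum m n (A : 'M[R]_(m, n)) : enorm A <= \sum_i \sum_j `|A i j|.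
Proof.
have S0 : 0 <= \sum_i \sum_j `|A i j| by apply: sumr_ge0 => i _; exact: sumr_ge0.
rewrite -(ger0_norm S0) -sqrtr_sqr; apply: ler_wsqrtr.
apply: ler_sum_sqr => i; first exact: sumr_ge0.
by apply: ler_sum_sqr => // j; rewrite real_normK ?num_real.
Qed.

Lemma lesssim_enorm m n (d : nat) (A : R * R -> 'M[R]_(m, n)) :
  (forall (i : 'I_m) (j : 'I_n), decay d (fun x => A x i j)) ->
  lesssim (fun x => enorm (A x)) (fun x => (1 + abs2 x) ^- d).
Proof.
move=> dA.
have [C HC] := choice (fun ij : 'I_m * 'I_n => dA ij.1 ij.2).
exists (\sum_i \sum_j C (i, j)) => x.
have p0 : 0 < (1 + abs2 x) ^+ d by rewrite exprn_gt0// oneDabs2_gt0.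
apply: (le_trans (enorm_le_sum _)); rewrite mulr_suml; apply: ler_sum => i _.
rewrite mulr_suml; apply: ler_sum => j _.
by rewrite ler_pdivlMr// mulrC; exact: (HC (i, j)).
Qed.

Lemma lesssim_norm m u : decay m u -> lesssim (fun x => `|u x|) (fun x => (1 + abs2 x) ^- m).
Proof.
move=> [C HC]; exists C => x.
by rewrite ler_pdivlMr 1?mulrC// exprn_gt0// oneDabs2_gt0.
Qed.

Lemma decay_cvg0 m u : decay m.+1 u -> u @ @at_infinity R --> (0 : R).
Proof.
move=> [C HC]; apply/cvgr0Pnorm_lt => e e0; exists (C / e) => x Cx /=.
have a0 := abs2_ge0 x; have p0 := oneDabs2_gt0 x.
rewrite -(ltr_pM2l p0); apply: (@le_lt_trans _ _ C).
  apply: (le_trans _ (HC x)); rewrite ler_wpM2r// exprS ler_peMr ?(ltW p0)//.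
  by rewrite exprn_ege1// oneDabs2_ge1.
rewrite ltr_pdivrMr// in Cx; rewrite mulrDl mul1r.
by apply: (lt_trans Cx); rewrite ltrDr.
Qed.

Lemma cvg_mx0 g : (forall i j, entry g i j @ @at_infinity R --> (0 : R)) ->
  g @ @at_infinity R --> (0 : 'M[R]_2).
Proof.
move=> g0; apply/cvg_ballP => e e0.
have H i j : exists M : R, forall x, M < abs2 x -> `|entry g i j x| < e.
  have /cvgrPdist_lt/(_ _ e0)[M HM] := g0 i j.
  by exists M => x /HM /=; rewrite sub0r normrN.
have [M HM] := choice (fun ij : 'I_2 * 'I_2 => H ij.1 ij.2).
exists (\sum_i \sum_j `|M (i, j)|) => x Mx; split => // i j.
rewrite mxE /ball /= sub0r normrN; apply: (HM (i, j)); apply: le_lt_trans Mx.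
apply: (le_trans (ler_norm _)); rewrite (bigD1 i)//= (bigD1 j)//= -addrA lerDl.
by rewrite addr_ge0// sumr_ge0// => ? _; exact: sumr_ge0.
Qed.

Lemma sum2F (u : 'I_2 -> R * R -> R) : (fun x => \sum_i u i x) = fun x => u 0 x + u 1 x.
Proof. by apply/funext => x; rewrite sum2E. Qed.

Lemma sym_sum m (u : 'I_2 -> R * R -> R) : (forall i, sym m (u i)) -> sym m (fun x => \sum_i u i x).
Proof. by move=> su; rewrite sum2F; exact: symD. Qed.

Lemma lap_sum (u : 'I_2 -> R * R -> R) : (forall i, sm (u i)) ->
  lap (fun x => \sum_i u i x) = fun x => \sum_i lap (u i) x.
Proof. by move=> su; rewrite !sum2F lapD. Qed.

(** Writing the entries of [f] as divergences turns the right-hand side into a sum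
    of third derivatives of Schwartz functions, solved by [potential]. *)
Lemma bilap_solution (f : 'I_2 -> 'I_2 -> R * R -> R) :
  (forall i j, sch (f i j)) -> (forall i j, (\int[mu2]_x (f i j x)%:E = 0)%E) ->
  exists v, sym 1 v /\ forall x, lap (lap v) x = \sum_i \sum_j pd i (pd j (f i j)) x.
Proof.
move=> sf f0.
have [F HF] := choice (fun ij : 'I_2 * 'I_2 =>
  mean_zero_divergence (sf ij.1 ij.2) (f0 ij.1 ij.2)).
have sF i j k : sch (F (i, j) k) by have [+ _] := HF (i, j); apply.
have fE i j : f i j = fun x => \sum_k pd k (F (i, j) k) x.
  by rewrite sum2F; have [_ +] := HF (i, j).
have sP i j k := sym_potential i j k (sF i j k).
have sP1 i j := sym_sum (sP i j); have sP2 i := sym_sum (sP1 i).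
exists (fun x => \sum_i \sum_j \sum_k potential i j k (F (i, j) k) x); split.
  exact: sym_sum.
have L0 i j : lap (lap (fun x => \sum_k potential i j k (F (i, j) k) x)) = pd i (pd j (f i j)).
  rewrite !lap_sum => [|k|k]; [|exact: sm_lap (tame_sm (sP i j k))|exact: tame_sm (sP i j k)].
  rewrite fE !sum2F !sm_pdD; try by do 2?apply: sm_pd; exact: sch_sm.
  by rewrite !bilap_potential.
have L1 i : lap (lap (fun x => \sum_j \sum_k potential i j k (F (i, j) k) x)) =
    fun x => \sum_j pd i (pd j (f i j)) x.
  rewrite !lap_sum => [|j|j]; [|exact: sm_lap (tame_sm (sP1 i j))|exact: tame_sm (sP1 i j)].
  by apply/funext => x; apply: eq_bigr => j _; rewrite -L0.
move=> x; rewrite !lap_sum => [|i|i]; [|exact: sm_lap (tame_sm (sP2 i))|exact: tame_sm (sP2 i)].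
by apply: eq_bigr => i _; rewrite L1.
Qed.

End Assembly.

(** * Decaying decompositions *)

Section DecayingDecompositions.
Variable R : realType.
Local Notation mu := (@lebesgue_measure R).
Local Notation mu2 := (mu \x mu)%E.
Implicit Types (u v w : R * R -> R) (f g : R * R -> 'M[R]_2) (x : R * R) (i j k : 'I_2).

Lemma entry_decomposition f g v i j : (forall x, f x = g x + hess v x) ->
  entry f i j = fun x => entry g i j x + pd i (pd j v) x.
Proof.
by move=> fE; apply/funext => x; rewrite /entry fE !mxE !pdE.
Qed.

(** The Hessian of [v], a symbol of order [-1], decays like [|x|^-3], hence faster
    than what is required of [g]. *)
Lemma decaying_decomposition_exists f : schwartz_sym f -> mean_zero f ->
  exists v, decaying_decomposition f (fun x => f x - hess v x) v.
Proof.
move=> [f_sym /(_ _ _)/schP sf] f0.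
have [v [sv Lv]] := bilap_solution sf f0.
have mv := tame_sm sv; exists v; set g := fun x => f x - hess v x.
have gE i j : entry g i j = fun x => entry f i j x - pd i (pd j v) x.
  by apply/funext => x; rewrite /g /entry !mxE !pdE.
have v1 : decay 1 v := tame0 sv.
have dv i j : decay 3 (pd i (pd j v)) := tame_bound sv [:: i; j].
have dg i j : decay 2 (entry g i j).
  rewrite gE; apply: decayB; first exact: (rapid_decay 2 (sch_rapid (sf i j))).
  by apply: decay_weak; exact: dv.
split.
- split; last by apply/smP.
  split=> [x|i j].
    apply/symmetricmxP => i j; have /symmetricmxP/(_ i j) fs := f_sym x.
    by rewrite /g !mxE -!pdE fs (sm_pdC i j mv).
  by apply/smP; rewrite gE; apply: smB; [exact: sch_sm|do 2 apply: sm_pd].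
- split=> x; first by rewrite /g subrK.
  rewrite divdiv_pd.
  have E i j : pd i (pd j (entry g i j)) x =
      pd i (pd j (entry f i j)) x - pd i (pd j (pd i (pd j v))) x.
    have sj := sch_sm (sf i j); have vj : sm (pd i (pd j v)) by do 2 apply: sm_pd.
    by rewrite gE !sm_pdB//; exact: sm_pd.
  rewrite (eq_bigr _ (fun i _ => eq_bigr _ (fun j _ => E i j))).
  by rewrite (eq_bigr _ (fun i _ => sumrB _ _ _ _)) sumrB divdiv_hess// Lv subrr.
- split; last exact: (decay_cvg0 v1).
  by apply: cvg_mx0 => i j; exact: (decay_cvg0 (dg i j)).
- exact: lesssim_enorm.
- split; first by apply: lesssim_norm; exact: decay_weak v1.
  apply: lesssim_enorm => i j; rewrite (_ : (fun x => _) = pd j v).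
    by apply: decay_weak; exact: (tame_bound sv [:: j]).
  by apply/funext => x; rewrite grad_pd mxE.
Qed.

(** The difference [w] of the potentials has a Hessian equal to the difference of
    the fields [g' - g]: this makes [w] biharmonic, and [lap w] vanish at infinity. *)
Lemma decaying_decomposition_unique f g g' v v' :
  decaying_decomposition f g v -> decaying_decomposition f g' v' -> v = v'.
Proof.
move=> [[[_ sg] sv] [fE gE] [g0 v0] _ _] [[[_ sg'] sv'] [fE' gE'] [g0' v0'] _ _].
have {}sg i j := proj1 (smP _) (sg i j).
have {}sg' i j := proj1 (smP _) (sg' i j).
move/smP in sv; move/smP in sv'.
have hE i j x : entry g' i j x - entry g i j x = pd i (pd j v) x - pd i (pd j v') x.
  have := congr1 (@^~ x) (entry_decomposition i j fE).
  rewrite (entry_decomposition i j fE') /= => E; lra.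
pose w x := v x - v' x.
have sw : sm w by exact: smB.
have wE i j : pd i (pd j w) = fun x => entry g' i j x - entry g i j x.
  apply/funext => x; rewrite hE /w !sm_pdB//; exact: sm_pd.
have g0E i j : entry g i j @ @at_infinity R --> (0 : R).
  have -> : (0 : R) = (0 : 'M[R]_2) i j by rewrite mxE.
  exact: (cvg_comp _ _ g0 (@coord_continuous _ _ _ i j 0)).
have g0E' i j : entry g' i j @ @at_infinity R --> (0 : R).
  have -> : (0 : R) = (0 : 'M[R]_2) i j by rewrite mxE.
  exact: (cvg_comp _ _ g0' (@coord_continuous _ _ _ i j 0)).
have w0 : forall x, w x = 0.
  apply: biharmonic_vanishing => //.
  - move=> x; rewrite -divdiv_hess//.
    have E i j : pd i (pd j (pd i (pd j w))) x =
        pd i (pd j (entry g' i j)) x - pd i (pd j (entry g i j)) x.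
      by rewrite wE !sm_pdB//; exact: sm_pd.
    rewrite (eq_bigr _ (fun i _ => eq_bigr _ (fun j _ => E i j))).
    rewrite (eq_bigr _ (fun i _ => sumrB _ _ _ _)) sumrB -!divdiv_pd.
    by rewrite gE gE' subrr.
  - rewrite /lap !wE -[X in _ --> X](addr0 (0 : R)) -{1 2}(subrr (0 : R)).
    by apply: cvgD; apply: cvgB; first [exact: g0E|exact: g0E'].
  - rewrite -(subrr (0 : R)); exact: cvgB.
by apply/funext => x; apply/eqP; rewrite -subr_eq0; apply/eqP; exact: w0.
Qed.

Lemma mean_zero_of_decaying_decomposition f g v :
  schwartz_sym f -> decaying_decomposition f g v -> mean_zero f.
Proof.
move=> [f_sym /(_ _ _)/schP sf] [[[_ sg] sv] [fE gE] [_ v0] _ [[C HC] _]] i j.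
have fi : mu2.-integrable setT (EFin \o entry f i j).
  by rewrite -setXTT; exact: integrable_sch_plane.
have fin := integrable_fin_num measurableT fi.
suff : \int[mu2]_x entry f i j x = 0 by rewrite /Rintegral => E; rewrite -(fineK fin) E.
apply: (@mean_zero_of_decomposition _ (entry f) (entry g) v) => //.
- by apply/funext => x; have /symmetricmxP := f_sym x; apply.
- by move=> ? ?; exact: (proj1 (smP _) (sg _ _)).
- by apply/smP.
- by move=> ? ?; exact: entry_decomposition.
- by move=> x; rewrite -divdiv_pd.
- by exists C => x; have := HC x; rewrite expr0 invr1 mulr1.
Qed.

End DecayingDecompositions.

Theorem theorem3 (R : realType) (f : R * R -> 'M[R]_2)
  (f_schwartz : schwartz_sym f) :
  mean_zero f <->
  exists! gv : (R * R -> 'M[R]_2) * (R * R -> R),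
    decaying_decomposition f gv.1 gv.2.
Proof.
split=> [f0|[[g v] [fgv _]]]; last exact: mean_zero_of_decaying_decomposition fgv.
have [v fv] := decaying_decomposition_exists f_schwartz f0.
exists (fun x => f x - hess v x, v); split=> // -[g' v'] /= fgv'.
have vv' := decaying_decomposition_unique fv fgv'.
rewrite -{}vv' in fgv' *; congr pair; apply/funext => x.
by have [_ [-> _] _ _ _] := fgv'; rewrite addrK.
Qed.
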